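(* Let $X$ be any connected generating set for $\Gamma$, and let $\rho:\Gamma\to\mathrm{Sp}(V)$ be a representation admitting a maximal framing, where $V$ is a symplectic vector space over a real closed field $\mathbb F$ with order compatible valuation. The following are equivalent: (1) $\rho$ has a global fixed point in the affine building $\mathcal B_V$; (2) $L_{\mathcal B}(\rho(s))=0$ for all $s\in X$.
   Context: Surface: $\Sigma$ is an oriented surface of genus $g$ with $p\ge 0$ punctures, endowed with a complete hyperbolic metric of finite area; $\Gamma=\pi_1(\Sigma)$ is identified with a discrete subgroup of $\mathrm{PSL}(2,\mathbb R)$ with $\Sigma=\Gamma\backslash\mathbb H^2$. A generating set $X$ of $\Gamma$ (consisting of hyperbolic elements) is connected if the graph with vertex set $X$, whose edges are the pairs $(s_1,s_2)$ of elements of $X$ whose axes in $\mathbb H^2$ intersect, is connected. Order compatible valuation: $v:\mathbb F\to\mathbb R\cup\{\infty\}$ a valuation with $v(y)\le v(x)$ whenever $0\le x\le y$. $\mathcal B_V$ is the affine Bruhat–Tits building associated to $\mathrm{Sp}(V)$, with its invariant CAT(0) distance $d_{\mathcal B}$, and $L_{\mathcal B}(g)=\inf_{x\in\mathcal B_V}d_{\mathcal B}(gx,x)$ is the translation length of $g\in\mathrm{Sp}(V)$. Maximal triples: for pairwise transverse Lagrangians $l_1,l_2,l_3\in\mathcal L(V)$ and $v\in l_1$ let $T(v)\in l_3$ be the unique vector with $v+T(v)\in l_2$; the triple is maximal if the quadratic form $v\mapsto\langle v,T(v)\rangle$ on $l_1$ is positive definite. Maximal framing: $\rho$ admits a maximal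 framing if there is a $\rho$-equivariant map $\phi:S\to\mathcal L(V)$, with $S\subseteq\partial\mathbb H^2$ a $\Gamma$-invariant subset containing all fixed points of hyperbolic elements of $\Gamma$, such that for every positively oriented triple $(x,y,z)$ in $S$ the triple $(\phi(x),\phi(y),\phi(z))$ is maximal. *)

(* Defs.v *)
From HB Require Import structures.
From Stdlib Require Import Relation_Operators.
From mathcomp Require Import all_boot all_order all_algebra.
From mathcomp Require Import complex.
From mathcomp Require Import all_classical all_reals all_analysis.
Import Order.TTheory GRing.Theory Num.Theory.
Import numFieldNormedType.Exports.

Set Implicit Arguments.
Unset Strict Implicit.
Unset Printing Implicit Defensive.

Local Open Scope classical_set_scope.
Local Open Scope ring_scope.
Local Open Scope quotient_scope.
Local Open Scope complex_scope.

Section PSL2.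
Variable R : realType.

Record SL2 := MkSL2 { SL2val :> 'M[R]_2; SL2valP : \det SL2val == 1 }.

HB.instance Definition _ := [isSub for SL2val].
HB.instance Definition _ := [Choice of SL2 by <:].

Lemma SL2_unit (A : SL2) : (A : 'M[R]_2) \in unitmx.
Proof. by rewrite unitmxE (eqP (SL2valP A)) unitr1. Qed.

Lemma SL2_one_subproof : \det (1%:M : 'M[R]_2) == 1.
Proof. by rewrite det1. Qed.

Lemma SL2_mul_subproof (A B : SL2) : \det (A *m B) == 1.
Proof. by rewrite det_mulmx (eqP (SL2valP A)) (eqP (SL2valP B)) mulr1. Qed.

Lemma SL2_inv_subproof (A : SL2) : \det (invmx A) == 1.
Proof. by rewrite det_inv (eqP (SL2valP A)) invr1. Qed.

Definition SL2_one : SL2 := MkSL2 SL2_one_subproof.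
Definition SL2_mul (A B : SL2) : SL2 := MkSL2 (SL2_mul_subproof A B).
Definition SL2_inv (A : SL2) : SL2 := MkSL2 (SL2_inv_subproof A).

Definition pm_eq (A B : SL2) : bool :=
  (A == B :> 'M[R]_2) || (A == - (B : 'M[R]_2) :> 'M[R]_2).

Lemma pm_eq_equiv : equiv_class_of pm_eq.
Proof.
rewrite /pm_eq; split => [A|A B|B A C]; first by rewrite eqxx.
  by apply/idP/idP => /orP[] /eqP ->; rewrite ?opprK eqxx ?orbT.
by case/orP=> /eqP-> /orP[] /eqP->; rewrite ?opprK eqxx ?orbT.
Qed.

Canonical pm_equiv := EquivRelPack pm_eq_equiv.

Definition PSL2 := {eq_quot pm_equiv}.

HB.instance Definition _ := Choice.on PSL2.
HB.instance Definition _ : EqQuotient SL2 pm_eq PSL2 := EqQuotient.on PSL2.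

Lemma PSL2_eqP (A B : SL2) : reflect (\pi_PSL2 A = \pi_PSL2 B) (pm_eq A B).
Proof. exact: eqmodP. Qed.

Lemma pi_pm (A : SL2) : pm_eq (repr (\pi_PSL2 A)) A.
Proof. by apply/PSL2_eqP; rewrite reprK. Qed.

Definition PSL2_one : PSL2 := \pi_PSL2 SL2_one.
Definition PSL2_mul (p q : PSL2) : PSL2 := \pi_PSL2 (SL2_mul (repr p) (repr q)).
Definition PSL2_inv (p : PSL2) : PSL2 := \pi_PSL2 (SL2_inv (repr p)).

Lemma pi_mul (A B : SL2) :
  PSL2_mul (\pi_PSL2 A) (\pi_PSL2 B) = \pi_PSL2 (SL2_mul A B).
Proof.
apply/PSL2_eqP; rewrite /pm_eq /=.
have /orP[/eqP->|/eqP->] := pi_pm A; have /orP[/eqP->|/eqP->] := pi_pm B;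
  by rewrite ?mulNmx ?mulmxN ?opprK eqxx ?orbT.
Qed.

Lemma pi_inv (A : SL2) : PSL2_inv (\pi_PSL2 A) = \pi_PSL2 (SL2_inv A).
Proof.
apply/PSL2_eqP; rewrite /pm_eq /=.
have /orP[/eqP->|/eqP->] := pi_pm A; rewrite ?eqxx //.
have -> : invmx (- (A : 'M[R]_2)) = - invmx A.
  rewrite -scaleN1r invmxZ ?invrN ?invr1 ?scaleN1r //.
  by rewrite -scaleN1r unitmxZ ?unitrN1 ?SL2_unit.
by rewrite eqxx orbT.
Qed.

Lemma PSL2_mulA : associative PSL2_mul.
Proof.
move=> p q r; rewrite -[p]reprK -[q]reprK -[r]reprK.
move: (repr p) (repr q) (repr r) => A B C.
rewrite (pi_mul B C) (pi_mul A _) (pi_mul A B) (pi_mul _ C).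
by congr \pi_PSL2; apply: val_inj => /=; rewrite mulmxA.
Qed.

Lemma PSL2_mul1 : left_id PSL2_one PSL2_mul.
Proof.
move=> p; rewrite -[p]reprK; move: (repr p) => A; rewrite pi_mul.
by congr \pi_PSL2; apply: val_inj => /=; rewrite mul1mx.
Qed.

Lemma PSL2_mulr1 : right_id PSL2_one PSL2_mul.
Proof.
move=> p; rewrite -[p]reprK; move: (repr p) => A; rewrite pi_mul.
by congr \pi_PSL2; apply: val_inj => /=; rewrite mulmx1.
Qed.

Lemma PSL2_mulV : left_inverse PSL2_one PSL2_inv PSL2_mul.
Proof.
move=> p; rewrite -[p]reprK; move: (repr p) => A; rewrite pi_inv pi_mul.
by congr \pi_PSL2; apply: val_inj => /=; rewrite mulVmx // SL2_unit.
Qed.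

Lemma PSL2_mulrV : right_inverse PSL2_one PSL2_inv PSL2_mul.
Proof.
move=> p; rewrite -[p]reprK; move: (repr p) => A; rewrite pi_inv pi_mul.
by congr \pi_PSL2; apply: val_inj => /=; rewrite mulmxV // SL2_unit.
Qed.

HB.instance Definition _ := isGroup.Build PSL2
  PSL2_mulA PSL2_mul1 PSL2_mulr1 PSL2_mulV PSL2_mulrV.

End PSL2.

Section HyperbolicPlane.
Variable R : realType.

(* upper half-plane model *)
Definition H2 : set R[i] := [set z | 0 < complex.Im z].

Definition moebius_mx (A : 'M[R]_2) (z : R[i]) : R[i] :=
  ((A 0 0)%:C * z + (A 0 1)%:C) / ((A 1 0)%:C * z + (A 1 1)%:C).

(* Independent of the chosen representative, by pi_moebius below. *)
Definition moebius (p : PSL2 R) (z : R[i]) : R[i] := moebius_mx (repr p) z.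

(* The boundary of the half-plane is R together with infinity (None). *)
Definition boundary_mx (A : 'M[R]_2) (x : option R) : option R :=
  match x with
  | None => if A 1 0 == 0 then None else Some (A 0 0 / A 1 0)
  | Some t => if A 1 0 * t + A 1 1 == 0 then None
              else Some ((A 0 0 * t + A 0 1) / (A 1 0 * t + A 1 1))
  end.

Definition boundary_act (p : PSL2 R) (x : option R) : option R :=
  boundary_mx (repr p) x.

Definition hyperbolic (p : PSL2 R) : Prop := 2 < `|\tr (repr p : 'M[R]_2)|.

Lemma pi_moebius (A : SL2 R) : moebius (\pi_(PSL2 R) A) = moebius_mx A.
Proof.
apply/funext => z; rewrite /moebius; have /orP[/eqP->//|/eqP->] := pi_pm A.
by rewrite /moebius_mx !mxE !raddfN /= !mulNr -!opprD invrN mulrNN.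
Qed.

Lemma pi_boundary (A : SL2 R) :
  boundary_act (\pi_(PSL2 R) A) = boundary_mx A.
Proof.
apply/funext => -[t|]; rewrite /boundary_act;
  have /orP[/eqP->//|/eqP->] := pi_pm A; rewrite /boundary_mx !mxE.
  by rewrite !mulNr -!opprD oppr_eq0 invrN mulrNN.
by rewrite oppr_eq0 invrN mulrNN.
Qed.

Lemma pi_hyperbolic (A : SL2 R) :
  hyperbolic (\pi_(PSL2 R) A) = (2 < `|\tr (A : 'M[R]_2)|).
Proof.
by rewrite /hyperbolic; have /orP[/eqP->//|/eqP->] := pi_pm A; rewrite raddfN normrN.
Qed.

(* Counterclockwise order on the boundary: increasing order on R, with
   infinity as the largest element, up to cyclic permutation. *)
Definition boundary_lt (x y : option R) : bool :=
  match x, y with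
  | Some s, Some t => s < t
  | Some _, None => true
  | None, _ => false
  end.

Definition positively_oriented (x y z : option R) : bool :=
  [|| boundary_lt x y && boundary_lt y z,
      boundary_lt y z && boundary_lt z x |
      boundary_lt z x && boundary_lt x y].

(* The geodesic with endpoints x and y: a half-line or a half-circle orthogonal
   to the real line. *)
Definition geodesic (x y : option R) : set R[i] :=
  match x, y with
  | Some s, Some t => H2 `&` [set z |
      (complex.Re z - (s + t) / 2) ^+ 2 + complex.Im z ^+ 2
        = ((s - t) / 2) ^+ 2]
  | Some s, None | None, Some s => H2 `&` [set z | complex.Re z = s]
  | None, None => set0
  end.

(* For hyperbolic p: x and y are then the two fixed points of p. *)
Definition axis (p : PSL2 R) : set R[i] :=
  [set z | exists x y : option R,
     [/\ x != y, boundary_act p x = x, boundary_act p y = y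
       & geodesic x y z]].

End HyperbolicPlane.

Section SurfaceGroup.
Variables (R : realType) (Gamma : groupType).
Variable iota : {multiplicative Gamma -> PSL2 R}.

(* 1 is isolated in the preimage of the image of Gamma in SL(2, R); as the
   kernel {1, -1} is finite, this is discreteness in PSL(2, R). *)
Definition discrete_image : Prop :=
  exists2 e : R, 0 < e &
    forall A : SL2 R, range iota (\pi_(PSL2 R) A) ->
      `|(A : 'M[R]_2) - 1%:M| < e -> A = 1%:M :> 'M[R]_2.

Definition acts_freely : Prop :=
  forall (g : Gamma) z, H2 z -> moebius (iota g) z = z -> g = 1%g.

(* a measurable set of representatives of the orbits of Gamma in the
   half-plane; it has the area of the quotient *)
Definition fundamental_domain (D : set (R * R)) : Prop :=
  [/\ measurable D,
      (forall p, D p -> H2 (p.1 +i* p.2)) &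
      forall z, H2 z ->
        exists! p, D p /\ exists g : Gamma, moebius (iota g) z = p.1 +i* p.2].

Definition hyperbolic_area (D : set (R * R)) : \bar R :=
  (\int[lebesgue_measure \x lebesgue_measure]_(p in D) ((p.2 ^+ 2)^-1)%:E)%E.

(* iota identifies Gamma with a discrete subgroup of PSL(2, R) such that
   Gamma \ H2 is a surface with fundamental group Gamma, and its complete
   hyperbolic metric has finite area; such a surface is of finite type. *)
Definition surface_group : Prop :=
  [/\ injective iota, discrete_image, acts_freely
    & exists2 D, fundamental_domain D & (hyperbolic_area D < +oo)%E].

Definition generates (X : set Gamma) : Prop :=
  forall H : set Gamma,
    H 1%g -> (forall g h, H g -> H h -> H (g * h)%g) ->
    (forall g, H g -> H g^-1%g) -> X `<=` H -> H = setT.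

Definition crossing (X : set Gamma) (s1 s2 : Gamma) : Prop :=
  [/\ X s1, X s2 & axis (iota s1) `&` axis (iota s2) !=set0].

Definition connected_generating_set (X : set Gamma) : Prop :=
  [/\ generates X, (forall s, X s -> hyperbolic (iota s))
    & forall s1 s2, X s1 -> X s2 -> clos_refl_trans Gamma (crossing X) s1 s2].

End SurfaceGroup.

Section Symplectic.
Variables (F : rcfType) (V : vectType F) (omega : {skew_symmetric V}).

Definition half_dim : nat := (\dim {:V})./2.

Definition lagrangian (l : {vspace V}) : Prop :=
  {in l &, forall u w, omega u w = 0} /\ \dim l = half_dim.

Definition transverse (l1 l2 : {vspace V}) : Prop := (l1 :&: l2 = 0)%VS.

(* By transversality each u in l1 has exactly one w = T u in l3 with
   u + w in l2. *)
Definition maximal_triple (l1 l2 l3 : {vspace V}) : Prop :=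
  [/\ lagrangian l1, lagrangian l2 & lagrangian l3] /\
  [/\ transverse l1 l2, transverse l2 l3 & transverse l1 l3] /\
  (forall u w, u \in l1 -> u != 0 -> w \in l3 -> u + w \in l2 ->
     0 < omega u w).

Definition symplectic_representation (Gamma : groupType)
    (rho : Gamma -> 'End(V)) : Prop :=
  (forall g u w, omega (rho g u) (rho g w) = omega u w) /\
  (forall g h, rho (g * h)%g = (rho g \o rho h)%VF).

Definition maximal_framing (R : realType) (Gamma : groupType)
    (iota : Gamma -> PSL2 R) (rho : Gamma -> 'End(V))
    (S : set (option R)) (phi : option R -> {vspace V}) : Prop :=
  [/\ (forall g x, S x -> S (boundary_act (iota g) x)),
      (forall g x, hyperbolic (iota g) -> boundary_act (iota g) x = x -> S x),
      (forall x, S x -> lagrangian (phi x)),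
      (forall g x, S x ->
         phi (boundary_act (iota g) x) = (rho g @: phi x)%VS) &
      forall x y z, S x -> S y -> S z -> positively_oriented x y z ->
        maximal_triple (phi x) (phi y) (phi z)].

Definition admits_maximal_framing (R : realType) (Gamma : groupType)
    (iota : Gamma -> PSL2 R) (rho : Gamma -> 'End(V)) : Prop :=
  exists S phi, maximal_framing iota rho S phi.

End Symplectic.

Section Building.
Variables (R : realType) (F : rcfType).

Record order_compatible_valuation (v : F -> \bar R) : Prop := {
  valuation_neqNy : forall x, v x <> -oo%E;
  valuation_eqy : forall x, v x = +oo%E <-> x = 0;
  valuationM : forall x y, v (x * y)%R = (v x + v y)%E;
  valuationD : forall x y, (mine (v x) (v y) <= v (x + y)%R)%E;
  valuation_order : forall x y, 0 <= x -> x <= y -> (v y <= v x)%E }.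

Variables (v : F -> \bar R) (V : vectType F) (omega : {skew_symmetric V}).

Local Notation n := (half_dim V).

Definition symplectic_basis (e f : 'I_n -> V) : Prop :=
  [/\ basis_of {:V} (codom e ++ codom f),
      (forall i j, omega (e i) (e j) = 0),
      (forall i j, omega (f i) (f j) = 0) &
      (forall i j, omega (e i) (f j) = (i == j)%:R)].

(* eta is the norm (in logarithmic form) split by the symplectic basis (e, f),
   with value t i at e i and - t i at f i. *)
Definition split_norm (e f : 'I_n -> V) (t : 'I_n -> R)
    (eta : V -> \bar R) : Prop :=
  forall x y : 'I_n -> F,
    eta (\sum_(i < n) (x i *: e i + y i *: f i)) =
    (\big[mine/+oo]_(i < n)
       mine (v (x i) + (t i)%:E) (v (y i) - (t i)%:E))%E.

(* The affine Bruhat-Tits building of Sp(V), realized as the set of self-dual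
   splittable norms on V: it is the union of the apartments attached to the
   symplectic bases of V, the point t of R^n in the apartment of (e, f) being
   the norm of split_norm e f t. *)
Definition building : set (V -> \bar R) :=
  [set eta | exists e f t, symplectic_basis e f /\ split_norm e f t eta].

Definition building_act (g : 'End(V)) (eta : V -> \bar R) : V -> \bar R :=
  fun u => eta ((g^-1)%VF u).

(* The Euclidean distance in a common apartment. Any two points have one and
   the value does not depend on it, so the infimum is taken over a singleton. *)
Definition building_dist (eta mu : V -> \bar R) : \bar R :=
  ereal_inf [set d | exists e f t s,
    [/\ symplectic_basis e f, split_norm e f t eta, split_norm e f s mu
      & d = (Num.sqrt (\sum_(i < n) (t i - s i) ^+ 2))%:E]].

Definition translation_length (g : 'End(V)) : \bar R :=
  ereal_inf [set building_dist (building_act g eta) eta | eta in building].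

End Building.

(* Main.v *)
Require Import Defs.
From HB Require Import structures.
From mathcomp Require Import all_boot all_order all_algebra.
From mathcomp Require Import complex ring lra.
From mathcomp Require Import all_classical all_reals all_analysis.
Import Order.TTheory GRing.Theory Num.Theory.
Import numFieldNormedType.Exports.

Set Implicit Arguments.
Unset Strict Implicit.
Unset Printing Implicit Defensive.

Local Open Scope classical_set_scope.
Local Open Scope ring_scope.

(** Why the theorem is true.

    A fixed point makes every translation length vanish at once. For the
    converse, read the coordinates of [V] in a Darboux basis [(e, f)] adapted
    to a maximal triple [phi a, phi c, phi b]: [e] spans [phi a], [f] spans
    [phi b] and the vectors [e i + f i] span [phi c]. Such a basis comes from a
    Cholesky factorization, and it defines a point of the building, the
    barycenter of the triple. In this chart [phi x] is the graph of a symmetric matrix, equal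
    to 0 at [a] and to 1 at [c], and maximality says that this matrix increases
    with [x] (graph_mono).

    Let [s] fix [a] and [b] and have zero translation length. On [phi a] it acts
    by a matrix [A] whose powers have entries of valuation at least [C - k eps]
    for every [eps > 0], so [det A] is a unit of the valuation ring
    (acts_by_det). Since [s] moves [c] forward or backward, [A] or its inverse
    contracts the standard quadratic form, so one of them, hence both, have
    integral entries (zero_length_integral): a sum of squares bounded by 1 has
    integral terms. Therefore [s] fixes the barycenter. Any [y] on the same side
    of the axis lies between two translates of [c], so the barycenter does not
    depend on the point chosen on that side (barycenter_move).

    When the axes of [s1] and [s2] cross, with endpoints [a, c, b, d] in cyclic
    order, [phi d] is the graph of some [- T] with [T] positive definite. Moving
    [b] towards [d] by powers of [s2], and comparing with the translates of [d]
    by [s1], shows that the inverse of [T] is integral (crossing_half). The same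
    statement with the two axes exchanged bounds the trace of [T], so [T] is
    integral as well, and the triples of [a, c, b, d] all have one barycenter
    (crossing_barycenter). The two sides of both axes thus share it, and it
    propagates along the connected graph to a point fixed by all generators
    (linked_axes_fixed).

    Without generators [Gamma] is trivial. If there are some but no two axes
    cross transversally, all generators have the same axis. Then
    [Gamma] is cyclic by discreteness (elementary_cyclic), and its generator
    preserves the Lagrangian [phi a] of an endpoint of that axis, where it acts
    by a matrix with eigenvalues of absolute value of valuation 0. Such a matrix
    preserves a lattice (slow_lattice); the lattice and its dual define a fixed
    norm on [V] once the lattice is given enough weight (lagrangian_fixed). *)

(** * Integral elements and integral matrices *)

Section Valuation.
Variables (R : realType) (F : rcfType) (v : F -> \bar R).
Hypothesis hv : order_compatible_valuation v.

Definition integral (x : F) : Prop := (0 <= v x)%E.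

Lemma val0 : v 0 = +oo%E.
Proof. by apply/(valuation_eqy hv). Qed.

Lemma val_fin x : x != 0 -> v x \is a fin_num.
Proof.
move=> x0; rewrite fin_numE; apply/andP; split; apply/eqP.
  exact: valuation_neqNy hv x.
by move/(valuation_eqy hv)/eqP; apply/negP.
Qed.

Lemma val1 : v 1 = 0%E.
Proof.
have := valuationM hv 1 1; rewrite mulr1.
have /fineK <- := val_fin (oner_neq0 F).
by rewrite -EFinD => -[h]; congr (_%:E); lra.
Qed.

Lemma valN x : v (- x) = v x.
Proof.
rewrite -mulN1r (valuationM hv); suff -> : v (- 1) = 0%E by rewrite add0e.
have := valuationM hv (-1) (-1); rewrite mulrNN mulr1 val1.
have n0 : (-1 : F) != 0 by rewrite oppr_eq0 oner_neq0.
have /fineK <- := val_fin n0.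
by rewrite -EFinD => -[h]; congr (_%:E); lra.
Qed.

Lemma valV x : x != 0 -> v x^-1 = (- v x)%E.
Proof.
move=> x0; have := valuationM hv x x^-1; rewrite divff // val1.
have /fineK <- := val_fin x0.
have xV0 : x^-1 != 0 by rewrite invr_eq0.
have /fineK <- := val_fin xV0.
by rewrite -EFinD -EFinN => -[h]; congr (_%:E); lra.
Qed.

Lemma val_norm x : v `|x| = v x.
Proof. by case: (ger0P x) => // _; rewrite valN. Qed.

Lemma val_le x y : `|x| <= `|y| -> (v y <= v x)%E.
Proof.
by move=> xy; rewrite -(val_norm x) -(val_norm y); apply: valuation_order hv _ _ _ _.
Qed.

Lemma valD_ge c x y : (c <= v x)%E -> (c <= v y)%E -> (c <= v (x + y))%E.
Proof.
move=> cx cy; apply: le_trans (valuationD hv x y).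
by rewrite le_min cx cy.
Qed.

Lemma val_sum_ge c (I : Type) (r : seq I) (P : pred I) (E : I -> F) :
  (forall i, P i -> (c <= v (E i))%E) -> (c <= v (\sum_(i <- r | P i) E i)%R)%E.
Proof.
move=> h; apply: (big_ind (fun x => (c <= v x)%E)) => //.
  by rewrite val0 leey.
exact: valD_ge.
Qed.

Lemma valX x k : x != 0 -> v (x ^+ k) = (k%:R * fine (v x))%:E.
Proof.
move=> x0; elim: k => [|k IHk]; first by rewrite expr0 val1 mul0r.
rewrite exprS (valuationM hv) IHk -{1}(fineK (val_fin x0)) -EFinD.
by congr (_%:E); rewrite -natr1 mulrDl mul1r addrC.
Qed.

Lemma integral0 : integral 0. Proof. by rewrite /integral val0 leey. Qed.
Lemma integral1 : integral 1. Proof. by rewrite /integral val1. Qed.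

Lemma integralN x : integral x -> integral (- x).
Proof. by rewrite /integral valN. Qed.

Lemma integralD x y : integral x -> integral y -> integral (x + y).
Proof. exact: valD_ge. Qed.

Lemma integralM x y : integral x -> integral y -> integral (x * y).
Proof. by rewrite /integral (valuationM hv) => ? ?; apply: adde_ge0. Qed.

Lemma integral_sum (I : Type) (r : seq I) (P : pred I) (E : I -> F) :
  (forall i, P i -> integral (E i)) -> integral (\sum_(i <- r | P i) E i).
Proof. exact: val_sum_ge. Qed.

Lemma integral_le x y : `|x| <= `|y| -> integral y -> integral x.
Proof. by move=> /val_le xy /le_trans; apply. Qed.

(** Order compatibility does it: either [x] is at most 1 in absolute value, or
    it is dominated by its square. *)
Lemma integral_sqr x : integral (x ^+ 2) -> integral x.
Proof.
case: (ltP `|x| 1) => [/ltW x1 _|x1].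
  by apply: integral_le integral1; rewrite normr1.
by apply: integral_le; rewrite normrX expr2 ler_peMr.
Qed.

Lemma val_prod_ge c (I : Type) (r : seq I) (E : I -> F) :
  (forall i, (c%:E <= v (E i))%E) ->
  (((size r)%:R * c)%:E <= v (\prod_(i <- r) E i)%R)%E.
Proof.
move=> h; elim: r => [|i r IHr]; first by rewrite big_nil val1 mul0r.
rewrite big_cons (valuationM hv) /= -natr1 mulrDl mul1r EFinD addeC.
exact: leeD.
Qed.

Lemma val_det_ge c n (A : 'M[F]_n) :
  (forall i j, (c%:E <= v (A i j))%E) -> ((n%:R * c)%:E <= v (\det A))%E.
Proof.
move=> h; apply: val_sum_ge => s _.
rewrite (valuationM hv) -[leLHS]add0e; apply: leeD.
  by case: (perm.odd_perm s); rewrite ?expr1 ?valN ?val1.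
have := @val_prod_ge c _ (index_enum 'I_n) _ (fun i => h i (perm.fun_of_perm s i)).
have -> : size (index_enum 'I_n) = n.
  by rewrite [index_enum _]unlock -enumT size_enum_ord.
exact.
Qed.

Definition integralmx m n (A : 'M[F]_(m, n)) : Prop :=
  forall i j, integral (A i j).

Lemma integralmx1 n : integralmx (1%:M : 'M[F]_n).
Proof. by move=> i j; rewrite mxE; case: eqP => _; [exact: integral1|exact: integral0]. Qed.

Lemma integralmxN m n (A : 'M[F]_(m, n)) : integralmx A -> integralmx (- A).
Proof. by move=> hA i j; rewrite mxE; apply: integralN. Qed.

Lemma integralmxD m n (A B : 'M[F]_(m, n)) :
  integralmx A -> integralmx B -> integralmx (A + B).
Proof. by move=> hA hB i j; rewrite mxE; apply: integralD. Qed.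

Lemma integralmxB m n (A B : 'M[F]_(m, n)) :
  integralmx A -> integralmx B -> integralmx (A - B).
Proof. by move=> hA hB; apply/integralmxD/integralmxN. Qed.

Lemma integralmxM m n p (A : 'M[F]_(m, n)) (B : 'M[F]_(n, p)) :
  integralmx A -> integralmx B -> integralmx (A *m B).
Proof. by move=> hA hB i j; rewrite mxE; apply: integral_sum => k _; apply: integralM. Qed.

Lemma integralmx_tr m n (A : 'M[F]_(m, n)) : integralmx A -> integralmx A^T.
Proof. by move=> hA i j; rewrite mxE. Qed.

Lemma integral_det n (A : 'M[F]_n) : integralmx A -> integral (\det A).
Proof.
move=> hA; have := @val_det_ge 0 n A; rewrite mulr0; apply => i j.
exact: hA.
Qed.

(** The adjugate is integral and the determinant is a unit. *)
Lemma integralmx_inv n (A : 'M[F]_n) :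
  integralmx A -> v (\det A) = 0%E -> integralmx (invmx A).
Proof.
move=> hA d0; have dA : \det A != 0.
  by apply/eqP => d; move: d0; rewrite d val0.
rewrite /invmx unitmxE unitfE dA => i j; rewrite !mxE; apply: integralM.
  by rewrite /integral valV // d0 oppe0.
rewrite /cofactor; apply: integralM; last first.
  by apply: integral_det => k l; rewrite !mxE.
rewrite /integral; elim: (_ + _)%N => [|k IHk]; first by rewrite expr0 val1.
by rewrite exprS mulN1r valN.
Qed.

(** This is [GL_n] of the valuation ring. *)
Definition integral_unitmx n (A : 'M[F]_n) : Prop :=
  [/\ A \in unitmx, integralmx A & integralmx (invmx A)].

Lemma integral_unitmxV n (A : 'M[F]_n) : integral_unitmx A -> integral_unitmx (invmx A).
Proof. by case=> *; split; rewrite ?unitmx_inv ?invmxK. Qed.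

Lemma integral_unitmx1 n : integral_unitmx (1%:M : 'M[F]_n).
Proof. by split; rewrite ?unitmx1 ?invmx1 //; exact: integralmx1. Qed.

Lemma integral_unitmxM n (A B : 'M[F]_n) :
  integral_unitmx A -> integral_unitmx B -> integral_unitmx (A *m B).
Proof.
case=> uA hA hA' [uB hB hB']; split; rewrite ?unitmx_mul ?uA ?uB //.
  exact: integralmxM.
have -> : invmx (A *m B) = invmx B *m invmx A.
  rewrite -[LHS]mulmx1 -[1%:M in LHS](mulmxV uA) -[X in _ *m (X *m _)]mulmx1.
  rewrite -[1%:M in LHS](mulmxV uB) !mulmxA -(mulmxA _ A B) mulVmx ?mul1mx //.
  by rewrite unitmx_mul uA uB.
exact: integralmxM.
Qed.

End Valuation.

(** * Quadratic forms, and what positivity says about integrality *)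

Section QuadraticForms.
Variable F : rcfType.

Definition qform n (M : 'M[F]_n) (x : 'rV[F]_n) : F := (x *m M *m x^T) 0 0.

Definition posdef n (M : 'M[F]_n) : Prop := forall x, x != 0 -> 0 < qform M x.

(** The Loewner order. *)
Definition le_form n (M N : 'M[F]_n) : Prop := forall x, qform M x <= qform N x.

Lemma qformD n (M N : 'M[F]_n) x : qform (M + N) x = qform M x + qform N x.
Proof. by rewrite /qform mulmxDr mulmxDl mxE. Qed.

Lemma qformN n (M : 'M[F]_n) x : qform (- M) x = - qform M x.
Proof. by rewrite /qform mulmxN mulNmx mxE. Qed.

Lemma qformB n (M N : 'M[F]_n) x : qform (M - N) x = qform M x - qform N x.
Proof. by rewrite qformD qformN. Qed.

Lemma qform_congr n (M P : 'M[F]_n) x :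
  qform (P *m M *m P^T) x = qform M (x *m P).
Proof. by rewrite /qform trmx_mul !mulmxA. Qed.

Lemma qform1 n (x : 'rV[F]_n) : qform 1%:M x = \sum_i x 0 i ^+ 2.
Proof.
by rewrite /qform mulmx1 mxE; apply: eq_bigr => i _; rewrite mxE expr2.
Qed.

Lemma qform_gram m n (A : 'M[F]_(n, m)) x : qform (A *m A^T) x = \sum_i (x *m A) 0 i ^+ 2.
Proof.
by rewrite -qform1 -[RHS]/(((x *m A) *m 1%:M *m (x *m A)^T) 0 0) mulmx1 trmx_mul /qform !mulmxA.
Qed.

Lemma qform_delta n (M : 'M[F]_n) i : qform M (delta_mx 0 i) = M i i.
Proof. by rewrite /qform -rowE trmx_delta -colE !mxE. Qed.

Lemma qform0 n (M : 'M[F]_n) : qform M 0 = 0.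
Proof. by rewrite /qform !mul0mx mxE. Qed.

Lemma posdef_ge0 n (M : 'M[F]_n) x : posdef M -> 0 <= qform M x.
Proof. by move=> hM; have [->|/hM/ltW//] := eqVneq x 0; rewrite qform0. Qed.

Lemma posdefD n (M N : 'M[F]_n) : posdef M -> posdef N -> posdef (M + N).
Proof. by move=> hM hN x x0; rewrite qformD addr_gt0 // ?hM ?hN. Qed.

Lemma posdef1 n : posdef (1%:M : 'M[F]_n).
Proof.
move=> x /rV0Pn[i xi]; rewrite qform1 (bigD1 i) //= ltr_wpDr ?exprn_even_gt0 //.
by rewrite sumr_ge0 // => j _; rewrite sqr_ge0.
Qed.

Lemma posdef_unit n (M : 'M[F]_n) : posdef M -> M \in unitmx.
Proof.
move=> hM; rewrite -row_free_unit -kermx_eq0; apply/eqP/row_matrixP => i.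
rewrite row0; apply/eqP/negPn/negP => /hM; rewrite /qform -row_mul mulmx_ker row0.
by rewrite mul0mx mxE ltxx.
Qed.

Lemma posdef_congr n (M P : 'M[F]_n) :
  P \in unitmx -> posdef M -> posdef (P *m M *m P^T).
Proof.
move=> uP hM x x0; rewrite qform_congr; apply: hM.
by apply: contra_neq x0 => xP; rewrite -[x](mulmxK uP) xP mul0mx.
Qed.

Lemma le_form_congr n (M N P : 'M[F]_n) :
  le_form M N -> le_form (P *m M *m P^T) (P *m N *m P^T).
Proof. by move=> h x; rewrite !qform_congr. Qed.

Lemma posdef_gram n (A : 'M[F]_n) : posdef (A *m A^T) -> A \in unitmx.
Proof.
by move/posdef_unit; rewrite unitmx_mul => /andP[].
Qed.

(** Induction on the Schur complement; the square root of the pivot exists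
    because [F] is real closed. *)
Lemma cholesky n (M : 'M[F]_n) :
  M^T = M -> posdef M -> exists2 C : 'M[F]_n, C \in unitmx & M = C *m C^T.
Proof.
elim: n M => [|n IHn] M symM posM.
  by exists 1%:M; [exact: unitmx1 | apply/matrixP => -[]].
suff [C MC] : exists C : 'M[F]_n.+1, M = C *m C^T.
  by exists C => //; apply: posdef_gram; rewrite -MC.
move: M symM posM; rewrite -[n.+1]/(1 + n)%N => M symM posM.
pose a := M 0 0; pose u : 'rV[F]_n := ursubmx M.
have a_gt0 : 0 < a.
  by rewrite /a -(qform_delta M); apply: posM; apply/rV0Pn; exists 0; rewrite mxE !eqxx oner_neq0.
have ulE : ulsubmx M = a%:M.
  by apply/matrixP => i j; rewrite !ord1 !mxE eqxx /a; congr (M _ _); apply: val_inj.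
have dlE : dlsubmx M = u^T by rewrite /u trmx_ursub symM.
have drE : (drsubmx M)^T = drsubmx M by rewrite trmx_drsub symM.
have ME : M = block_mx a%:M u u^T (drsubmx M) by rewrite -ulE -dlE submxK.
pose S := drsubmx M - a^-1 *: (u^T *m u).
have symS : S^T = S by rewrite /S linearB linearZ /= trmx_mul trmxK drE.
have a0 : a != 0 by rewrite gt_eqF.
have posS : posdef S.
  move=> y y0; pose x : 'rV[F]_(1 + n) := row_mx (- a^-1 *: (y *m u^T)) y.
  have x0 : x != 0.
    apply: contra_neq y0 => x0; have := congr1 (@rsubmx _ 1 1 n) x0.
    by rewrite row_mxKr linear0.
  have := posM x x0; suff -> : qform M x = qform S y by [].
  rewrite /qform {1}ME /x mul_row_block tr_row_mx mul_row_col linearZ /= trmx_mul trmxK.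
  rewrite -!scalemxAl mul_mx_scalar !scalerA !mulNr mulVf //.
  rewrite scaleN1r addNr mul0mx add0r /S mulmxBr -scalemxAr mulmxA addrC.
  by rewrite -scaleNr -?scalemxAl ?scaleNr.
have [C _ SC] := IHn S symS posS.
pose s := Num.sqrt a.
have ss : s * s = a by rewrite -expr2 sqr_sqrtr // ltW.
have s0 : s != 0 by rewrite gt_eqF // sqrtr_gt0.
exists (block_mx s%:M 0 (s^-1 *: u^T) C).
rewrite ME tr_block_mx mulmx_block !linearZ /= trmx0 !trmxK tr_scalar_mx.
rewrite !mul0mx !mulmx0 !addr0 -!scalar_mxM ss.
rewrite mul_scalar_mx mul_mx_scalar !scalerA mulVf // divff // !scale1r.
by rewrite -SC -scalemxAl scalerA -invfM ss /S addrC subrK.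
Qed.

End QuadraticForms.

Section IntegralForms.
Variables (R : realType) (F : rcfType) (v : F -> \bar R).
Hypothesis hv : order_compatible_valuation v.

(** Squares are nonnegative, so nothing cancels in their sum: each of them is
    dominated by the total. This is how inequalities between quadratic forms
    turn into integrality of matrices. *)
Lemma integral_sum_sqr (I : finType) (E : I -> F) :
  integral v (\sum_i E i ^+ 2) -> forall i, integral v (E i).
Proof.
move=> h i; apply: integral_sqr hv _ _; apply: integral_le hv _ _ _ h.
rewrite !ger0_norm ?sumr_ge0 ?sqr_ge0 // => [|j _]; last exact: sqr_ge0.
by rewrite (bigD1 i) //= lerDl sumr_ge0 // => j _; rewrite sqr_ge0.
Qed.

Lemma integral_gram m n (A : 'M[F]_(n, m)) :
  (forall i, integral v ((A *m A^T) i i)) -> integralmx v A.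
Proof.
move=> h i; apply: integral_sum_sqr.
have := h i; rewrite !mxE; congr (integral v _).
by apply: eq_bigr => j _; rewrite mxE expr2.
Qed.

Lemma integral_gram_le1 n (A : 'M[F]_n) :
  le_form (A *m A^T) 1%:M -> integralmx v A.
Proof.
move=> h; apply: integral_gram => i; apply: integral_le hv _ _ _ (integral1 hv).
have := h (delta_mx 0 i); rewrite !qform_delta [in X in _ <= X]mxE eqxx.
rewrite -qform_delta qform_gram => h1.
by rewrite normr1 ger0_norm // sumr_ge0 // => j _; rewrite sqr_ge0.
Qed.

(** After the change of variables by the inverse of [B], the hypothesis bounds
    a Gram matrix by the identity, so its diagonal entries are sums of squares
    at most 1. *)
Lemma integral_gram_le n (A B : 'M[F]_n) : B \in unitmx ->
  le_form (A *m A^T) (B *m B^T) -> integralmx v (invmx B *m A).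
Proof.
move=> uB h; apply: integral_gram_le1.
have := le_form_congr (invmx B) h.
have -> : invmx B *m (A *m A^T) *m (invmx B)^T = (invmx B *m A) *m (invmx B *m A)^T.
  by rewrite trmx_mul !mulmxA.
have -> // : invmx B *m (B *m B^T) *m (invmx B)^T = 1%:M.
by rewrite mulmxA mulVmx // mul1mx trmx_inv mulmxV // unitmx_tr.
Qed.

Lemma integral_sandwich n (A B C : 'M[F]_n) : C \in unitmx ->
  integral_unitmx v A -> integral_unitmx v B ->
  le_form (A *m A^T) (C *m C^T) -> le_form (C *m C^T) (B *m B^T) ->
  integral_unitmx v C.
Proof.
move=> uC [uA hA hA'] [uB hB hB'] AC CB; split=> //.
  by rewrite -(mulKVmx uB C); apply: integralmxM => //; exact: integral_gram_le.
rewrite -(mulmxK uA (invmx C)); apply: integralmxM => //.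
exact: integral_gram_le.
Qed.

(** Write [M] as a Gram matrix: the trace is then the sum of the squares of
    all entries of the factor, which is therefore integral. *)
Lemma integral_posdef_tr n (M : 'M[F]_n) :
  M^T = M -> posdef M -> integral v (\tr M) -> integralmx v M.
Proof.
move=> symM posM trM; have [C uC MC] := cholesky symM posM.
have Mii i : 0 <= M i i by rewrite -qform_delta posdef_ge0.
have hC : integralmx v C.
  apply: integral_gram => i; rewrite -MC; apply: integral_le hv _ _ _ trM.
  rewrite /mxtrace !ger0_norm ?sumr_ge0 // (bigD1 i) //= lerDl.
  by rewrite sumr_ge0.
by rewrite MC; apply: integralmxM => //; exact: integralmx_tr.
Qed.

(** Matrix computation behind the comparison of two crossing axes. The
    intertwining equation between [T] and [T'] says that [W], the form
    [T' - T] written in the basis that normalizes [1 + T], has the integral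
    inverse [K - 1], where [K] is the Gram matrix of the inverse of [A]. Hence
    [1 + T] is at most an integral multiple of [T' - T]; as [T'] is at most
    the translate of [T] by the integral matrix [B], the identity is at most
    an integral multiple of [T]. *)
Lemma integral_crossing n (C P A B T' : 'M[F]_n) (T := C *m C^T) :
  C \in unitmx -> P *m (1%:M + T) *m P^T = 1%:M ->
  T'^T = T' -> posdef (T' - T) ->
  integral_unitmx v A -> integral_unitmx v B ->
  A *m P *m (1%:M + T') = invmx A^T *m P *m (T' - T) ->
  le_form T' (B *m T *m B^T) ->
  integralmx v (invmx C).
Proof.
move=> uC hP symT' posD [uA hA hA'] [uB hB hB'] hT' leT'.
have symT : T^T = T by rewrite /T trmx_mul trmxK.
have uP : P \in unitmx.
  by have := @unitmx1 F n; rewrite -hP !unitmx_mul => /andP[/andP[]].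
have uAT : A^T \in unitmx by rewrite unitmx_tr.
pose W := P *m (T' - T) *m P^T.
have symW : W^T = W by rewrite /W !trmx_mul trmxK linearB /= symT symT' mulmxA.
have posW : posdef W by apply: posdef_congr.
have [Y uY WY] := cholesky symW posW.
have WE : (invmx A *m invmx A^T - 1%:M) *m W = 1%:M.
  have : P *m (1%:M + T') *m P^T = invmx A *m invmx A^T *m W.
    by rewrite -[P *m _ in LHS](mulKmx uA) (mulmxA A) hT' /W !mulmxA.
  rewrite mulmxBl mul1mx => <-; rewrite /W -mulmxBl -mulmxBr.
  by rewrite (_ : 1%:M + T' - (T' - T) = 1%:M + T) // opprB addrA addrAC addrK.
(* The inverse of [W] is the Gram matrix of the transposed inverse of [Y], so
   integrality passes from [W] to its factor. *)
have hY : integralmx v (invmx Y).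
  have -> : invmx Y = (invmx Y)^T^T by rewrite trmxK.
  apply: integralmx_tr; apply: integral_gram => i; rewrite trmxK.
  suff -> : (invmx Y)^T *m invmx Y = invmx A *m invmx A^T - 1%:M.
    apply: integralmxB => //; last exact: integralmx1.
    by apply: integralmxM => //; rewrite -trmx_inv; exact: integralmx_tr.
  rewrite -[RHS]mulmx1 -[X in _ = _ *m X](mulmxV (posdef_unit posW)) mulmxA WE mul1mx WY.
  have uYY : Y *m Y^T \in unitmx by rewrite -WY; exact: posdef_unit.
  apply: (can_inj (mulKmx uYY)); rewrite mulmxV // -mulmxA trmx_inv mulKVmx ?unitmx_tr //.
  by rewrite mulmxV.
have hPint : integralmx v P.
  apply: integral_gram_le1 => x; rewrite -[X in _ <= qform X _]hP mulmxDr mulmx1 mulmxDl.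
  rewrite qformD lerDl qform_congr /T qform_gram sumr_ge0 // => i _; exact: sqr_ge0.
(* [T' - T] is the Gram matrix of [P^-1 Y], and [B T B^T] that of [B C]. *)
have : integralmx v (invmx (B *m C) *m (invmx P *m Y)).
  apply: integral_gram_le; first by rewrite unitmx_mul uB.
  move=> x; apply: le_trans (_ : qform T' x <= _); last first.
    by apply: le_trans (leT' x) _; rewrite trmx_mul !mulmxA.
  have -> : invmx P *m Y *m (invmx P *m Y)^T = T' - T.
    rewrite trmx_mul mulmxA -(mulmxA (invmx P)) -WY /W !mulmxA mulVmx // mul1mx.
    by rewrite -mulmxA trmx_inv mulmxV ?unitmx_tr // mulmx1.
  by rewrite qformB gerDl oppr_le0 /T qform_gram sumr_ge0 // => i _; exact: sqr_ge0.
move=> h1; have := integralmxM hv (integralmxM hv (integralmxM hv h1 hY) hPint) hB.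
congr (integralmx v _); rewrite -!mulmxA (mulKVmx uY) (mulKmx uP).
have uBC : B *m C \in unitmx by rewrite unitmx_mul uB.
by apply: (can_inj (mulKmx uBC)); rewrite mulKVmx // -mulmxA mulmxV // mulmx1.
Qed.

End IntegralForms.

(** * Darboux bases and charts of the Lagrangian Grassmannian *)

Section LinearCombinations.
Variables (F : fieldType) (V : vectType F) (n : nat).
Implicit Types (e : 'I_n -> V) (x y : 'rV[F]_n).

Definition cmb e x : V := \sum_i x 0 i *: e i.

Lemma cmb_is_linear e : linear (cmb e).
Proof.
move=> a x y; rewrite /cmb scaler_sumr -big_split; apply: eq_bigr => i _ /=.
by rewrite !mxE scalerDl scalerA.
Qed.

HB.instance Definition _ e := GRing.isLinear.Build F 'rV[F]_n V *:%R (cmb e) (cmb_is_linear e).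

Lemma cmb_delta e i : cmb e (delta_mx 0 i) = e i.
Proof.
rewrite /cmb (bigD1 i) //= mxE !eqxx scale1r big1 ?addr0 // => j ji.
by rewrite mxE eqxx (negPf ji) scale0r.
Qed.

(** Matrices act on families through row coordinates, so that coordinate
    vectors are multiplied by [P] on the right (cmb_comb). *)
Definition comb_fam m (P : 'M[F]_(m, n)) e (i : 'I_m) : V := cmb e (row i P).

Lemma mem_cmb e (l : {vspace V}) x : (forall i, e i \in l) -> cmb e x \in l.
Proof. by move=> h; apply: memv_suml => i _; apply: memvZ. Qed.

End LinearCombinations.

Lemma cmb_comb (F : fieldType) (V : vectType F) m n (P : 'M[F]_(m, n)) (e : 'I_n -> V) x :
  cmb (comb_fam P e) x = cmb e (x *m P).
Proof. by rewrite mulmx_sum_row linear_sum; apply: eq_bigr => i _; rewrite linearZ. Qed.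

Section Symplectic.
Variables (F : rcfType) (V : vectType F) (omega : {skew_symmetric V}).
Hypothesis homega : nondegenerate omega.
Local Notation n := (half_dim V).
Implicit Types (u w : V) (e f : 'I_n -> V) (x y : 'rV[F]_n) (l : {vspace V}).

Lemma skewC u w : omega u w = - omega w u.
Proof. by rewrite hermC /= expr1 mulN1r. Qed.

Lemma skew0 u : omega u u = 0.
Proof. by have := skewC u u; lra. Qed.

Lemma nondegP u : (forall w, omega u w = 0) -> u = 0.
Proof.
move=> h; apply/eqP; rewrite -memv0 -(eqP homega).
by apply/mem_orthovP => w _; apply: h.
Qed.

(** The Gram matrix of a skew form equals minus its transpose, so in odd
    dimension its determinant would vanish, against nondegeneracy. *)
Lemma dim_even : \dim {:V} = (n + n)%N.
Proof.
pose d := \dim {:V}; pose b := vbasis {:V}.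
pose G : 'M[F]_d := \matrix_(i, j) omega b`_i b`_j.
have symG : G^T = - G by apply/matrixP => i j; rewrite !mxE skewC.
have uG : \det G != 0.
  rewrite -unitfE -unitmxE -row_free_unit -kermx_eq0; apply/eqP/row_matrixP => i.
  rewrite row0; have : row i (kermx G) *m G = 0 by rewrite -row_mul mulmx_ker row0.
  move: (row i _) => x xG.
  have x0 : \sum_j x 0 j *: b`_j = 0.
    apply: nondegP => w; rewrite (coord_vbasis (memvf w)) linear_sumr big1 // => k _.
    rewrite linearZr_LR /= linear_sumlz; apply/eqP; rewrite mulf_eq0; apply/orP; right; apply/eqP.
    have := congr1 (fun y : 'rV_d => y 0 k) xG; rewrite !mxE => xk.
    by apply: etrans xk; apply: eq_bigr => j _; rewrite linearZl_LR mxE.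
  apply/rowP => j; rewrite [RHS]mxE.
  have := vbasisP {:V}; rewrite basisEfree => /and3P[/freeP fr _ _].
  by have := fr (fun k => x 0 k) x0 j.
have := congr1 determinant symG; rewrite det_tr -scaleN1r detZ => dG.
have ev : ~~ odd d.
  apply/negP => od; move: dG; rewrite -signr_odd od expr1 mulN1r => dG.
  by move/eqP: uG; apply; lra.
by rewrite /half_dim addnn -[LHS]odd_double_half (negPf ev).
Qed.

Lemma omega_cmb e f (Q : 'M[F]_n) x y :
  (forall i j, omega (e i) (f j) = Q i j) -> omega (cmb e x) (cmb f y) = (x *m Q *m y^T) 0 0.
Proof.
move=> h; rewrite linear_sumlz mxE.
under eq_bigr do rewrite linearZl_LR linear_sumr /=.
under [RHS]eq_bigr do rewrite mxE mulr_suml.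
rewrite [RHS]exchange_big; apply: eq_bigr => i _ /=. rewrite mulr_sumr.
by apply: eq_bigr => j _; rewrite linearZr_LR /= h !mxE -mulrA (mulrC (Q i j)).
Qed.

(** The relations of a symplectic basis. That they make [(e, f)] a basis
    follows by counting dimensions (darboux_symplectic). *)
Definition darboux e f : Prop :=
  [/\ (forall i j, omega (e i) (e j) = 0), (forall i j, omega (f i) (f j) = 0) &
      (forall i j, omega (e i) (f j) = (i == j)%:R)].

Section Darboux.
Variables e f : 'I_n -> V.
Hypothesis hef : darboux e f.

Lemma darboux_ee x y : omega (cmb e x) (cmb e y) = 0.
Proof.
case: hef => ee _ _; rewrite (@omega_cmb e e 0) ?mulmx0 ?mul0mx ?mxE // => i j.
by rewrite ee mxE.
Qed.

Lemma darboux_ff x y : omega (cmb f x) (cmb f y) = 0.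
Proof.
case: hef => _ ff _; rewrite (@omega_cmb f f 0) ?mulmx0 ?mul0mx ?mxE // => i j.
by rewrite ff mxE.
Qed.

Lemma darboux_ef x y : omega (cmb e x) (cmb f y) = (x *m y^T) 0 0.
Proof.
case: hef => _ _ ef; rewrite (@omega_cmb e f 1%:M) ?mulmx1 // => i j.
by rewrite ef mxE.
Qed.

Lemma darboux_fe x y : omega (cmb f x) (cmb e y) = - (x *m y^T) 0 0.
Proof. by rewrite skewC darboux_ef -[y *m _]trmxK trmx_mul trmxK mxE. Qed.

Lemma darboux_cmb x y x' y' :
  omega (cmb e x + cmb f y) (cmb e x' + cmb f y') =
  (x *m y'^T) 0 0 - (y *m x'^T) 0 0.
Proof.
rewrite linearDl /= !linearDr /= darboux_ee darboux_ef darboux_fe darboux_ff.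
by rewrite add0r addr0.
Qed.

Lemma darboux_x x y i : omega (cmb e x + cmb f y) (f i) = x 0 i.
Proof.
rewrite -(cmb_delta f i) -[cmb f (delta_mx _ _)]add0r -(linear0 (cmb e)).
by rewrite darboux_cmb trmx0 mulmx0 [X in _ - X]mxE subr0 trmx_delta -colE mxE.
Qed.

Lemma darboux_y x y i : omega (e i) (cmb e x + cmb f y) = y 0 i.
Proof.
rewrite -(cmb_delta e i) -[cmb e (delta_mx _ _)]addr0 -(linear0 (cmb f)).
by rewrite darboux_cmb mul0mx [X in _ - X]mxE subr0 -rowE !mxE.
Qed.

Lemma darboux_symplectic : symplectic_basis omega e f.
Proof.
case: (hef) => ee ff ef; split => //; rewrite basisEfree subvf /=.
rewrite size_cat !size_codom !card_ord dim_even leqnn andbT.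
have s : size (codom e ++ codom f) == (n + n)%N.
  by rewrite size_cat !size_codom !card_ord.
apply/(@freeP _ _ _ (Tuple s)) => k; rewrite big_split_ord /=.
pose x : 'rV[F]_n := \row_i k (lshift n i); pose y : 'rV[F]_n := \row_i k (rshift n i).
have nthc g (i : 'I_n) : (codom g)`_i = g i :> V.
  by rewrite (nth_map i) ?size_enum_ord // nth_ord_enum.
move=> k0; have xy0 : cmb e x + cmb f y = 0.
  rewrite -[RHS]k0; congr (_ + _); apply: eq_bigr => i _; rewrite mxE nth_cat size_codom card_ord /=.
    by rewrite ltn_ord nthc.
  by rewrite ltnNge leq_addr addKn nthc.
move=> i; case: (split_ordP i) => j ->.
  by have := darboux_x x y j; rewrite xy0 mxE linear0l => <-.
by have := darboux_y x y j; rewrite xy0 mxE linear0r => <-.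
Qed.

Definition xcoord u : 'rV[F]_n := \row_i omega u (f i).
Definition ycoord u : 'rV[F]_n := \row_i omega (e i) u.

(** The difference of the two sides is orthogonal to the whole basis, hence to
    [V]. *)
Lemma coordK u : u = cmb e (xcoord u) + cmb f (ycoord u).
Proof.
apply/eqP; rewrite -subr_eq0; set w := _ - _; rewrite -memv0 -(eqP homega).
case: darboux_symplectic => bas _ _ _.
rewrite -(span_basis bas) memvE -span_seq1 -orthogonalE.
apply/orthogonalP => _ z /[!inE] /eqP -> /[!mem_cat] /orP[]/codomP[i ->].
  by rewrite skewC /w linearBr /= darboux_y mxE subrr oppr0.
by rewrite /w linearBl /= darboux_x mxE subrr.
Qed.

Lemma cmb_eq0 x y : cmb e x + cmb f y = 0 -> x = 0 /\ y = 0.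
Proof.
move=> h; split; apply/rowP => i; rewrite [RHS]mxE.
  by rewrite -(darboux_x x y i) h linear0l.
by rewrite -(darboux_y x y i) h linear0r.
Qed.

(** Families given by the blocks of a matrix of size [n] by [2n]; a symplectic
    matrix consists of two of them. *)
Definition fam (P Q : 'M[F]_n) i : V := cmb e (row i P) + cmb f (row i Q).

Lemma omega_fam (P Q P' Q' : 'M[F]_n) i j :
  omega (fam P Q i) (fam P' Q' j) = (P *m Q'^T - Q *m P'^T) i j.
Proof.
rewrite /fam darboux_cmb !mxE; congr (_ - _);
  by apply: eq_bigr => k _; rewrite !mxE.
Qed.

Lemma cmb_fam (P Q : 'M[F]_n) (x : 'rV[F]_n) : cmb (fam P Q) x = cmb e (x *m P) + cmb f (x *m Q).
Proof.
rewrite -!cmb_comb -big_split; apply: eq_bigr => i _ /=.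
by rewrite -scalerDr.
Qed.

Lemma darboux_fam (P Q P' Q' : 'M[F]_n) :
  P *m Q^T = Q *m P^T -> P' *m Q'^T = Q' *m P'^T -> P *m Q'^T - Q *m P'^T = 1%:M ->
  darboux (fam P Q) (fam P' Q').
Proof.
move=> h1 h2 h3; split=> i j; rewrite omega_fam.
- by rewrite h1 subrr mxE.
- by rewrite h2 subrr mxE.
- by rewrite h3 mxE.
Qed.

End Darboux.

Lemma symplectic_darboux e f : symplectic_basis omega e f -> darboux e f.
Proof. by case. Qed.

(** Chart of the Lagrangians transverse to the span of [f]: [l] is the graph
    of the linear map of matrix [M] from the span of [e] to the span of [f]. *)
Definition graph e f (M : 'M[F]_n) l : Prop := forall x, cmb e x + cmb f (x *m M) \in l.

Lemma lagrangian_eq l u w : lagrangian omega l -> u \in l -> w \in l -> omega u w = 0.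
Proof. by case=> h _; apply: h. Qed.

Lemma lagrangian_cmb e f l u : darboux e f -> lagrangian omega l ->
  (forall i, e i \in l) -> u \in l -> u = cmb e (xcoord f u).
Proof.
move=> hef hl el ul; rewrite {1}(coordK hef u) (_ : ycoord e u = 0) ?linear0 ?addr0 //.
by apply/rowP => i; rewrite !mxE (lagrangian_eq hl).
Qed.

Lemma lagrangian_cmb' e f l u : darboux e f -> lagrangian omega l ->
  (forall i, f i \in l) -> u \in l -> u = cmb f (ycoord e u).
Proof.
move=> hef hl fl ul; rewrite {1}(coordK hef u) (_ : xcoord f u = 0) ?linear0 ?add0r //.
by apply/rowP => i; rewrite !mxE (lagrangian_eq hl).
Qed.

Lemma transverse_sum l l' u :
  lagrangian omega l -> lagrangian omega l' -> transverse l l' ->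
  exists a b, [/\ a \in l, b \in l' & u = a + b].
Proof.
move=> [_ dl] [_ dl'] t; have : u \in (l + l')%VS.
  suff -> : (l + l')%VS = fullv by apply: memvf.
  by apply/eqP; rewrite eqEdim subvf /= dimv_disjoint_sum // dl dl' dim_even.
by case/memv_addP => a al [b bl ->]; exists a, b.
Qed.

(** The component of [e i] along [l], in the decomposition of [V] into [l] and
    [l'], differs from [e i] by a combination of [f]; isotropy of [l] makes
    the coefficients symmetric. *)
Lemma transverse_graph e f l l' : darboux e f ->
  lagrangian omega l -> lagrangian omega l' -> transverse l l' ->
  (forall i, f i \in l') -> exists M, M^T = M /\ graph e f M l.
Proof.
move=> hef hl hl' t fl'.
have h i : exists y : 'rV[F]_n, e i + cmb f y \in l.
  have [a [b [al bl' eab]]] := transverse_sum (e i) hl hl' t.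
  exists (- ycoord e b).
  have xb : xcoord f b = 0.
    by apply/rowP => j; rewrite !mxE (lagrangian_eq hl').
  have := coordK hef b; rewrite xb linear0 add0r => bE.
  by rewrite linearN /= -bE eab addrK.
have [y hy] := choice h; pose M : 'M[F]_n := \matrix_i y i.
have gM : graph e f M l.
  move=> x; rewrite -cmb_comb -big_split; apply: memv_suml => i _ /=.
  by rewrite -scalerDr memvZ // /comb_fam rowK.
exists M; split=> //; apply/matrixP => i j.
have := lagrangian_eq hl (gM (delta_mx 0 i)) (gM (delta_mx 0 j)).
rewrite darboux_cmb // -!rowE trmx_delta -colE !mxE => /eqP.
by rewrite subr_eq0 => /eqP.
Qed.

Lemma graph_uniq e f l l' M x y : darboux e f -> transverse l l' ->
  (forall i, f i \in l') -> graph e f M l ->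
  cmb e x + cmb f y \in l -> y = x *m M.
Proof.
move=> hef t fl' gM xyl; apply/eqP; rewrite -subr_eq0; apply/eqP.
have : cmb f (y - x *m M) \in (l :&: l')%VS.
  rewrite memv_cap; apply/andP; split; last exact: mem_cmb.
  rewrite linearB /=.
  have -> : cmb f y - cmb f (x *m M) = (cmb e x + cmb f y) - (cmb e x + cmb f (x *m M)).
    by rewrite opprD addrACA subrr add0r.
  exact: memvB.
rewrite t memv0 -[cmb f _]add0r -(linear0 (cmb e)) => /eqP h.
by have [] := cmb_eq0 hef (etrans h (linear0 _)).
Qed.

(** For [u] in [lx] with coordinates [x] on [e], the vector of [l'] carrying
    it into [ly] has coordinates [x (N - M)] on [f], so the form of the triple
    is [N - M]. *)
Lemma maximal_posdef e f lx ly l' M N : darboux e f ->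
  maximal_triple omega lx ly l' -> (forall i, f i \in l') ->
  N^T = N -> M^T = M -> graph e f M lx -> graph e f N ly -> posdef (N - M).
Proof.
move=> hef [_ [_ hpos]] fl' symN symM gM gN x x0.
have := hpos (cmb e x + cmb f (x *m M)) (cmb e 0 + cmb f (x *m (N - M))) (gM x).
have z00 : (0 : 'M[F]_1) 0 0 = 0 by rewrite mxE.
rewrite darboux_cmb // trmx0 mulmx0 z00 subr0.
have symNM : (N - M)^T = N - M by rewrite linearB /= symN symM.
rewrite trmx_mul symNM mulmxA; apply.
- by apply: contra_neq x0 => /(cmb_eq0 hef)[].
- by rewrite linear0 add0r mem_cmb.
- rewrite linear0 add0r -addrA -linearD /= -mulmxDr (addrC M) subrK; exact: gN.
Qed.

(** The form of a maximal triple on [la] is positive definite; an orthonormal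
    basis of it, paired with its image in [lb], is the required basis. *)
Lemma adapted_basis la lc lb : maximal_triple omega la lc lb ->
  exists e f, [/\ darboux e f, (forall i, e i \in la), (forall i, f i \in lb) &
                  forall i, e i + f i \in lc].
Proof.
move=> [[hla hlc hlb] [[tac tcb tab] hpos]].
have dla : \dim la = n by case: hla.
pose b : n.-tuple V := tcast dla (vbasis la).
have bE : tval b = vbasis la by rewrite val_tcast.
pose e0 (i : 'I_n) : V := b`_i.
have e0la i : e0 i \in la.
  have : e0 i \in tval b by rewrite mem_nth ?size_tuple.
  by rewrite bE; exact: vbasis_mem.
have h i : exists w, w \in lb /\ e0 i + w \in lc.
  have [c [d [cl dl ->]]] := transverse_sum (e0 i) hlc hlb tcb.
  by exists (- d); rewrite memvN addrK.
have [w hw] := choice h.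
(* The form of the triple in the basis [e0] of [la]. *)
pose Q : 'M[F]_n := \matrix_(i, j) omega (e0 i) (w j).
have wlb i : w i \in lb by case: (hw i).
have ee i j : omega (e0 i) (e0 j) = 0 by apply: lagrangian_eq hla _ _.
have ww i j : omega (w i) (w j) = 0 by apply: lagrangian_eq hlb _ _.
have symQ : Q^T = Q.
  apply/matrixP => i j; rewrite !mxE.
  have := lagrangian_eq hlc (proj2 (hw i)) (proj2 (hw j)).
  rewrite linearDl /= !linearDr /= ee ww (skewC (w i)) add0r addr0 => /eqP.
  by rewrite subr_eq0 => /eqP.
have Qcmb x y : omega (cmb e0 x) (cmb w y) = (x *m Q *m y^T) 0 0.
  by apply: omega_cmb => i j; rewrite mxE.
have posQ : posdef Q.
  move=> x x0; rewrite /qform -Qcmb; apply: hpos.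
  - by apply: mem_cmb.
  - apply: contra_neq x0 => x0; apply/rowP => j; rewrite [RHS]mxE.
    have := vbasisP la; rewrite basisEfree -bE => /and3P[/freeP fr _ _].
    exact: (fr (fun k => x 0 k) x0 j).
  - exact: mem_cmb.
  - by rewrite -big_split; apply: memv_suml => i _ /=; rewrite -scalerDr memvZ //; case: (hw i).
have [C uC QC] := cholesky symQ posQ.
pose P := invmx C.
have PQP : P *m Q *m P^T = 1%:M.
  by rewrite QC /P mulmxA mulVmx // mul1mx trmx_inv mulmxV // unitmx_tr.
exists (comb_fam P e0), (comb_fam P w); split.
- split=> i j; rewrite /comb_fam.
  + rewrite (@omega_cmb e0 e0 0) ?mulmx0 ?mul0mx ?mxE // => k l; by rewrite ee mxE.
  + rewrite (@omega_cmb w w 0) ?mulmx0 ?mul0mx ?mxE // => k l; by rewrite ww mxE.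
  + rewrite Qcmb -row_mul.
    have := congr1 (fun Z : 'M[F]_n => Z i j) PQP => /=; rewrite [X in _ = X -> _]mxE => <-.
    rewrite [LHS]mxE [RHS]mxE; apply: eq_bigr => k _.
    by congr (_ * _); rewrite [LHS]mxE // [LHS]mxE [RHS]mxE.
- by move=> i; apply: mem_cmb.
- by move=> i; apply: mem_cmb.
- move=> i; rewrite -big_split; apply: memv_suml => j _ /=; rewrite -scalerDr memvZ //.
  by case: (hw j).
Qed.

End Symplectic.

(** * Existence of Lagrangians and of Darboux bases *)

Section LagrangianBases.
Variables (F : rcfType) (V : vectType F) (omega : {skew_symmetric V}).
Hypothesis homega : nondegenerate omega.
Local Notation n := (half_dim V).

(** An isotropic subspace [l] of dimension less than [n] is smaller than its
    orthogonal, so it can be enlarged by a line. *)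
Lemma lagrangian_exists : exists l, lagrangian omega l.
Proof.
pose Q k := (k <= n)%N &&
  `[< exists l : {vspace V}, {in l &, forall u w, omega u w = 0} /\ \dim l = k >].
have exQ : exists k, Q k.
  exists 0%N; rewrite /Q leq0n; apply/asboolP; exists 0%VS; split; last exact: dimv0.
  by move=> u w; rewrite !memv0 => /eqP -> _; rewrite linear0l.
have bdQ k : Q k -> (k <= n)%N by case/andP.
case: (ex_maxnP exQ bdQ) => k /andP[kn /asboolP[l [isol dl]]] kmax.
exists l; split=> //; rewrite dl; apply/eqP; rewrite eqn_leq kn leqNgt; apply/negP => ltkn.
have dorth (us : seq V) : (\dim {:V} <= \dim (orthov omega << us >>) + size us)%N.
  elim: us => [|u us IHs] /=; first by rewrite span_nil orthov0 addn0.
  have sub : (orthov omega << us >> :&: orthov omega <[u]> <= orthov omega << u :: us >>)%VS.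
    by rewrite span_cons orthov_sym orthoDv !(orthov_sym omega _ (_ :&: _)) capvSr capvSl.
  apply: leq_trans IHs _; rewrite addnS -addSn leq_add2r.
  apply: leq_trans (_ : (\dim (orthov omega << us >> :&: orthov omega <[u]>)).+1 <= _)%N; last first.
    by rewrite ltnS dimvS.
  by have := leq_dim_orthov1 omega u (orthov omega << us >>); case: (\dim (orthov omega << us >>)).
have [u uo ul] : exists2 u, u \in orthov omega l & u \notin l.
  have nsub : ~~ (orthov omega l <= l)%VS.
    apply/negP => /dimvS; rewrite dl => h.
    have := dorth (vbasis l); rewrite (span_basis (vbasisP l)) size_tuple dl (dim_even homega).
    move=> h2; have := leq_trans h2 (leq_add h (leqnn k)); rewrite leqNgt.
    by rewrite !addnn ltn_double ltkn.
  apply: contrapT => H; case/negP: nsub; apply/subvP => u uo.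
  by apply/negPn/negP => ul; apply: H; exists u.
have : Q k.+1.
  rewrite /Q ltkn; apply/asboolP; exists (l + <[u]>)%VS; split.
    move=> x y /memv_addP[x1 x1l [_ /vlineP[a ->] ->]] /memv_addP[y1 y1l [_ /vlineP[b ->] ->]].
    have ou z : z \in l -> omega u z = 0 by move=> zl; exact: (mem_orthovP uo).
    have ou' z : z \in l -> omega z u = 0 by move=> zl; rewrite skewC ou // oppr0.
    rewrite linearDl /= !linearDr /= !linearZl_LR !linearZr_LR /= isol // ou' // ou //.
    by rewrite (skew0 omega) !mulr0 scaler0 !addr0.
  rewrite dimv_disjoint_sum ?dl.
    by rewrite dim_vline; case: eqP ul => [->|]; rewrite ?mem0v ?addn1.
  apply/eqP; rewrite -subv0; apply/subvP => x; rewrite memv_cap memv0 => /andP[xl /vlineP[a xa]].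
  apply: contraNT ul => x0; have a0 : a != 0 by apply: contraNneq x0 => a0; rewrite xa a0 scale0r.
  by rewrite -[u](scalerK a0) -xa memvZ.
by move/kmax; rewrite ltnn.
Qed.

(** Nondegeneracy gives vectors [f0] dual to a basis of [l]; correcting [f0 i]
    along [l] by half of its pairings with the [f0 j] makes the family
    isotropic without changing the duality. *)
Lemma darboux_extension l : lagrangian omega l ->
  exists e f, darboux omega e f /\ forall i, e i \in l.
Proof.
move=> hl; have dl : \dim l = n by case: hl.
pose b : n.-tuple V := tcast dl (vbasis l).
have bE : tval b = vbasis l by rewrite val_tcast.
pose e (i : 'I_n) : V := b`_i.
have el i : e i \in l.
  have : e i \in tval b by rewrite mem_nth ?size_tuple.
  by rewrite bE; exact: vbasis_mem.
have efree x : cmb e x = 0 -> x = 0.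
  move=> x0; apply/rowP => j; rewrite [RHS]mxE.
  have := vbasisP l; rewrite basisEfree -bE => /and3P[/freeP fr _ _].
  exact: (fr (fun k => x 0 k) x0 j).
pose d := \dim {:V}; pose B := vbasis {:V}.
pose G : 'M[F]_(n, d) := \matrix_(i, j) omega (e i) B`_j.
have freeG : row_free G.
  rewrite -kermx_eq0; apply/eqP/row_matrixP => i; rewrite row0.
  have : row i (kermx G) *m G = 0 by rewrite -row_mul mulmx_ker row0.
  move: (row i _) => x xG; apply: efree; apply: (nondegP homega) => w.
  rewrite (coord_vbasis (memvf w)) linear_sumr big1 // => k _.
  rewrite linearZr_LR /= linear_sumlz; apply/eqP; rewrite mulf_eq0; apply/orP; right; apply/eqP.
  have := congr1 (fun y : 'rV_d => y 0 k) xG; rewrite !mxE => xk.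
  by apply: etrans xk; apply: eq_bigr => j _; rewrite linearZl_LR mxE.
pose f0 (j : 'I_n) : V := \sum_k (pinvmx G) k j *: B`_k.
have ef0 i j : omega (e i) (f0 j) = (i == j)%:R.
  have := mulmxVp freeG => /matrixP /(_ i j); rewrite !mxE => <-.
  by rewrite linear_sumr; apply: eq_bigr => k _; rewrite linearZr_LR /= ?mxE mulrC.
have ee i j : omega (e i) (e j) = 0 by apply: (lagrangian_eq hl).
pose c i : 'rV[F]_n := \row_j (- omega (f0 i) (f0 j) / 2).
exists e, (fun i => f0 i + cmb e (c i)); split=> //; split=> // i j.
  have fe k : omega (f0 j) (cmb e (c k)) = - c k 0 j.
    rewrite linear_sumr (bigD1 j) //= linearZr_LR /= skewC ef0 eqxx mulrN1 big1 ?addr0 // => l' lj.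
    by rewrite linearZr_LR /= skewC ef0 (negPf lj) oppr0 mulr0.
  have fe' k : omega (cmb e (c k)) (f0 j) = c k 0 j by rewrite skewC fe opprK.
  have fi k : omega (f0 i) (cmb e (c k)) = - c k 0 i.
    rewrite linear_sumr (bigD1 i) //= linearZr_LR /= skewC ef0 eqxx mulrN1 big1 ?addr0 // => l' lj.
    by rewrite linearZr_LR /= skewC ef0 (negPf lj) oppr0 mulr0.
  have cc : omega (cmb e (c i)) (cmb e (c j)) = 0.
    by rewrite (@omega_cmb _ _ _ e e 0) ?mulmx0 ?mul0mx ?mxE // => k k'; rewrite ee mxE.
  rewrite linearDl /= !linearDr /= fi fe' cc !mxE (skewC omega (f0 j)).
  by field.
rewrite linearDr /= ef0 -(cmb_delta e i) (@omega_cmb _ _ _ e e 0) ?mulmx0 ?mul0mx ?mxE ?addr0 //.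
by move=> k k'; rewrite ee mxE.
Qed.

End LagrangianBases.

(** * Norms of the building and translation lengths *)

Section Norms.
Variables (R : realType) (F : rcfType) (v : F -> \bar R).
Hypothesis hv : order_compatible_valuation v.
Variables (V : vectType F) (omega : {skew_symmetric V}).
Hypothesis homega : nondegenerate omega.
Local Notation n := (half_dim V).
Implicit Types (u w : V) (e f : 'I_n -> V) (t s : 'I_n -> R) (g : 'End(V)).

(** The unique norm split by [(e, f)] with weights [t] (split_normE), written
    through the pairing so that the action of an isometry is visible
    (norm_of_act). *)
Definition norm_of e f t u : \bar R :=
  (\big[mine/+oo]_(i < n)
     mine (v (omega u (f i)) + (t i)%:E) (v (omega (e i) u) - (t i)%:E))%E.

Lemma norm_of_geP e f t u c :
  (c <= norm_of e f t u)%E <->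
  forall i, (c <= v (omega u (f i)) + (t i)%:E)%E /\ (c <= v (omega (e i) u) - (t i)%:E)%E.
Proof.
split=> [/Order.TotalTheory.bigmin_geP [_ h] i|h].
  by have := h i isT; rewrite le_min => /andP.
apply/Order.TotalTheory.bigmin_geP; split=> [|i _]; first exact: leey.
by rewrite le_min; apply/andP.
Qed.

Lemma split_norm_of e f t : darboux omega e f -> split_norm v e f t (norm_of e f t).
Proof.
move=> hef x y; apply: eq_bigr => i _.
pose X : 'rV[F]_n := \row_i x i; pose Y : 'rV[F]_n := \row_i y i.
have -> : \sum_(i < n) (x i *: e i + y i *: f i) = cmb e X + cmb f Y.
  by rewrite big_split; congr (_ + _); apply: eq_bigr => j _; rewrite mxE.
by rewrite (darboux_x hef) (darboux_y hef) !mxE.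
Qed.

Lemma split_normE e f t eta : darboux omega e f -> split_norm v e f t eta ->
  eta = norm_of e f t.
Proof.
move=> hef h; apply/funext => u.
have := h (fun i => omega u (f i)) (fun i => omega (e i) u); rewrite /norm_of => <-.
congr (eta _); rewrite {1}(coordK homega hef u) big_split; congr (_ + _);
  by apply: eq_bigr => i _; rewrite mxE.
Qed.

Lemma building_norm_of e f t : darboux omega e f -> building v omega (norm_of e f t).
Proof.
move=> hef; exists e, f, t; split; last exact: split_norm_of.
exact: darboux_symplectic.
Qed.

Lemma valN_omega u w : v (omega u w) = v (omega w u).
Proof. by rewrite skewC valN. Qed.

(** The pairings of the two families are the entries of the change of basis,
    and the ultrametric inequality bounds the new coordinates through them.
    The weights of [e] and [f] differ by [tau + tau], which relaxes the
    condition on one off-diagonal block and strengthens the other. *)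
Lemma norm_of_le e f e' f' (tau : R) u : darboux omega e f ->
  (forall i j, integral v (omega (e' i) (f j))) ->
  (forall i j, ((tau + tau)%:E <= v (omega (e j) (e' i)))%E) ->
  (forall i j, integral v (omega (e j) (f' i))) ->
  (forall i j, ((- (tau + tau))%:E <= v (omega (f' i) (f j)))%E) ->
  (norm_of e f (fun=> tau) u <= norm_of e' f' (fun=> tau) u)%E.
Proof.
move=> hef hA hB hD hC; set c := norm_of e f _ u.
have hc := (norm_of_geP e f (fun=> tau) u c).1 (lexx _).
have cx j : (c - tau%:E <= v (omega u (f j)))%E.
  by have [h _] := hc j; rewrite leeBlDr.
have cy j : (c + tau%:E <= v (omega (e j) u))%E.
  by have [_ h] := hc j; rewrite -leeBrDr.
have addl (a b d : \bar R) : (0 <= a)%E -> (d <= b)%E -> (d <= a + b)%E.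
  by move=> a0 db; rewrite -[d]add0e; exact: leeD.
apply/norm_of_geP => i; split.
  rewrite -leeBlDr // (coordK homega hef u) linearDl /= !linear_sumlz /=.
  apply: valD_ge => //; apply: val_sum_ge => // j _; rewrite linearZl_LR /= mxE (valuationM hv) [leRHS]addeC.
    apply: addl (cx j); exact: hD.
  rewrite (valN_omega (f j)). apply: le_trans (leeD (hC i j) (cy j)).
  rewrite addeCA -EFinD (_ : - (tau + tau) + tau = - tau) //; lra.
rewrite leeBrDr // (coordK homega hef u) linearDr /= !linear_sumr /=.
apply: valD_ge => //; apply: val_sum_ge => // j _; rewrite linearZr_LR /= mxE (valuationM hv) [leRHS]addeC.
  rewrite (valN_omega (e' i)); apply: le_trans (leeD (hB i j) (cx j)).
  by rewrite addeCA -EFinB (_ : tau + tau - tau = tau) //; lra.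
apply: addl (cy j); exact: hA.
Qed.

(** The inverse of a symplectic matrix has the same entries up to sign and
    transposition, so norm_of_le applies in both directions. *)
Lemma norm_of_eq e f e' f' (tau : R) : darboux omega e f -> darboux omega e' f' ->
  (forall i j, integral v (omega (e' i) (f j))) ->
  (forall i j, ((tau + tau)%:E <= v (omega (e j) (e' i)))%E) ->
  (forall i j, integral v (omega (e j) (f' i))) ->
  (forall i j, ((- (tau + tau))%:E <= v (omega (f' i) (f j)))%E) ->
  norm_of e' f' (fun=> tau) = norm_of e f (fun=> tau).
Proof.
move=> hef hef' hA hB hD hC; apply/funext => u; apply/eqP; rewrite eq_le.
by apply/andP; split; apply: norm_of_le => // i j; rewrite valN_omega.
Qed.

Lemma norm_of_eq0 e f e' f' : darboux omega e f -> darboux omega e' f' ->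
  (forall i j, integral v (omega (e' i) (f j))) ->
  (forall i j, integral v (omega (e j) (e' i))) ->
  (forall i j, integral v (omega (e j) (f' i))) ->
  (forall i j, integral v (omega (f' i) (f j))) ->
  norm_of e' f' (fun=> 0) = norm_of e f (fun=> 0).
Proof.
by move=> hef hef' hA hB hD hC; apply: norm_of_eq => // i j; rewrite addr0 ?oppr0;
  [exact: hB | exact: hC].
Qed.

Lemma norm_of_fam e f (P Q P' Q' : 'M[F]_n) : darboux omega e f ->
  darboux omega (fam e f P Q) (fam e f P' Q') ->
  integralmx v P -> integralmx v Q -> integralmx v P' -> integralmx v Q' ->
  norm_of (fam e f P Q) (fam e f P' Q') (fun=> 0) = norm_of e f (fun=> 0).
Proof.
move=> hef hd hP hQ hP' hQ'; apply: norm_of_eq0 => // i j; rewrite /fam.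
- by rewrite (darboux_x hef) mxE; apply: hP.
- by rewrite (darboux_y hef) mxE; apply: hQ.
- by rewrite (darboux_y hef) mxE; apply: hQ'.
- by rewrite (darboux_x hef) mxE; apply: hP'.
Qed.

(** The weights on [e i] and [f i] are opposite, so they cancel in each term
    of the pairing. This is the self-duality of the points of the building. *)
Lemma norm_of_pairing e f t u w : darboux omega e f ->
  (norm_of e f t u + norm_of e f t w <= v (omega u w))%E.
Proof.
move=> hef; set a := norm_of e f t u; set b := norm_of e f t w.
have ha := (norm_of_geP e f t u a).1 (lexx _).
have hb := (norm_of_geP e f t w b).1 (lexx _).
rewrite (coordK homega hef u) (coordK homega hef w) (darboux_cmb hef) [X in X - _]mxE [X in _ - X]mxE.
have h (x y : \bar R) (c : R) : (a <= x + c%:E)%E -> (b <= y - c%:E)%E -> (a + b <= x + y)%E.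
  move=> ax byc; have -> : (x + y = (x + c%:E) + (y - c%:E))%E.
    by rewrite addeACA -EFinB subrr adde0.
  exact: leeD.
have h' (x y : \bar R) (c : R) : (b <= x + c%:E)%E -> (a <= y - c%:E)%E -> (a + b <= y + x)%E.
  move=> ax byc; have -> : (y + x = (y - c%:E) + (x + c%:E))%E.
    by rewrite addeACA -EFinD addNr adde0.
  exact: leeD.
apply: valD_ge => //; rewrite ?valN //; apply: val_sum_ge => // i _; rewrite !mxE (valuationM hv).
  by apply: (h _ _ (t i)); [case: (ha i) | case: (hb i)].
by apply: (h' _ _ (t i)); [case: (hb i) | case: (ha i)].
Qed.

Lemma norm_of_lb e f t u : exists c : R, (c%:E <= norm_of e f t u)%E.
Proof.
have : norm_of e f t u != -oo%E.
  rewrite gt_eqF //; apply/Order.TotalTheory.bigmin_gtP; split=> // i _.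
  rewrite lt_min; apply/andP; split.
    by have := @valuation_neqNy _ _ _ hv (omega u (f i));
      case: (v _) => [r _|_|/(_ erefl)] //=; rewrite ltNyr.
  by have := @valuation_neqNy _ _ _ hv (omega (e i) u);
      case: (v _) => [r _|_|/(_ erefl)] //=; rewrite ltNyr.
by case: (norm_of e f t u) => [r _|_|//]; [exists r | exists 0; rewrite leey].
Qed.

Lemma norm_of_near e f t s (eps : R) u : (forall i, `|t i - s i| <= eps) ->
  (norm_of e f s u - eps%:E <= norm_of e f t u)%E.
Proof.
move=> h; apply/norm_of_geP => i; set c := norm_of e f s u.
have [h1 h2] := (norm_of_geP e f s u c).1 (lexx _) i.
have := h i; rewrite ler_norml => /andP[l1 l2].
rewrite !leeBlDr //; split.
  apply: le_trans h1 _; rewrite -addeA; apply: leeD => //.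
  by rewrite -EFinD lee_fin; lra.
apply: le_trans h2 _; rewrite -addeA; apply: leeD => //.
by rewrite -EFinN -EFinD lee_fin; lra.
Qed.

Section SymplecticMap.
Variable g : 'End(V).
Hypothesis hg : forall u w, omega (g u) (g w) = omega u w.

Lemma symplectic_ker : lker g == 0%VS.
Proof.
apply/lker0P => u w guw; apply/eqP; rewrite -subr_eq0; apply/eqP.
apply: (nondegP homega) => z; rewrite -hg linearB /= guw subrr linear0l //.
Qed.

Lemma symplecticK : cancel g (g^-1)%VF.
Proof. exact: lker0_lfunK symplectic_ker. Qed.

Lemma symplecticVK : cancel (g^-1)%VF g.
Proof. exact: lker0_lfunVK symplectic_ker. Qed.

Lemma symplecticV u w : omega ((g^-1)%VF u) ((g^-1)%VF w) = omega u w.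
Proof. by rewrite -hg !symplecticVK. Qed.

Lemma symplectic_darboux_map e f : darboux omega e f ->
  darboux omega (fun i => g (e i)) (fun i => g (f i)).
Proof. by case=> ee ff ef; split=> i j; rewrite hg. Qed.

Lemma norm_of_act e f t : building_act g (norm_of e f t) =
  norm_of (fun i => g (e i)) (fun i => g (f i)) t.
Proof.
apply/funext => u; apply: eq_bigr => i _.
by rewrite -(hg ((g^-1)%VF u)) -(hg (e i)) !symplecticVK.
Qed.

(** In a common apartment the norms differ by at most the Euclidean distance
    of their weights. The infimum that defines the translation length need not
    be attained, whence the [eps]. *)
Lemma small_displacement (eps : R) : 0 < eps -> translation_length v omega g = 0%E ->
  exists e f t, darboux omega e f /\
    (forall u, norm_of e f t u - eps%:E <= norm_of e f t (g u))%E /\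
    (forall u, norm_of e f t u - eps%:E <= norm_of e f t ((g^-1)%VF u))%E.
Proof.
move=> e0 L0; have : (translation_length v omega g < eps%:E)%E by rewrite L0 lte_fin.
move=> /ereal_inf_lt [_ [eta hb <-]] /ereal_inf_lt [_ [e [f [t [s [hef sp1 sp2 ->]]]]]].
move/symplectic_darboux in hef; rewrite lte_fin => hd.
exists e, f, s; split=> //.
have E1 := split_normE hef sp1; have E2 := split_normE hef sp2.
have hts i : `|t i - s i| <= eps.
  apply: ltW; apply: le_lt_trans hd; rewrite -sqrtr_sqr ler_wsqrtr //.
  by rewrite (bigD1 i) //= lerDl sumr_ge0 // => j _; rewrite sqr_ge0.
have hst i : `|s i - t i| <= eps by rewrite distrC.
have actE u : norm_of e f t u = norm_of e f s ((g^-1)%VF u).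
  by rewrite -E1 -E2.
split=> u; last by rewrite -actE; apply: norm_of_near.
by have := norm_of_near e f (g u) hst; rewrite actE symplecticK.
Qed.

(** Each application of [g] costs at most [eps] in a nearly fixed norm, and
    that norm bounds the valuation of every pairing by self-duality. *)
Lemma slow_growth (eps : R) u w : 0 < eps -> translation_length v omega g = 0%E ->
  exists C : R, forall k,
    ((C - k%:R * eps)%:E <= v (omega (iter k g u) w))%E /\
    ((C - k%:R * eps)%:E <= v (omega (iter k (g^-1)%VF u) w))%E.
Proof.
move=> e0 L0; have [e [f [t [hef [h1 h2]]]]] := small_displacement e0 L0.
have [c hc] := norm_of_lb e f t u; have [d hd] := norm_of_lb e f t w.
have iterh (h : V -> V) (k : nat) : (forall u, norm_of e f t u - eps%:E <= norm_of e f t (h u))%E ->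
    ((c + d - k%:R * eps)%:E <= v (omega (iter k h u) w))%E.
  move=> hh; apply: le_trans (norm_of_pairing t (iter k h u) w hef).
  have -> : c + d - k%:R * eps = (c - k%:R * eps) + d by lra.
  rewrite EFinD; apply: leeD => //.
  elim: k => [|k IHk]; first by rewrite mul0r subr0.
  rewrite iterS; apply: le_trans (hh _); rewrite leeBrDr // -EFinD.
  by apply: le_trans IHk; rewrite lee_fin -natr1; lra.
by exists (c + d) => k; split; apply: iterh.
Qed.

End SymplecticMap.

Lemma slow_ge0 (r : R) :
  (forall eps, 0 < eps -> exists C : R, forall k : nat, C - k%:R * eps <= k%:R * r) -> 0 <= r.
Proof.
move=> h; rewrite leNgt; apply/negP => r0.
have [C hC] : exists C : R, forall k : nat, C - k%:R * (- r / 2) <= k%:R * r by apply: h; lra.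
(* For this [k] the defect [- C] is smaller than half of [k |r|], against the
   bound for [eps = |r| / 2]. *)
pose k := Num.bound `|- C * (2 / - r)|.
have hk : - C * (2 / - r) < k%:R.
  by rewrite /k; apply: le_lt_trans (ler_norm _) _; apply: archi_boundP; exact: normr_ge0.
have := hC k; have : - C < k%:R * (- r / 2).
  by rewrite -ltr_pdivrMr ?invf_div //; lra.
lra.
Qed.

(** The powers of [A] in any size, including [m = 0], where matrices do not
    form a nontrivial ring. *)
Definition mxpow m (A : 'M[F]_m) k : 'M[F]_m := iter k (mulmx A) 1%:M.

Lemma det_mxpow m (A : 'M[F]_m) k : \det (mxpow A k) = \det A ^+ k.
Proof.
elim: k => [|k IHk]; first by rewrite det1 expr0.
by rewrite /mxpow iterS det_mulmx -/(mxpow A k) IHk exprS.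
Qed.

Lemma mxpowSr m (A : 'M[F]_m) k : mxpow A k.+1 = mxpow A k *m A.
Proof.
elim: k => [|k IHk]; first by rewrite /mxpow /= mulmx1 mul1mx.
transitivity (A *m (mxpow A k *m A)); last by rewrite mulmxA.
by rewrite -IHk.
Qed.

(** The entries of the powers of [A] have valuations that decrease
    sublinearly; over an algebraic closure this says that all eigenvalues are
    integral. *)
Definition slowmx m (A : 'M[F]_m) : Prop :=
  forall eps : R, 0 < eps -> exists C : R, forall k i j,
    ((C - k%:R * eps)%:E <= v (mxpow A k i j))%E.

(** The determinant of the [k]-th power is bounded below like the entries,
    while its valuation is [k] times that of the determinant. *)
Lemma slowmx_det m (A : 'M[F]_m) : \det A != 0 -> slowmx A -> (0 <= v (\det A))%E.
Proof.
move=> d0 hA; rewrite -(fineK (val_fin hv d0)) lee_fin; apply: slow_ge0 => eps e0.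
have m0 : 0 < m%:R + 1 :> R by rewrite ltr_wpDl ?ler0n.
have [C hC] := hA (eps / (m%:R + 1)) (divr_gt0 e0 m0).
exists (m%:R * C) => k.
have := val_det_ge hv (hC k); rewrite det_mxpow valX // lee_fin; apply: le_trans.
rewrite mulrBr lerD2l lerN2 mulrCA; apply: ler_wpM2l; first exact: ler0n.
by rewrite mulrCA ler_piMr ?(ltW e0) // ler_pdivrMr // mul1r lerDl.
Qed.

(** In row coordinates the matrix acts on the right, so composing maps
    multiplies matrices in the opposite order. *)
Definition acts_by (h : V -> V) e (A : 'M[F]_n) : Prop := forall x, h (cmb e x) = cmb e (x *m A).

Lemma acts_by_iter h e A k : acts_by h e A -> acts_by (iter k h) e (mxpow A k).
Proof.
move=> hA; elim: k => [|k IHk] x; first by rewrite /= mulmx1.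
by rewrite iterS IHk hA mxpowSr mulmxA.
Qed.

Lemma acts_by_unit e f A g : darboux omega e f ->
  (forall u w, omega (g u) (g w) = omega u w) -> acts_by g e A -> A \in unitmx.
Proof.
move=> hef hg hA; rewrite -row_free_unit -kermx_eq0; apply/eqP/row_matrixP => i.
rewrite row0; have : row i (kermx A) *m A = 0 by rewrite -row_mul mulmx_ker row0.
move: (row i _) => x xA; have := hA x; rewrite xA linear0 => gx.
have : cmb e x + cmb f 0 = 0.
  by rewrite linear0 addr0 -[LHS](symplecticK hg) gx linear0.
by case/(cmb_eq0 hef).
Qed.

Lemma acts_byV e f A g : darboux omega e f ->
  (forall u w, omega (g u) (g w) = omega u w) -> acts_by g e A ->
  acts_by (g^-1)%VF e (invmx A).
Proof.
move=> hef hg hA x; have uA := acts_by_unit hef hg hA.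
by rewrite -[x in LHS](mulmxKV uA) -hA symplecticK.
Qed.

Lemma acts_by_exists e f l (h : 'End(V)) : darboux omega e f -> lagrangian omega l ->
  (forall i, e i \in l) -> (forall u, u \in l -> h u \in l) -> exists A, acts_by h e A.
Proof.
move=> hef hl el hh; exists (\matrix_i xcoord omega f (h (e i))) => x.
rewrite -cmb_comb [in LHS]/cmb linear_sum; apply: eq_bigr => i _.
by rewrite linearZ /comb_fam rowK -(lagrangian_cmb homega hef hl el) // hh.
Qed.

(** A symplectic map that stabilizes two transverse Lagrangians acts on them
    by contragredient matrices. *)
Lemma acts_by_dual e f l (h : 'End(V)) A : darboux omega e f -> lagrangian omega l ->
  (forall i, f i \in l) -> (forall u, u \in l -> h u \in l) ->
  (forall u w, omega (h u) (h w) = omega u w) ->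
  acts_by h e A -> acts_by h f (invmx A)^T.
Proof.
move=> hef hl fl hh ho hA y; have hy : h (cmb f y) \in l by rewrite hh // mem_cmb.
rewrite (lagrangian_cmb' homega hef hl fl hy); congr cmb; apply/rowP => i; rewrite mxE.
rewrite -{1}(symplecticVK ho (e i)) ho -(cmb_delta e i).
rewrite (acts_byV hef ho hA) (darboux_ef hef) -rowE [LHS]mxE [RHS]mxE.
by apply: eq_bigr => k _; rewrite [X in X * _]mxE [X in _ * X]mxE [in RHS]mxE mulrC.
Qed.

Lemma acts_by_slow e f A g : darboux omega e f ->
  (forall u w, omega (g u) (g w) = omega u w) -> acts_by g e A ->
  translation_length v omega g = 0%E -> slowmx A /\ slowmx (invmx A).
Proof.
move=> hef hg hA L0.
have entry h B k i j : acts_by h e B -> mxpow B k i j = omega (iter k h (e i)) (f j).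
  move=> hB; rewrite -(cmb_delta e i) (acts_by_iter k hB).
  by rewrite -[cmb e _]addr0 -(linear0 (cmb f)) (darboux_x hef) -rowE mxE.
have key eps : 0 < eps -> exists C : R, forall k i j,
    ((C - k%:R * eps)%:E <= v (omega (iter k g (e i)) (f j)))%E /\
    ((C - k%:R * eps)%:E <= v (omega (iter k (g^-1)%VF (e i)) (f j)))%E.
  move=> e0.
  have /choice[C hC] : forall p : 'I_n * 'I_n, exists C : R, forall k,
    ((C - k%:R * eps)%:E <= v (omega (iter k g (e p.1)) (f p.2)))%E /\
    ((C - k%:R * eps)%:E <= v (omega (iter k (g^-1)%VF (e p.1)) (f p.2)))%E.
    by move=> p; apply: slow_growth.
  exists (\big[Order.min/0]_p C p) => k i j.
  have Cij : \big[Order.min/0]_p C p <= C (i, j) by exact: Order.TotalTheory.bigmin_le.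
  have [c1 c2] := hC (i, j) k.
  by split; [apply: le_trans c1 | apply: le_trans c2]; rewrite lee_fin lerD2r.
split=> eps /key[C hC]; exists C => k i j.
  by rewrite (entry g) //; case: (hC k i j).
rewrite (entry (g^-1)%VF); first by case: (hC k i j).
exact: acts_byV hef hg hA.
Qed.

(** Both [A] and its inverse are slow. *)
Lemma acts_by_det e f A g : darboux omega e f ->
  (forall u w, omega (g u) (g w) = omega u w) -> acts_by g e A ->
  translation_length v omega g = 0%E -> v (\det A) = 0%E.
Proof.
move=> hef hg hA L0; have [s1 s2] := acts_by_slow hef hg hA L0.
have := acts_by_unit hef hg hA; rewrite unitmxE unitfE => d0.
have h1 := slowmx_det d0 s1; apply/eqP; rewrite eq_le h1 andbT.
have := slowmx_det _ s2; rewrite det_inv invr_eq0 => /(_ d0).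
by rewrite valV // leeNr oppe0.
Qed.

(** All distances are nonnegative, and the distance from the fixed norm to its
    image is 0, as seen in any apartment through that norm. *)
Lemma translation_length_fixed g eta : building v omega eta ->
  building_act g eta = eta -> translation_length v omega g = 0%E.
Proof.
move=> [e [f [t [hef hs]]]] fixeta; apply/eqP; rewrite eq_le; apply/andP; split.
  apply: ge_ereal_inf; exists (building_dist v omega (building_act g eta) eta).
    by exists eta => //; exists e, f, t.
  apply: ge_ereal_inf; exists 0%E => //; exists e, f, t, t; split=> //.
    by rewrite fixeta.
  by rewrite big1 ?sqrtr0 // => i _; rewrite subrr expr0n.
apply/ereal_infP => _ [mu _ <-]; apply/ereal_infP => _ [e' [f' [t' [s' [_ _ _ ->]]]]].
by rewrite lee_fin sqrtr_ge0.
Qed.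

End Norms.

(** * Lattices preserved by a matrix of slow growth *)

Section SlowMatrices.
Variables (R : realType) (F : rcfType) (v : F -> \bar R).
Hypothesis hv : order_compatible_valuation v.
Local Notation C := F[i]%C.
Local Notation normc := (@Normc.normc F).

Lemma val_family_lb (I : finType) (x : I -> F) : exists c : R, forall i, (c%:E <= v (x i))%E.
Proof.
have h i : exists c : R, (c%:E <= v (x i))%E.
  have := @valuation_neqNy _ _ _ hv (x i).
  by case: (v _) => [r _|_|/(_ erefl)//]; [exists r | exists 0; rewrite leey].
have [c hc] := choice h; exists (\big[Order.min/0]_i c i) => i.
by apply: le_trans (hc i); rewrite lee_fin; exact: Order.TotalTheory.bigmin_le.
Qed.

Lemma normc_real x : normc (real_complex F x) = `|x|.
Proof. by rewrite /= expr0n addr0 sqrtr_sqr. Qed.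

Lemma normc_ge0 (z : C) : 0 <= normc z.
Proof. by case: z => a b; exact: sqrtr_ge0. Qed.

Lemma normcX (z : C) k : normc (z ^+ k) = normc z ^+ k.
Proof.
elim: k => [|k IHk]; first by rewrite !expr0 Normc.normc1.
by rewrite !exprS Normc.normcM IHk.
Qed.

Lemma normc_sum (I : Type) (r : seq I) (E : I -> C) :
  normc (\sum_(i <- r) E i) <= \sum_(i <- r) normc (E i).
Proof.
apply: (big_ind2 (fun (z : C) x => normc z <= x)) => //; first by rewrite Normc.normc0.
by move=> z x w y zx wy; apply: le_trans (le_normcD _ _) _; exact: lerD.
Qed.

(** Apply the powers of [B] to an eigenvector and compare absolute values in a
    nonzero coordinate: the powers of [z] decrease in valuation no faster than
    the entries of those of [B]. *)
Lemma slow_eigenvalue n (B : 'M[F]_n) (z : C) (w : 'rV[C]_n) : slowmx v B ->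
  w != 0 -> w *m map_mx (real_complex F) B = z *: w -> integral v (normc z).
Proof.
move=> slowB w0 wB; have [z0|z0] := eqVneq z 0.
  by rewrite z0 Normc.normc0; exact: integral0.
have wBk k : w *m map_mx (real_complex F) (mxpow B k) = z ^+ k *: w.
  elim: k => [|k IHk]; first by rewrite /mxpow /= map_mx1 mulmx1 scale1r.
  by rewrite mxpowSr map_mxM mulmxA IHk -scalemxAl wB scalerA exprSr.
have [j wj] := rV0Pn _ w0.
have nz0 : normc z != 0 by apply: contra_neq z0; exact: Normc.eq0_normc.
have nw0 : normc (w 0 j) != 0 by apply: contra_neq wj; exact: Normc.eq0_normc.
have [c hc] := val_family_lb (fun i => normc (w 0 i)).
rewrite /integral -(fineK (val_fin hv nz0)) lee_fin; apply: slow_ge0 => eps e0.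
have [D hD] := slowB eps e0.
exists (c + D - fine (v (normc (w 0 j)))) => k.
have le1 : normc z ^+ k * normc (w 0 j) <= \sum_i normc (w 0 i) * `|mxpow B k i j|.
  have := congr1 (fun u : 'rV[C]_n => normc (u 0 j)) (wBk k).
  rewrite !mxE Normc.normcM normcX => <-; apply: le_trans (normc_sum _ _) _.
  by apply: ler_sum => i _; rewrite Normc.normcM mxE normc_real.
have := @val_le _ _ _ hv (normc z ^+ k * normc (w 0 j)) (\sum_i normc (w 0 i) * `|mxpow B k i j|).
rewrite !ger0_norm ?mulr_ge0 ?exprn_ge0 ?normc_ge0 //; last first.
  by rewrite sumr_ge0 // => i _; rewrite mulr_ge0 // normc_ge0.
move=> /(_ le1); rewrite (valuationM hv) valX // -{1}(fineK (val_fin hv nw0)) -EFinD => le2.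
have : ((c + (D - k%:R * eps))%:E <= v (\sum_i normc (w 0 i) * `|mxpow B k i j|)%R)%E.
  apply: val_sum_ge => // i _; rewrite (valuationM hv) EFinD; apply: leeD => //.
  by rewrite val_norm.
by move/le_trans => /(_ _ le2); rewrite lee_fin; lra.
Qed.

Lemma slow_eigenvalue_root n (A : 'M[F]_n) m (z : C) : slowmx v (mxpow A m.+1) ->
  eigenvalue (map_mx (real_complex F) A) z -> integral v (normc z).
Proof.
move=> slowA /eigenvalueP [w wA w0].
have wAk k : w *m map_mx (real_complex F) (mxpow A k) = z ^+ k *: w.
  elim: k => [|k IHk]; first by rewrite /mxpow /= map_mx1 mulmx1 scale1r.
  by rewrite mxpowSr map_mxM mulmxA IHk -scalemxAl wA scalerA exprSr.
have := slow_eigenvalue slowA w0 (wAk _); rewrite normcX.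
have [->|nz0] := eqVneq (normc z) 0; first by move=> _; exact: integral0.
rewrite /integral valX // -[in X in _ -> X](fineK (val_fin hv nz0)) !lee_fin.
by rewrite pmulr_rge0 ?ltr0n.
Qed.

(** The roots of the characteristic polynomial in [F[i]] have integral
    absolute values, hence so do its coefficients, which are polynomials in
    the roots. *)
Lemma slow_char_poly n (A : 'M[F]_n) m : slowmx v (mxpow A m.+1) ->
  forall i, integral v (char_poly A)`_i.
Proof.
move=> slowA; pose f := real_complex F; pose p := map_poly f (char_poly A).
have pE : p = char_poly (map_mx f A) by rewrite /p map_char_poly.
have [r pr] := closed_field_poly_normal p.
have lc : lead_coef p = 1 by rewrite pE; apply/monicP; exact: char_poly_monic.
rewrite lc scale1r in pr.
have rint z : z \in r -> integral v (normc z).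
  move=> zr; apply: (slow_eigenvalue_root slowA).
  by rewrite eigenvalue_root_char -pE pr root_prod_XsubC.
suff h : forall i, integral v (normc p`_i).
  move=> i; have := h i; rewrite coef_map normc_real.
  by rewrite /integral val_norm.
rewrite pr; elim: r rint {pr} => [|z r IHr] rint i.
  rewrite big_nil coef1; case: (i == 0)%N; rewrite ?Normc.normc1 ?Normc.normc0.
    exact: integral1.
  exact: integral0.
have {}IHr : forall i, integral v (normc (\prod_(z <- r) ('X - z%:P))`_i).
  by apply: IHr => w wr; apply: rint; rewrite inE wr orbT.
have zint : integral v (normc z) by apply: rint; rewrite inE eqxx.
rewrite big_cons mulrBl coefB coefXM coefCM.
set q := \prod_(z <- r) _ in IHr *.
have normD (x y : C) : integral v (normc x) -> integral v (normc y) -> integral v (normc (x - y)).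
  move=> hx hy; apply: (integral_le hv (y := normc x + normc y)); last exact: integralD.
  rewrite !ger0_norm ?addr_ge0 ?normc_ge0 //.
  by rewrite -(normcN y); exact: le_normcD.
apply: normD; last by rewrite Normc.normcM; exact: integralM.
by case: eqP => _; rewrite ?Normc.normc0 //; exact: integral0.
Qed.

(** Among the bases formed by rows of [1, A, ..., A ^ (n - 1)], one of maximal
    determinant spans all these rows integrally, by Cramer's rule. The lattice
    it spans is stable under [A], since the integral characteristic polynomial
    expresses [A ^ n] through lower powers. *)
Lemma slow_lattice n (A : 'M[F]_n) m : slowmx v (mxpow A m.+1) -> v (\det A) = 0%E ->
  exists2 P : 'M[F]_n, P \in unitmx & integral_unitmx v (P *m A *m invmx P).
Proof.
case: n A => [|n] A slowA dA.
  exists 1%:M; first exact: unitmx1.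
  by split=> [||]; rewrite ?[_ *m _]flatmx0 ?unitmxE ?det_mx00 ?unitr1 // => -[].
pose Q (c : {ffun 'I_n.+1 -> 'I_n.+1 * 'I_n.+1}) : 'M[F]_n.+1 :=
  \matrix_i row (c i).1 (A ^+ (c i).2).
(* The rows of the identity matrix show that the maximal determinant is not
   0. *)
pose c0 : {ffun 'I_n.+1 -> 'I_n.+1 * 'I_n.+1} := [ffun i => (i, 0)].
have Q0 : Q c0 = 1%:M.
  by apply/row_matrixP => i; rewrite rowK ffunE /= expr0.
pose c := [arg max_(c > c0) `|\det (Q c)|]%O.
have cmax c' : `|\det (Q c')| <= `|\det (Q c)|.
  by rewrite /c; case: Order.TotalTheory.arg_maxP => // i _; apply.
set P := Q c; have dP : \det P != 0.
  rewrite -normr_gt0; apply: lt_le_trans (cmax c0); rewrite Q0 det1 normr1; exact: ltr01.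
have uP : P \in unitmx by rewrite unitmxE unitfE.
have span (i j : 'I_n.+1) : integralmx v (row i (A ^+ j) *m invmx P).
  move=> i0 k; rewrite ord1 {i0}; set u := row i _.
  pose c' : {ffun 'I_n.+1 -> 'I_n.+1 * 'I_n.+1} := [ffun l => if l == k then (i, j) else c l].
  suff -> : (u *m invmx P) 0 k = \det (Q c') / \det P.
    apply: (integral_le hv (y := 1)); last exact: integral1.
    by rewrite normr1 normrM normfV ler_pdivrMr ?normr_gt0 // mul1r.
  (* Cramer's rule: expand along row [k] the determinant of the basis whose
     [k]-th vector is replaced by [u]. *)
  rewrite /invmx uP -scalemxAr mxE mulrC; congr (_ / _).
  rewrite (expand_det_row _ k) mxE; apply: eq_bigr => l _; rewrite [in RHS]mxE ffunE eqxx /=.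
  rewrite [in LHS]mxE; congr (_ * _); rewrite /u !mxE //.
  rewrite /cofactor; congr (_ * \det _); apply/matrixP => x y; rewrite !mxE.
  by rewrite ffunE eq_sym (negPf (neq_lift _ _)).
have chi := slow_char_poly slowA.
have spanS (i : 'I_n.+1) (j : 'I_n.+1) : integralmx v (row i (A ^+ j.+1) *m invmx P).
  have [jn|jn] := ltnP j.+1 n.+1; first exact: (span i (Ordinal jn)).
  have -> : j.+1 = n.+1 by apply/eqP; rewrite eqn_leq jn ltn_ord.
  have CH : A ^+ n.+1 = - \sum_(k < n.+1) (char_poly A)`_k *: A ^+ k.
    have := Cayley_Hamilton A; rewrite -{1}(coefK (char_poly A)) poly_def size_char_poly.
    rewrite big_ord_recr /= linearD /= linear_sum /=.
    have := char_poly_monic A; rewrite monicE lead_coefE size_char_poly /= => /eqP ->.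
    rewrite scale1r rmorphXn /= horner_mx_X addrC => /eqP; rewrite addr_eq0 => /eqP ->.
    congr (- _); apply: eq_bigr => k _.
    by rewrite linearZ /= rmorphXn /= horner_mx_X.
  rewrite CH linearN linear_sum /= mulNmx mulmx_suml; apply: integralmxN => // i0 k.
  rewrite summxE; apply: integral_sum => // l _; rewrite linearZ /= -scalemxAl mxE.
  by apply: integralM => //; apply: span.
exists P => //; set X := P *m A *m invmx P.
have iX : integralmx v X.
  move=> i k; have -> : X i k = (row (c i).1 (A ^+ (c i).2.+1) *m invmx P) 0 k.
    have -> : row (c i).1 (A ^+ (c i).2.+1) = row i (P *m A).
      by rewrite row_mul /P rowK -row_mul exprSr.
    by rewrite -row_mul -/X [RHS]mxE.
  exact: spanS.
have dX : v (\det X) = 0%E.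
  by rewrite !det_mulmx det_inv mulrAC divff // mul1r.
split=> //; last exact: integralmx_inv.
rewrite unitmxE unitfE; apply/eqP => d0; move: dX; rewrite d0 val0 //.
Qed.

End SlowMatrices.

(** * The boundary of the hyperbolic plane *)

Lemma det_mx22 (K : comNzRingType) (M : 'M[K]_2) : \det M = M 0 0 * M 1 1 - M 0 1 * M 1 0.
Proof.
rewrite (expand_det_row _ 0) !big_ord_recl big_ord0 addr0 /cofactor !det_mx11 !mxE /=.
have -> : lift 0 0 = 1 :> 'I_2 by apply: val_inj.
have -> : lift (1 : 'I_2) 0 = 0 :> 'I_2 by apply: val_inj.
by rewrite expr0 expr1 mul1r mulN1r mulrN.
Qed.

Section Boundary.
Local Open Scope quotient_scope.
Variable R : realType.
Implicit Types (x y z a b c d : option R) (p q : PSL2 R) (A B : SL2 R).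

(** Homogeneous coordinates on the projective line, in which infinity is not
    exceptional. *)
Definition hcoord x : R * R := if x is Some t then (t, 1) else (1, 0).

Definition bracket x y : R :=
  (hcoord x).1 * (hcoord y).2 - (hcoord x).2 * (hcoord y).1.

Lemma bracketC x y : bracket x y = - bracket y x.
Proof. by rewrite /bracket; ring. Qed.

Lemma bracket_eq0 x y : bracket x y = 0 -> x = y.
Proof.
case: x y => [s|] [t|] //=; rewrite /bracket /=.
- by move=> h; congr Some; lra.
- by move=> h; exfalso; lra.
- by move=> h; exfalso; lra.
Qed.

(** Rescaling the homogeneous coordinates of a point multiplies the product by
    a square, so its sign makes sense on the projective line; this is the
    invariant form of the cyclic order. *)
Lemma orientedE x y z :
  positively_oriented x y z = (0 < bracket x y * bracket y z * bracket z x).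
Proof.
rewrite /positively_oriented /bracket.
case: x y z => [x|] [y|] [z|] //=; rewrite ?mulr1 ?mul1r ?mulr0 ?mul0r ?subr0 ?sub0r ?subrr
  ?mulr0 ?mul0r ?mulrN1 ?mulr1 ?mulN1r ?ltxx ?andbF ?orbF ?andbT //.
- have pos (r s t : R) : r < s -> s < t -> 0 < (s - r) * (t - s) * (t - r).
    by move=> rs st; rewrite !mulr_gt0 //; lra.
  apply/idP/idP => [/or3P[]/andP[h1 h2]|].
  + by have := pos _ _ _ h1 h2; lra.
  + by have := pos _ _ _ h1 h2; lra.
  + by have := pos _ _ _ h1 h2; lra.
  case: (ltgtP x y) => [xy|yx|xy]; case: (ltgtP y z) => [yz|zy|yz];
    case: (ltgtP z x) => [zx|xz|zx] //= h;
    exfalso; subst; try lra.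
  + by have := pos _ _ _ xz zy; lra.
  + by have := pos _ _ _ yx xz; lra.
  + by have := pos _ _ _ zy yx; lra.
- by apply/idP/idP => h; lra.
- by apply/idP/idP => h; lra.
- by apply/idP/idP => h; lra.
Qed.

Lemma SL2_det A : A 0 0 * A 1 1 - A 0 1 * A 1 0 = 1.
Proof. by rewrite -det_mx22; apply/eqP; case: A. Qed.

(** The action of a matrix is linear in homogeneous coordinates, up to the
    factor [k]. *)
Lemma hcoord_act A x : exists2 k, k != 0 &
  A 0 0 * (hcoord x).1 + A 0 1 * (hcoord x).2 = k * (hcoord (boundary_mx A x)).1 /\
  A 1 0 * (hcoord x).1 + A 1 1 * (hcoord x).2 = k * (hcoord (boundary_mx A x)).2.
Proof.
have dA := SL2_det A; case: x => [t|] /=.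
  case: eqVneq => [h0|h0] /=.
    exists (A 0 0 * t + A 0 1); last by rewrite !mulr1 mulr0.
    apply/eqP => h1; have : 1 = 0 :> R.
      rewrite -dA.
      transitivity (A 0 0 * (A 1 0 * t + A 1 1) - A 1 0 * (A 0 0 * t + A 0 1)); first by ring.
      by rewrite h0 h1 !mulr0 subrr.
    by move/eqP; rewrite oner_eq0.
  by exists (A 1 0 * t + A 1 1) => //; split; rewrite !mulr1 // [RHS]mulrC divfK.
case: eqVneq => [h0|h0] /=.
  exists (A 0 0); last by rewrite !mulr1 !mulr0 !addr0.
  apply/eqP => h1; have : 1 = 0 :> R by rewrite -dA h0 h1 mul0r mulr0 subrr.
  by move/eqP; rewrite oner_eq0.
by exists (A 1 0) => //; rewrite !mulr1 !mulr0 !addr0 [RHS]mulrC divfK.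
Qed.

(** The three brackets are multiplied by products of the rescaling factors, in
    which each factor occurs twice. *)
Lemma oriented_act p x y z :
  positively_oriented (boundary_act p x) (boundary_act p y) (boundary_act p z) =
  positively_oriented x y z.
Proof.
rewrite !orientedE /boundary_act; set A := repr p.
have [k k0 [kx1 kx2]] := hcoord_act A x; have [l l0 [ly1 ly2]] := hcoord_act A y.
have [m m0 [mz1 mz2]] := hcoord_act A z.
have br u w k1 k2 :
    A 0 0 * (hcoord u).1 + A 0 1 * (hcoord u).2 = k1 * (hcoord (boundary_mx A u)).1 ->
    A 1 0 * (hcoord u).1 + A 1 1 * (hcoord u).2 = k1 * (hcoord (boundary_mx A u)).2 ->
    A 0 0 * (hcoord w).1 + A 0 1 * (hcoord w).2 = k2 * (hcoord (boundary_mx A w)).1 ->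
    A 1 0 * (hcoord w).1 + A 1 1 * (hcoord w).2 = k2 * (hcoord (boundary_mx A w)).2 ->
    bracket u w = k1 * k2 * bracket (boundary_mx A u) (boundary_mx A w).
  move=> e1 e2 e3 e4; rewrite -[LHS]mul1r -(SL2_det A) /bracket.
  transitivity ((k1 * (hcoord (boundary_mx A u)).1) * (k2 * (hcoord (boundary_mx A w)).2) -
    (k1 * (hcoord (boundary_mx A u)).2) * (k2 * (hcoord (boundary_mx A w)).1)); last by ring.
  by rewrite -e1 -e2 -e3 -e4; ring.
rewrite (br x y k l) // (br y z l m) // (br z x m k) //.
set b1 := bracket _ _; set b2 := bracket _ _; set b3 := bracket _ _.
rewrite (_ : k * l * b1 * (l * m * b2) * (m * k * b3) = (k * l * m) ^+ 2 * (b1 * b2 * b3)); last by ring.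
have kk : 0 < (k * l * m) ^+ 2 by rewrite exprn_even_gt0 //= !mulf_neq0.
by rewrite (pmulr_rgt0 _ kk).
Qed.

Lemma boundary_mul p q x : boundary_act (p * q)%g x = boundary_act p (boundary_act q x).
Proof.
have -> : (p * q)%g = \pi_(PSL2 R) (SL2_mul (repr p) (repr q)) by [].
rewrite pi_boundary /boundary_act; move: (repr p) (repr q) => A B {p q}.
set y := boundary_mx B x.
have [k k0 [k1 k2]] := hcoord_act (SL2_mul A B) x; have [l l0 [l1 l2]] := hcoord_act B x.
have [m m0 [m1 m2]] := hcoord_act A y.
apply: bracket_eq0; apply: (mulfI k0); apply: (mulfI m0); apply: (mulfI l0).
rewrite !mulr0 /bracket.
transitivity (l * ((k * (hcoord (boundary_mx (SL2_mul A B) x)).1) * (m * (hcoord (boundary_mx A y)).2) -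
   (k * (hcoord (boundary_mx (SL2_mul A B) x)).2) * (m * (hcoord (boundary_mx A y)).1))); first by ring.
rewrite -k1 -k2 -m1 -m2 mulrBr.
transitivity ((SL2_mul A B 0 0 * (hcoord x).1 + SL2_mul A B 0 1 * (hcoord x).2) *
   (A 1 0 * (l * (hcoord y).1) + A 1 1 * (l * (hcoord y).2)) -
   (SL2_mul A B 1 0 * (hcoord x).1 + SL2_mul A B 1 1 * (hcoord x).2) *
   (A 0 0 * (l * (hcoord y).1) + A 0 1 * (l * (hcoord y).2))); first by ring.
rewrite -l1 -l2 /= !mxE !big_ord_recl !big_ord0 !addr0.
have -> : lift ord0 ord0 = 1 :> 'I_2 by apply: val_inj.
ring.
Qed.

Lemma boundary_one x : boundary_act 1%g x = x.
Proof.
have -> : 1%g = \pi_(PSL2 R) (SL2_one R) by [].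
rewrite pi_boundary /boundary_mx /SL2_one /= !mxE /=.
by case: x => [t|]; rewrite ?mul0r ?add0r ?mul1r ?addr0 ?oner_eq0 ?divr1 ?eqxx.
Qed.

Lemma boundaryK p x : boundary_act p^-1%g (boundary_act p x) = x.
Proof. by rewrite -boundary_mul mulVg boundary_one. Qed.

Lemma boundaryVK p x : boundary_act p (boundary_act p^-1%g x) = x.
Proof. by rewrite -boundary_mul mulgV boundary_one. Qed.

Lemma oriented_rot x y z : positively_oriented x y z = positively_oriented y z x.
Proof. by rewrite !orientedE; congr (0 < _); ring. Qed.

(** Take coordinates of [a] and [b] as columns, rescaled to get determinant
    1. *)
Lemma boundary_transitive a b : a != b -> exists h : PSL2 R,
  boundary_act h None = a /\ boundary_act h (Some 0) = b.
Proof.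
move=> ab; have br0 : bracket a b != 0 by apply: contra_neq ab; exact: bracket_eq0.
pose M : 'M[R]_2 := \matrix_(i, j)
  if j == 0 then (if i == 0 then (hcoord a).1 else (hcoord a).2) / bracket a b
  else (if i == 0 then (hcoord b).1 else (hcoord b).2).
have dM : \det M == 1.
  rewrite det_mx22 !mxE /= -[X in X == _](_ : bracket a b / bracket a b = _).
    by rewrite divff.
  by rewrite /bracket; ring.
exists (\pi_(PSL2 R) (MkSL2 dM)); rewrite pi_boundary.
split; apply: bracket_eq0.
  have [k k0] := hcoord_act (MkSL2 dM) None; rewrite /= !mxE /= !mulr1 !mulr0 !addr0 => -[k1 k2].
  apply: (mulfI k0); rewrite mulr0 /bracket mulrBr !mulrA -k1 -k2.
  by ring.
have [k k0] := hcoord_act (MkSL2 dM) (Some 0); rewrite /= !mxE /= !mulr1 !mulr0 !add0r => -[k1 k2].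
apply: (mulfI k0); rewrite mulr0 /bracket mulrBr !mulrA -k1 -k2.
by ring.
Qed.

Lemma hyperbolic_conj p h : hyperbolic p -> hyperbolic (h^-1 * (p * h))%g.
Proof.
rewrite -[p]reprK -[h]reprK; move: (repr p) (repr h) => A H.
have -> : ((\pi_(PSL2 R) H)^-1 * (\pi_(PSL2 R) A * \pi_(PSL2 R) H))%g =
    \pi_(PSL2 R) (SL2_mul (SL2_inv H) (SL2_mul A H)).
  rewrite -[LHS]/(PSL2_mul (PSL2_inv (\pi_(PSL2 R) H)) (PSL2_mul (\pi_(PSL2 R) A) (\pi_(PSL2 R) H))).
  by rewrite Defs.pi_inv !Defs.pi_mul.
by rewrite !pi_hyperbolic /= mulmxA mxtrace_mulC mulmxA mulmxV ?SL2_unit // mul1mx.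
Qed.

(** Conjugating the fixed points to infinity and 0 makes the matrix diagonal,
    and the map a homothety of ratio the square of an eigenvalue. *)
Lemma hyperbolic_normal p a b : hyperbolic p -> a != b ->
  boundary_act p a = a -> boundary_act p b = b -> exists h lambda,
  [/\ boundary_act h None = a, boundary_act h (Some 0) = b, 0 < lambda, lambda != 1 &
      forall t, boundary_act p (boundary_act h (Some t)) = boundary_act h (Some (lambda * t))].
Proof.
move=> hp ab pa pb; have [h [ha hb]] := boundary_transitive ab.
pose q := (h^-1 * (p * h))%g; have hq : hyperbolic q by apply: hyperbolic_conj.
have qN : boundary_act q None = None by rewrite !boundary_mul ha pa -ha boundaryK.
have q0 : boundary_act q (Some 0) = Some 0 by rewrite !boundary_mul hb pb -hb boundaryK.
have ph x : boundary_act p (boundary_act h x) = boundary_act h (boundary_act q x).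
  by rewrite /q !boundary_mul boundaryVK.
pose A := repr q.
have c0 : A 1 0 = 0.
  by move: qN; rewrite /boundary_act /= -/A; case: eqP.
have dA := SL2_det A; rewrite c0 mulr0 subr0 in dA.
have d0 : A 1 1 != 0 by apply/eqP => d0; move: dA; rewrite d0 mulr0 => /eqP; rewrite eq_sym oner_eq0.
have b0 : A 0 1 = 0.
  move: q0; rewrite /boundary_act /= -/A c0 mul0r !mulr0 !add0r (negPf d0) => -[] /eqP.
  by rewrite mulf_eq0 invr_eq0 (negPf d0) orbF => /eqP.
have aE : A 1 1 = (A 0 0)^-1.
  by apply: (mulfI (_ : A 0 0 != 0)); rewrite ?dA ?divff //;
    apply/eqP => a0; move: dA; rewrite a0 mul0r => /eqP; rewrite eq_sym oner_eq0.
have a0 : A 0 0 != 0 by rewrite -invr_eq0 -aE.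
exists h, (A 0 0 ^+ 2); split=> //.
- by rewrite exprn_even_gt0.
- apply: contraPneq hq => l1; rewrite /hyperbolic -/A /mxtrace !big_ord_recl big_ord0 addr0.
  have -> : lift ord0 ord0 = 1 :> 'I_2 by apply: val_inj.
  have : (A 0 0 - 1) * (A 0 0 + 1) = A 0 0 ^+ 2 - 1 by ring.
  rewrite l1 subrr => /eqP; rewrite aE mulf_eq0 subr_eq0 addr_eq0 => /orP[]/eqP ->.
    by rewrite invr1 -natr1 ger0_norm ?ltxx.
  by rewrite invrN invr1 -opprD normrN ger0_norm ?ltxx.
- move=> t; rewrite ph; congr (boundary_act h _).
  rewrite /boundary_act /= -/A c0 b0 mul0r add0r addr0 (negPf d0) aE invrK; congr Some.
  by ring.
Qed.

Lemma hyperbolic_fixed p a b c : hyperbolic p -> a != b ->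
  boundary_act p a = a -> boundary_act p b = b -> boundary_act p c = c -> c = a \/ c = b.
Proof.
move=> hp ab pa pb pc; have [h [l [ha hb l0 l1 hl]]] := hyperbolic_normal hp ab pa pb.
move: pc; rewrite -(boundaryVK h c); case: (boundary_act h^-1%g c) => [t|]; last by left.
rewrite hl => /(congr1 (boundary_act h^-1%g)); rewrite !boundaryK => -[] /eqP.
rewrite -subr_eq0 -[X in _ - X]mul1r -mulrBl mulf_eq0 subr_eq0 (negPf l1) /= => /eqP ->.
by right.
Qed.

Lemma expr_unbounded (l c : R) : 1 < l -> exists k, c < l ^+ k.
Proof.
move=> l1; have bern k : 1 + k%:R * (l - 1) <= l ^+ k.
  elim: k => [|k IHk]; first by rewrite mul0r addr0 expr0.
  rewrite exprS -natr1; have : l * (1 + k%:R * (l - 1)) <= l * l ^+ k by rewrite ler_pM2l //; lra.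
  have : 0 <= k%:R * (l - 1) * (l - 1) by rewrite !mulr_ge0 ?ler0n //; lra.
  lra.
exists (Num.bound `|c / (l - 1)|); apply: lt_le_trans (bern _).
have : c / (l - 1) < (Num.bound `|c / (l - 1)|)%:R.
  by apply: le_lt_trans (ler_norm _) _; apply: archi_boundP; exact: normr_ge0.
rewrite ltr_pdivrMr; last by lra.
lra.
Qed.

Lemma boundary_iter p k x : boundary_act (p ^+ k)%g x = iter k (boundary_act p) x.
Proof.
elim: k => [|k IHk]; first by rewrite expg0 boundary_one.
by rewrite expgS boundary_mul IHk.
Qed.

(** North-south dynamics: for a homothety, powers of the ratio eventually pass
    any given quotient of two points of the same sign. *)
Lemma hyperbolic_sandwich p a b x y : hyperbolic p -> a != b ->
  boundary_act p a = a -> boundary_act p b = b ->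
  positively_oriented a x b -> positively_oriented a y b ->
  exists q k, [/\ q = p \/ q = p^-1%g,
    positively_oriented a (boundary_act (q ^+ k)%g x) y &
    positively_oriented y (boundary_act (q^-1 ^+ k)%g x) b].
Proof.
move=> hp ab pa pb axb ayb; have [h [l [ha hb l0 l1 hl]]] := hyperbolic_normal hp ab pa pb.
have hVl t : boundary_act p^-1%g (boundary_act h (Some t)) = boundary_act h (Some (l^-1 * t)).
  have lt0 : l != 0 by rewrite gt_eqF.
  by rewrite -{1}[t](mulVKf lt0) -hl boundaryK.
have [q [m [hq m1 hm hmV]]] : exists q m, [/\ q = p \/ q = p^-1%g, 1 < m,
    (forall t, boundary_act q (boundary_act h (Some t)) = boundary_act h (Some (m * t))) &
    (forall t, boundary_act q^-1%g (boundary_act h (Some t)) = boundary_act h (Some (m^-1 * t)))].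
  case: (ltgtP l 1) l1 => // l1 _.
    exists p^-1%g, l^-1; split; [by right| | by [] |by rewrite invgK invrK].
    by rewrite invf_gt1.
  by exists p, l; split=> //; left.
have m0 : 0 < m by lra.
have iterq k t : boundary_act (q ^+ k)%g (boundary_act h (Some t)) = boundary_act h (Some (m ^+ k * t)).
  rewrite boundary_iter; elim: k => [|k IHk]; first by rewrite mul1r.
  by rewrite iterS IHk hm exprS mulrA.
have iterqV k t : boundary_act (q^-1 ^+ k)%g (boundary_act h (Some t)) = boundary_act h (Some (m ^- k * t)).
  rewrite boundary_iter; elim: k => [|k IHk]; first by rewrite expr0 invr1 mul1r.
  by rewrite iterS IHk hmV -!exprVn exprS mulrA.
have side z : positively_oriented a z b -> exists2 t, z = boundary_act h (Some t) & t < 0.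
  rewrite -ha -hb -{1}(boundaryVK h z) oriented_act.
  case E: (boundary_act h^-1%g z) => [t|]; last by rewrite /positively_oriented /= ?andbF.
  rewrite /positively_oriented /= ?andbF ?andbT ?orbF /= => t0.
  by exists t => //; rewrite -[LHS](boundaryVK h) E.
have [t xt t0] := side x axb; have [u yu u0] := side y ayb.
have [k1 hk1] := expr_unbounded (u / t) m1; have [k2 hk2] := expr_unbounded (t / u) m1.
pose k := maxn k1 k2; exists q, k.
have mk1 : u / t < m ^+ k by apply: lt_le_trans hk1 _; rewrite ler_weXn2l ?leq_maxl // ltW.
have mk2 : t / u < m ^+ k by apply: lt_le_trans hk2 _; rewrite ler_weXn2l ?leq_maxr // ltW.
rewrite ltr_ndivrMr // in mk1; rewrite ltr_ndivrMr // in mk2.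
rewrite xt yu iterq iterqV -ha -hb !oriented_act /positively_oriented /=; split=> //.
  by rewrite mk1 ?andbT ?orbT.
have mk0 : 0 < m ^+ k by rewrite exprn_gt0.
apply/orP; left; apply/andP; split.
  by rewrite mulrC ltr_pdivlMr // mulrC.
by rewrite pmulr_rlt0 // invr_gt0.
Qed.

(** They are the roots of a quadratic equation whose discriminant is the
    square of the trace minus 4; infinity is one of them when [A 1 0]
    vanishes. *)
Lemma hyperbolic_fixed_points p : hyperbolic p -> exists a b,
  [/\ a != b, boundary_act p a = a & boundary_act p b = b].
Proof.
rewrite /hyperbolic /boundary_act; set A := repr p => hp.
have dA := SL2_det A; move: hp; rewrite /mxtrace !big_ord_recl big_ord0 addr0.
have -> : lift ord0 ord0 = 1 :> 'I_2 by apply: val_inj.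
rewrite /boundary_mx; set a := A 0 0 in dA *; set b := A 0 1 in dA *.
set c := A 1 0 in dA *; set d := A 1 1 in dA * => hp.
have disc : 0 < (a + d) ^+ 2 - 4.
  rewrite subr_gt0 -[(a + d) ^+ 2]real_normK ?num_real //.
  have : 0 < (`|a + d| - 2) * (`|a + d| + 2) by apply: mulr_gt0; lra.
  lra.
have [c0|c0] := eqVneq c 0.
  have ad : d - a != 0.
    apply/eqP => ad; have da : d = a by lra.
    by move: disc dA; rewrite c0 da mulr0 subr0 => disc dA; lra.
  have d0 : d != 0 by apply/eqP => d0; move: dA; rewrite c0 d0 !mulr0 subr0 => /eqP; rewrite eq_sym oner_eq0.
  exists None, (Some (b / (d - a))); split=> //.
  rewrite c0 mul0r add0r (negPf d0); congr Some; field.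
  by rewrite d0 ad.
pose r := Num.sqrt ((a + d) ^+ 2 - 4).
have rr : r ^+ 2 = (a + d) ^+ 2 - 4 by rewrite sqr_sqrtr // ltW.
have r0 : r != 0 by rewrite gt_eqF // sqrtr_gt0.
have fixp e : e ^+ 2 = r ^+ 2 ->
    let t := (a - d + e) / (2 * c) in
    (if c * t + d == 0 then None else Some ((a * t + b) / (c * t + d))) = Some t.
  move=> er t; have ctd : c * t + d = (a + d + e) / 2 by rewrite /t; field.
  have n0 : a + d + e != 0.
    apply/eqP => ade; have eE : e = - (a + d) by lra.
    by move: er; rewrite rr eE sqrrN => er; lra.
  have n1 : (a + d + e) / 2 != 0 by rewrite mulf_neq0 ?invr_eq0.
  rewrite ctd (negPf n1); congr Some.
  apply: (mulIf n1); rewrite divfK // /t; apply: (mulfI c0).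
  have bc : c * b = a * d - 1 by rewrite -dA; ring.
  rewrite mulrDr bc.
  have e2 : e ^+ 2 = (a + d) ^+ 2 - 4 by rewrite er rr.
  rewrite (_ : c * ((a - d + e) / (2 * c) * ((a + d + e) / 2)) = ((a - d + e) * (a + d + e)) / 4); last by field.
  rewrite (_ : (a - d + e) * (a + d + e) = a ^+ 2 - d ^+ 2 + 2 * a * e + e ^+ 2); last by ring.
  by rewrite e2; field.
exists (Some ((a - d + r) / (2 * c))), (Some ((a - d - r) / (2 * c))); split.
- apply/eqP => -[] /(mulIf _) h; have : a - d + r = a - d - r by apply: h; rewrite invr_eq0 mulf_neq0.
  by move=> h'; move/eqP: r0; apply; lra.
- exact: fixp.
- by apply: fixp; rewrite sqrrN.
Qed.

(** Half-lines and half-circles have the same equation in homogeneous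
    coordinates of their endpoints. *)
Lemma geodesicE x y (z : R[i]) : geodesic x y z ->
  0 < complex.Im z /\
  (hcoord x).1 * (hcoord y).1 - ((hcoord x).1 * (hcoord y).2 + (hcoord x).2 * (hcoord y).1) * complex.Re z
   + (hcoord x).2 * (hcoord y).2 * (complex.Re z ^+ 2 + complex.Im z ^+ 2) = 0.
Proof.
case: z => X Y; case: x y => [s|] [t|] //=; case; rewrite /H2 /= => Y0 h; split=> //; lra.
Qed.

Lemma hcoord_neq0 x : (hcoord x).1 = 0 -> (hcoord x).2 = 0 -> False.
Proof. by case: x => [t|] /= h1 h2; lra. Qed.

(** The equation of the geodesic is linear in its second endpoint, so it
    determines that endpoint up to scaling. *)
Lemma geodesic_endpoint a b d (z : R[i]) : geodesic a b z -> geodesic a d z -> b = d.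
Proof.
move=> /geodesicE[Y0 h1] /geodesicE[_ h2]; apply: bracket_eq0; apply/eqP/negPn/negP => br0.
move: h1 h2 br0; rewrite /bracket; set X := complex.Re z; set Y := complex.Im z.
have := @hcoord_neq0 a.
move: (hcoord a) (hcoord b) (hcoord d) => [a1 a2] [b1 b2] [d1 d2] /= na h1 h2 br0.
have e1 : (b1 * d2 - b2 * d1) * (a1 - a2 * X) = 0.
  transitivity (d2 * (a1 * b1 - (a1 * b2 + a2 * b1) * X + a2 * b2 * (X ^+ 2 + Y ^+ 2)) -
    b2 * (a1 * d1 - (a1 * d2 + a2 * d1) * X + a2 * d2 * (X ^+ 2 + Y ^+ 2))); first by ring.
  by rewrite h1 h2 !mulr0 subrr.
have e2 : (b1 * d2 - b2 * d1) * (a2 * (X ^+ 2 + Y ^+ 2) - a1 * X) = 0.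
  transitivity (b1 * (a1 * d1 - (a1 * d2 + a2 * d1) * X + a2 * d2 * (X ^+ 2 + Y ^+ 2)) -
    d1 * (a1 * b1 - (a1 * b2 + a2 * b1) * X + a2 * b2 * (X ^+ 2 + Y ^+ 2))); first by ring.
  by rewrite h1 h2 !mulr0 subrr.
move/eqP: e1; rewrite mulf_eq0 (negPf br0) subr_eq0 => /eqP a1E.
move/eqP: e2; rewrite mulf_eq0 (negPf br0) a1E /= => /eqP e2.
have : a2 * Y ^+ 2 = 0 by rewrite -e2; ring.
move/eqP; rewrite mulf_eq0 expf_eq0 /= (gt_eqF Y0) orbF => /eqP a20.
by apply: na; rewrite // a1E a20 mul0r.
Qed.

Lemma geodesicC a b : geodesic a b = geodesic b a :> set R[i].
Proof.
case: a b => [s|] [t|] //; apply/seteqP; split=> z [z0 /= h]; split=> //=.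
  by rewrite (addrC t) h -(opprB s) mulNr sqrrN.
by rewrite (addrC s) h -(opprB t) mulNr sqrrN.
Qed.

(** The point [z] is a common zero of the two quadratic equations of the
    geodesics, so their resultant is minus a square; the resultant is the
    product of the four brackets between the endpoints of the two geodesics,
    and its sign decides whether they are linked. *)
Lemma geodesic_linked a b c d (z : R[i]) : geodesic a b z -> geodesic c d z ->
  [\/ c = a /\ d = b, c = b /\ d = a,
      positively_oriented a c b /\ positively_oriented b d a |
      positively_oriented b c a /\ positively_oriented a d b].
Proof.
move=> gab gcd; have [Y0 hP] := geodesicE gab; have [_ hQ] := geodesicE gcd.
have res : bracket c a * bracket c b * (bracket d a * bracket d b) <= 0.
  move: hP hQ; rewrite /bracket; set X := complex.Re z; set Y := complex.Im z.
  move: (hcoord a) (hcoord b) (hcoord c) (hcoord d) => [a1 a2] [b1 b2] [c1 c2] [d1 d2] /= hP hQ.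
  pose P1 := a1 * b1; pose P2 := a1 * b2 + a2 * b1; pose P3 := a2 * b2.
  pose Q1 := c1 * d1; pose Q2 := c1 * d2 + c2 * d1; pose Q3 := c2 * d2.
  have P1E : P1 = P2 * X - P3 * (X ^+ 2 + Y ^+ 2) by rewrite /P1 /P2 /P3; lra.
  have Q1E : Q1 = Q2 * X - Q3 * (X ^+ 2 + Y ^+ 2) by rewrite /Q1 /Q2 /Q3; lra.
  rewrite (_ : _ * _ = (P1 * Q3 - P3 * Q1) ^+ 2 - (P1 * Q2 - P2 * Q1) * (P2 * Q3 - P3 * Q2)); last first.
    by rewrite /P1 /P2 /P3 /Q1 /Q2 /Q3; ring.
  rewrite P1E Q1E (_ : _ - _ = - ((P2 * Q3 - P3 * Q2) * Y) ^+ 2); last by ring.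
  by rewrite oppr_le0 sqr_ge0.
have [ca|nca] := eqVneq (bracket c a) 0.
  have E := bracket_eq0 ca; rewrite E in gcd *; apply: Or41; split=> //.
  by rewrite (geodesic_endpoint gab gcd).
have [cb|ncb] := eqVneq (bracket c b) 0.
  have E := bracket_eq0 cb; rewrite E in gcd *; apply: Or42; split=> //.
  by rewrite geodesicC in gab; rewrite (geodesic_endpoint gab gcd).
have [da|nda] := eqVneq (bracket d a) 0.
  have E := bracket_eq0 da; rewrite E in gcd *; apply: Or42; split=> //.
  by rewrite geodesicC in gcd; rewrite (geodesic_endpoint gab gcd).
have [db|ndb] := eqVneq (bracket d b) 0.
  have E := bracket_eq0 db; rewrite E in gcd *; apply: Or41; split=> //.
  by rewrite geodesicC in gab; rewrite geodesicC in gcd; rewrite (geodesic_endpoint gab gcd).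
have [ab|nab] := eqVneq (bracket a b) 0.
  have E := bracket_eq0 ab; rewrite E in gab.
  exfalso; have [_] := geodesicE gab; have := @hcoord_neq0 b; move: (hcoord b) => [b1 b2] /= nb h.
  have h2 : (b1 - b2 * complex.Re z) ^+ 2 + (b2 * complex.Im z) ^+ 2 = 0 by rewrite -h; ring.
  move/eqP: h2; rewrite paddr_eq0 ?sqr_ge0 // !expf_eq0 /= mulf_eq0 (gt_eqF Y0) orbF subr_eq0.
  by case/andP => /eqP h2 /eqP b20; apply: nb => //; rewrite h2 b20 mul0r.
rewrite !orientedE.
have lt0 : (bracket a c * bracket c b * bracket b a) * (bracket b d * bracket d a * bracket a b) > 0.
  rewrite (bracketC a c) (bracketC b d) (bracketC b a).
  rewrite (_ : _ * _ = - (bracket c a * bracket c b * (bracket d a * bracket d b)) * bracket a b ^+ 2); last by ring.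
  apply: mulr_gt0; last by rewrite exprn_even_gt0.
  by rewrite oppr_gt0 lt_neqAle res !mulf_neq0.
have E1 : bracket b c * bracket c a * bracket a b = - (bracket a c * bracket c b * bracket b a).
  by rewrite (bracketC b c) (bracketC c a) (bracketC a b); ring.
have E2 : bracket a d * bracket d b * bracket b a = - (bracket b d * bracket d a * bracket a b).
  by rewrite (bracketC a d) (bracketC d b) (bracketC b a); ring.
rewrite E1 E2 !oppr_gt0.
move: lt0; case: (ltgtP 0 (bracket a c * bracket c b * bracket b a)) => [h|h|<-].
- by rewrite pmulr_rgt0 // => h'; apply: Or43.
- by rewrite nmulr_rgt0 // => h'; apply: Or44.
- by rewrite mul0r ltxx.
Qed.

End Boundary.

(** * Cyclic order on the boundary *)

Section CyclicOrder.
Variable R : realType.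
Implicit Types (x y z a b c d : option R).

Lemma oriented_neq x y z : positively_oriented x y z -> [/\ x != y, y != z & x != z].
Proof.
rewrite orientedE => h; split; apply: contraPneq h => ->; apply/negP; rewrite -leNgt /bracket.
- by rewrite (_ : _ * _ = 0) //; ring.
- by rewrite (_ : _ * _ = 0) //; ring.
- by rewrite (_ : _ * _ = 0) //; ring.
Qed.

(** Once [y] is at infinity, the cyclic order of triples through [y] is the
    order of the real line. *)
Lemma oriented_send y : exists p : PSL2 R, boundary_act p y = None.
Proof.
case: y => [t|]; last by exists 1%g; rewrite boundary_one.
have [h [hN _]] := @boundary_transitive R (Some t) None isT.
by exists h^-1%g; rewrite -hN boundaryK.
Qed.

Lemma oriented_None x y : positively_oriented x y None ->
  exists s t, [/\ x = Some s, y = Some t & s < t].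
Proof.
by case: x y => [s|] [t|]; rewrite /positively_oriented /= ?andbF ?andbT ?orbF // => st; exists s, t.
Qed.

Lemma oriented_NoneE (s t : R) : positively_oriented (Some s) (Some t) None = (s < t).
Proof. by rewrite /positively_oriented /= ?andbF ?andbT ?orbF. Qed.

Lemma oriented_trans a x y b :
  positively_oriented a x y -> positively_oriented a y b -> positively_oriented x y b.
Proof.
have [p py] := oriented_send y.
rewrite -(oriented_act p a x y) -(oriented_act p a y b) -(oriented_act p x y b) py.
move=> /oriented_None[s [t [-> -> st]]]; rewrite -oriented_rot => /oriented_None[r [_ [-> [<-] rs]]].
by rewrite -oriented_rot oriented_NoneE; exact: lt_trans st.
Qed.

Lemma oriented_trans' a x y b :
  positively_oriented a x y -> positively_oriented a y b -> positively_oriented a x b.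
Proof.
have [p py] := oriented_send a.
rewrite -(oriented_act p a x y) -(oriented_act p a y b) -(oriented_act p a x b) py oriented_rot.
move=> /oriented_None[s [t [-> -> st]]]; rewrite oriented_rot => /oriented_None[_ [r [[<-] -> tr]]].
by rewrite oriented_rot oriented_NoneE; exact: lt_trans tr.
Qed.

Lemma oriented_total a x y b : positively_oriented a x b -> positively_oriented a y b ->
  [\/ x = y, positively_oriented x y b | positively_oriented y x b].
Proof.
have [p pb] := oriented_send b.
rewrite -(oriented_act p a x b) -(oriented_act p a y b).
rewrite -(oriented_act p x y b) -(oriented_act p y x b) pb.
move=> /oriented_None[r [s [_ xs rs]]] /oriented_None[r' [t [_ yt rt]]].
rewrite xs yt !oriented_NoneE; case: (ltgtP s t) => [st|ts|st].
- exact: Or32.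
- exact: Or33.
- by apply: Or31; rewrite -(boundaryK p x) xs st -yt boundaryK.
Qed.

(** The points [a], [c], [b], [d] are in this cyclic order: [c] and [d] lie on
    different sides of the geodesic from [a] to [b]. *)
Definition linked a c b d : Prop := positively_oriented a c b /\ positively_oriented b d a.

Lemma linked_rot a c b d : linked a c b d -> linked c b d a.
Proof.
case=> acb bda; split.
  apply: (@oriented_trans a); first exact: acb.
  by rewrite oriented_rot.
rewrite oriented_rot; apply: (@oriented_trans' _ _ b) => //.
by rewrite oriented_rot.
Qed.

End CyclicOrder.

(** * Discrete groups of homotheties *)

Section DiscreteHomotheties.
Local Open Scope quotient_scope.
Variable R : realType.
Implicit Types (a b : option R) (p q h : PSL2 R) (alpha beta : R).

(** By the gap, two elements larger than 1 in the same interval between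
    consecutive powers of [1 + delta] are equal, so there is a least element
    larger than 1; Euclidean division by it does the rest. *)
Lemma gap_cyclic (L : R -> Prop) (delta : R) : 0 < delta ->
  (forall x, L x -> 0 < x) -> (forall x y, L x -> L y -> L (x / y)) ->
  (forall x, L x -> 1 <= x -> x < 1 + delta -> x = 1) ->
  (exists2 x, L x & 1 < x) ->
  exists2 x0, L x0 /\ 1 < x0 & forall x, L x -> 1 <= x -> exists k, x = x0 ^+ k.
Proof.
move=> d0 Lpos Ldiv gap [x1 Lx1 x1gt].
have d1 : 1 < 1 + delta by rewrite ltrDl.
(* The least element is looked for in the first of the intervals that contains
   an element larger than 1. *)
pose Q k := exists x, [/\ L x, 1 < x & x < (1 + delta) ^+ k].
have exQ : exists k, `[< Q k >].
  by have [k hk] := expr_unbounded x1 d1; exists k; apply/asboolP; exists x1.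
case: (ex_minnP exQ) => k /asboolP [x0 [Lx0 x0gt x0lt]] kmin.
have k0 : (0 < k)%N.
  by rewrite lt0n; apply/eqP => k0; move: x0lt; rewrite k0 expr0 ltNge ltW.
have x0min x : L x -> 1 < x -> x0 <= x.
  move=> Lx x1'; rewrite leNgt; apply/negP => xx0.
  have xp : 0 < x by exact: Lpos.
  have lex : (1 + delta) ^+ k.-1 <= x.
    rewrite leNgt; apply/negP => xlt.
    have := kmin k.-1; rewrite leqNgt ltn_predL k0 => H.
    by apply/negP: isT; rewrite -[X in ~~ X]negbK; apply: H; apply/asboolP; exists x.
  have q1 : x0 / x = 1.
    apply: gap; first exact: Ldiv.
      by rewrite ler_pdivlMr // mul1r ltW.
    rewrite ltr_pdivrMr //; apply: lt_le_trans x0lt _.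
    by rewrite -[k in leLHS]prednK // exprS ler_pM2l // (lt_trans ltr01).
  have xn0 : x != 0 by rewrite gt_eqF.
  by move: xx0; rewrite -[x0](divfK xn0) q1 mul1r ltxx.
exists x0 => // x Lx x1'.
have x0p : 0 < x0 by exact: Lpos.
have L1 : L 1 by rewrite -(@divff _ x0) ?gt_eqF //; exact: Ldiv.
have LX m : L (x0 ^+ m).
  elim: m => [|m IHm]; first by rewrite expr0.
  have -> : x0 ^+ m.+1 = x0 ^+ m / x0^-1 by rewrite invrK exprSr.
  apply: (Ldiv) => //.
  by rewrite -[x0^-1]mul1r; apply: Ldiv.
have exm : exists m, x < x0 ^+ m by exact: expr_unbounded.
case: (ex_minnP exm) => m xm mmin.
have m0 : (0 < m)%N by rewrite lt0n; apply/eqP => m0; move: xm; rewrite m0 expr0 ltNge x1'.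
exists m.-1; have le1 : x0 ^+ m.-1 <= x.
  by rewrite leNgt; apply/negP => /mmin; rewrite leqNgt ltn_predL m0.
have p0 : 0 < x0 ^+ m.-1 by rewrite exprn_gt0.
have Lq : L (x / x0 ^+ m.-1) by apply: Ldiv.
have [q1|q1] := leP (x / x0 ^+ m.-1) 1.
  by apply/eqP; rewrite eq_le le1 andbT -[leRHS]mul1r -ler_pdivrMr.
have := x0min _ Lq q1; rewrite ler_pdivlMr // -exprS prednK // leNgt xm.
by [].
Qed.

Definition diagmx alpha : 'M[R]_2 := \matrix_(i, j)
  if i == j then (if i == 0 then alpha else alpha^-1) else 0.

Lemma det_diagmx alpha : alpha != 0 -> \det (diagmx alpha) == 1.
Proof. by move=> a0; rewrite det_mx22 !mxE /= mulr0 subr0 divff. Qed.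

(** At 0 the diagonal matrix has determinant 0, and [insubd] returns the
    identity. *)
Definition homothety alpha : PSL2 R :=
  \pi_(PSL2 R) (insubd (SL2_one R) (diagmx alpha)).

Lemma homothetyE alpha : alpha != 0 ->
  exists2 A : SL2 R, homothety alpha = \pi_(PSL2 R) A & A = diagmx alpha :> 'M[R]_2.
Proof.
move=> a0; exists (insubd (SL2_one R) (diagmx alpha)) => //.
by rewrite -[LHS]/(val _) val_insubd det_diagmx.
Qed.

Lemma ord2P (P : 'I_2 -> Prop) : P 0 -> P 1 -> forall i, P i.
Proof.
move=> P0 P1 [[|[|//]] hi].
  by have -> : Ordinal hi = 0 by apply: val_inj.
by have -> : Ordinal hi = 1 by apply: val_inj.
Qed.

Lemma diagmxM alpha beta : diagmx (alpha * beta) = diagmx alpha *m diagmx beta.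
Proof.
apply/matrixP; apply: ord2P; apply: ord2P; rewrite !mxE !big_ord_recl big_ord0 !mxE /=;
  by rewrite ?mulr0 ?mul0r ?addr0 ?add0r ?invfM.
Qed.

Lemma homothetyM alpha beta : alpha != 0 -> beta != 0 ->
  homothety (alpha * beta) = (homothety alpha * homothety beta)%g.
Proof.
move=> a0 b0; have [A -> AE] := homothetyE a0; have [B -> BE] := homothetyE b0.
have [C -> CE] := homothetyE (mulf_neq0 a0 b0).
rewrite -[RHS]/(PSL2_mul _ _) Defs.pi_mul; congr (\pi_(PSL2 R) _); apply: val_inj.
by rewrite /= CE AE BE diagmxM.
Qed.

Lemma homothety1 : homothety 1 = 1%g.
Proof.
apply: (mulgI (homothety 1)); rewrite -homothetyM ?oner_neq0 // !mulr1.
by rewrite mulg1.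
Qed.

Lemma fixed_homothety q : boundary_act q None = None -> boundary_act q (Some 0) = Some 0 ->
  exists2 alpha, 0 < alpha & q = homothety alpha.
Proof.
rewrite -[q]reprK; move: (repr q) => A; rewrite !pi_boundary /=.
case: eqP => // c0 _; have dA := SL2_det A; rewrite c0 mulr0 subr0 in dA.
have a0 : A 0 0 != 0 by apply/eqP => a0; move: dA; rewrite a0 mul0r => /eqP; rewrite eq_sym oner_eq0.
have d0 : A 1 1 != 0 by apply/eqP => d0; move: dA; rewrite d0 mulr0 => /eqP; rewrite eq_sym oner_eq0.
have dE : A 1 1 = (A 0 0)^-1 by apply: (mulfI a0); rewrite dA divff.
rewrite c0 mul0r !mulr0 !add0r (negPf d0) => -[] /eqP.
rewrite mulf_eq0 invr_eq0 (negPf d0) orbF => /eqP b0.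
have AE : A = diagmx (A 0 0) :> 'M[R]_2.
  by apply/matrixP; apply: ord2P; apply: ord2P; rewrite !mxE.
exists `|A 0 0|; first by rewrite normr_gt0.
have n0 : `|A 0 0| != 0 by rewrite normr_eq0.
have [B -> BE] := homothetyE n0; apply/PSL2_eqP; rewrite /pm_eq AE BE.
case: (ger0P (A 0 0)) => _; first by rewrite eqxx.
apply/orP; right; apply/eqP/matrixP; apply: ord2P; apply: ord2P; rewrite !mxE /= ?oppr0 ?opprK //.
by rewrite invrN opprK.
Qed.

(** Conjugation by [h] multiplies the distance from [diagmx alpha] to 1 by at
    most a constant [K]. *)
Lemma homothety_gap h (eps : R) : 0 < eps -> exists2 delta, 0 < delta &
  forall alpha, 1 <= alpha -> alpha < 1 + delta -> exists A : SL2 R,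
  [/\ (h * homothety alpha * h^-1)%g = \pi_(PSL2 R) A,
      `|(A : 'M[R]_2) - 1%:M| < eps & A = 1%:M :> 'M[R]_2 -> alpha = 1].
Proof.
move=> e0; rewrite -[h]reprK; move: (repr h) => H.
pose G : 'M[R]_2 := invmx H.
pose K := 1 + \sum_(i < 2) \sum_(j < 2) \sum_(k < 2) `|H i k * G k j|.
have K0 : 0 < K.
  by rewrite ltr_pwDl // !sumr_ge0 // => i _; rewrite sumr_ge0 // => j _; rewrite sumr_ge0.
exists (eps / K); first exact: divr_gt0.
move=> alpha a1 aK; have a0 : 0 < alpha by apply: lt_le_trans a1.
have an0 : alpha != 0 by rewrite gt_eqF.
have [D -> DE] := homothetyE an0.
exists (SL2_mul (SL2_mul H D) (SL2_inv H)).
have uH : (H : 'M[R]_2) \in unitmx by exact: SL2_unit.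
have AE : (SL2_mul (SL2_mul H D) (SL2_inv H) : 'M[R]_2) = H *m diagmx alpha *m G.
  by rewrite /= DE.
split.
- rewrite -[LHS]/(PSL2_mul (PSL2_mul _ _) (PSL2_inv _)).
  by rewrite Defs.pi_inv (Defs.pi_mul H D) (Defs.pi_mul _ (SL2_inv H)).
- rewrite AE; have -> : H *m diagmx alpha *m G - 1%:M = H *m (diagmx alpha - 1%:M) *m G.
    by rewrite mulmxBr mulmx1 mulmxBl mulmxV.
  set M := _ *m G; rewrite -[X in X < _]/(mx_norm M).
  have [->//|M0] := eqVneq (mx_norm M) 0.
  have [[i j] ->] := mx_norm_neq0 M0; rewrite /=.
  have MijE : M i j = \sum_k H i k * G k j * (diagmx alpha - 1%:M) k k.
    rewrite /M !mxE; apply: eq_bigr => k _; rewrite !mxE (bigD1 k) //= big1 ?addr0 ?eqxx.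
      by rewrite !mxE eqxx; ring.
    by move=> l lk; rewrite !mxE (negPf lk) subrr mulr0.
  have bd k : `|(diagmx alpha - 1%:M) k k| <= alpha - 1.
    rewrite !mxE eqxx /=; case: eqP => _; first by rewrite ger0_norm ?subr_ge0.
    have aV1 : alpha^-1 <= 1 by rewrite invf_le1.
    rewrite ler0_norm ?subr_le0 // opprB -subr_ge0.
    have -> : alpha - 1 - (1 - alpha^-1) = (alpha - 1) ^+ 2 / alpha by field.
    by rewrite divr_ge0 ?sqr_ge0 // ltW.
  have le1 : `|M i j| <= K * (alpha - 1).
    rewrite MijE; apply: le_trans (ler_norm_sum _ _ _) _.
    apply: (@le_trans _ _ (\sum_k `|H i k * G k j| * (alpha - 1))).
      by apply: ler_sum => k _; rewrite normrM ler_wpM2l.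
    rewrite -mulr_suml ler_wpM2r ?subr_ge0 // /K.
    apply: (@le_trans _ _ (\sum_(j' < 2) \sum_k `|H i k * G k j'|)).
      by rewrite [leRHS](bigD1 j) //= lerDl sumr_ge0 // => j' _; rewrite sumr_ge0.
    rewrite [X in _ <= 1 + X](bigD1 i) //= addrCA lerDl addr_ge0 // sumr_ge0 // => i' _.
    by rewrite sumr_ge0 // => j' _; rewrite sumr_ge0.
  apply: le_lt_trans le1 _; rewrite mulrC -ltr_pdivlMr //; lra.
- rewrite AE => A1.
  have D1 : diagmx alpha = 1%:M.
    have := congr1 (fun Z => invmx H *m Z *m H) A1.
    by rewrite mulmx1 mulVmx // -!mulmxA mulVmx // mulmx1 mulKmx.
  by have := congr1 (fun Z : 'M[R]_2 => Z 0 0) D1; rewrite !mxE.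
Qed.

End DiscreteHomotheties.

(** * Maximal framings *)

Section Framing.
Variables (R : realType) (Gamma : groupType) (iota : {multiplicative Gamma -> PSL2 R}).
Variables (F : rcfType) (v : F -> \bar R).
Hypothesis hv : order_compatible_valuation v.
Variables (V : vectType F) (omega : {skew_symmetric V}).
Hypothesis homega : nondegenerate omega.
Variable rho : Gamma -> 'End(V).
Hypothesis hrho : symplectic_representation omega rho.
Variables (S : set (option R)) (phi : option R -> {vspace V}).
Hypothesis hphi : maximal_framing omega iota rho S phi.
Local Notation n := (half_dim V).
Implicit Types (e f : 'I_n -> V) (a b c d x y z : option R) (g s : Gamma).
Implicit Types (A B C M N T : 'M[F]_n) (u w : V).

Definition bact g x := boundary_act (iota g) x.

Lemma iota1 : iota 1%g = 1%g.
Proof. by apply: (mulgI (iota 1%g)); rewrite -gmulfM !mulg1. Qed.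

Lemma iotaV g : iota g^-1%g = (iota g)^-1%g.
Proof. by apply: (mulgI (iota g)); rewrite -gmulfM !mulgV iota1. Qed.

Lemma bactM g h x : bact (g * h)%g x = bact g (bact h x).
Proof. by rewrite /bact gmulfM boundary_mul. Qed.

Lemma bact1 x : bact 1%g x = x.
Proof. by rewrite /bact iota1 boundary_one. Qed.

Lemma bactV_fix g x : bact g x = x -> bact g^-1%g x = x.
Proof. by move=> gx; rewrite -{1}gx -bactM mulVg bact1. Qed.

Lemma iotaX g k : iota (g ^+ k)%g = (iota g ^+ k)%g.
Proof. by elim: k => [|k IHk]; rewrite ?expg0 ?iota1 // !expgS gmulfM IHk. Qed.

Lemma rho_omega g u w : omega (rho g u) (rho g w) = omega u w.
Proof. by case: hrho. Qed.

Lemma rhoM g h u : rho (g * h)%g u = rho g (rho h u).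
Proof. by case: hrho => _ ->; rewrite comp_lfunE. Qed.

Lemma rho1 u : rho 1%g u = u.
Proof.
apply: (can_inj (symplecticK homega (rho_omega 1%g))).
by rewrite -rhoM mulg1.
Qed.

Lemma rhoV g u : (rho g)^-1%VF u = rho g^-1%g u.
Proof.
apply: (can_inj (symplecticK homega (rho_omega g))).
by rewrite (symplecticVK homega (rho_omega g)) -rhoM mulgV rho1.
Qed.

Lemma S_act g x : S x -> S (bact g x).
Proof. by case: hphi => h _ _ _ _; apply: h. Qed.

Lemma phi_lagrangian x : S x -> lagrangian omega (phi x).
Proof. by case: hphi => _ _ h _ _; apply: h. Qed.

Lemma phi_act g x u : S x -> u \in phi x -> rho g u \in phi (bact g x).
Proof. by move=> Sx ux; case: hphi => _ _ _ h _; rewrite /bact h // memv_img. Qed.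

Lemma phi_maximal x y z : S x -> S y -> S z -> positively_oriented x y z ->
  maximal_triple omega (phi x) (phi y) (phi z).
Proof. by case: hphi => _ _ _ _ h; apply: h. Qed.

Lemma S_fixed g x : hyperbolic (iota g) -> bact g x = x -> S x.
Proof. by case: hphi => _ h _ _ _; apply: h. Qed.

Lemma phi_transverse x y z : S x -> S y -> S z -> positively_oriented x y z ->
  transverse (phi x) (phi y) /\ transverse (phi y) (phi x).
Proof.
move=> Sx Sy Sz /(phi_maximal Sx Sy Sz)[_ [[t _ _] _]].
by split; rewrite // /transverse capvC.
Qed.

(** The translates are taken by powers of [s], which stay in any subgroup [H]
    containing [s]; this is how integrality of [s] is passed on to them. *)
Lemma sandwich (H : Gamma -> Prop) s a b x y :
  H 1%g -> (forall g h, H g -> H h -> H (g * h)%g) -> (forall g, H g -> H g^-1%g) -> H s ->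
  hyperbolic (iota s) -> bact s a = a -> bact s b = b ->
  positively_oriented a x b -> positively_oriented a y b -> exists g h,
  [/\ H g, H h, positively_oriented a (bact g x) y & positively_oriented y (bact h x) b].
Proof.
move=> H1 HM HV Hs hs sa sb axb ayb; have [_ _ ab] := oriented_neq axb.
have HX g k : H g -> H (g ^+ k)%g.
  by move=> Hg; elim: k => [|k IHk]; rewrite ?expg0 // expgS; apply: HM.
have [q [k [hq h1 h2]]] := hyperbolic_sandwich hs ab sa sb axb ayb.
case: hq h1 h2 => ->; rewrite ?invgK -?iotaV -!iotaX => h1 h2.
  by exists (s ^+ k)%g, (s^-1 ^+ k)%g; split=> //; apply: HX => //; apply: HV.
by exists (s^-1 ^+ k)%g, (s ^+ k)%g; split=> //; apply: HX => //; apply: HV.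
Qed.

Definition integral_on e a b g : Prop :=
  [/\ bact g a = a, bact g b = b & exists2 A, integral_unitmx v A & acts_by (rho g) e A].

Section Axis.
Variables (e f : 'I_n -> V) (a c b : option R).
Hypotheses (Sa : S a) (Sb : S b) (Sc : S c) (acb : positively_oriented a c b).
Hypotheses (hef : darboux omega e f) (ea : forall i, e i \in phi a)
  (fb : forall i, f i \in phi b) (efc : forall i, e i + f i \in phi c).

Lemma integral_on1 : integral_on e a b 1%g.
Proof.
split; rewrite ?bact1 //; exists 1%:M; first exact: integral_unitmx1.
by move=> x; rewrite rho1 mulmx1.
Qed.

Lemma integral_onM g h : integral_on e a b g -> integral_on e a b h -> integral_on e a b (g * h)%g.
Proof.
move=> [ga gb [A uA hA]] [ha hb [B uB hB]]; split; rewrite ?bactM ?ha ?hb //.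
exists (B *m A); first exact: integral_unitmxM.
by move=> x; rewrite rhoM hB hA mulmxA.
Qed.

Lemma integral_onV g : integral_on e a b g -> integral_on e a b g^-1%g.
Proof.
move=> [ga gb [A uA hA]]; split; rewrite ?bactV_fix //.
exists (invmx A); first exact: integral_unitmxV.
by move=> x; rewrite -rhoV (acts_byV homega hef (rho_omega g) hA).
Qed.

Lemma fix_phi g x u : S x -> bact g x = x -> u \in phi x -> rho g u \in phi x.
Proof. by move=> Sx gx ux; rewrite -{1}gx phi_act. Qed.

Lemma rho_f g A : bact g b = b -> acts_by (rho g) e A -> acts_by (rho g) f (invmx A)^T.
Proof.
move=> gb hA; apply: (@acts_by_dual _ _ _ homega e f (phi b)) => //.
- exact: phi_lagrangian.
- by move=> u; apply: fix_phi.
- exact: rho_omega.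
Qed.

Lemma graph_act g A x M : bact g b = b -> acts_by (rho g) e A -> S x -> graph e f M (phi x) ->
  graph e f (invmx A *m M *m (invmx A)^T) (phi (bact g x)).
Proof.
move=> gb hA Sx gM y; have uA := acts_by_unit homega hef (rho_omega g) hA.
have := phi_act g Sx (gM (y *m invmx A)); rewrite linearD /= hA (rho_f gb hA).
by rewrite mulmxKV // !mulmxA.
Qed.

Lemma graph_a : graph e f 0 (phi a).
Proof. by move=> x; rewrite mulmx0 linear0 addr0 mem_cmb. Qed.

Lemma graph_c : graph e f 1%:M (phi c).
Proof.
move=> x; rewrite mulmx1 -big_split; apply: memv_suml => i _ /=.
by rewrite -scalerDr memvZ.
Qed.

Lemma graph_exists x : S x -> transverse (phi x) (phi b) ->
  exists M, M^T = M /\ graph e f M (phi x).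
Proof.
move=> Sx t; apply: (transverse_graph homega hef _ _ t) => //; exact: phi_lagrangian.
Qed.

(** By maximal_posdef the positivity of the triple at [x, y, b] is that of the
    difference: [phi] is an increasing curve in the chart away from [phi b]. *)
Lemma graph_mono x y M N : S x -> S y -> positively_oriented x y b ->
  M^T = M -> N^T = N -> graph e f M (phi x) -> graph e f N (phi y) -> posdef (N - M).
Proof.
move=> Sx Sy xyb symM symN gM gN.
exact: (maximal_posdef hef (phi_maximal Sx Sy Sb xyb)).
Qed.

Lemma graph_inj x M N : S x -> transverse (phi x) (phi b) ->
  graph e f M (phi x) -> graph e f N (phi x) -> M = N.
Proof.
move=> Sx t gM gN; apply/row_matrixP => i; rewrite !rowE.
exact: (graph_uniq hef t fb gN (gM _)).
Qed.

(** The translate of [phi c] by [s] is the graph of the Gram matrix of [B],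
    the inverse of [A]. If [s] moves [c] towards [b] this Gram matrix is at
    least 1 and [A] is integral; otherwise it is at most 1 and [B] is
    integral. The other one follows since the determinant is a unit. *)
Lemma zero_length_integral s : hyperbolic (iota s) -> bact s a = a -> bact s b = b ->
  translation_length v omega (rho s) = 0%E -> integral_on e a b s.
Proof.
move=> hs sa sb L0; split=> //.
have [A hA] : exists A, acts_by (rho s) e A.
  apply: (acts_by_exists homega hef (phi_lagrangian Sa) ea) => u; exact: fix_phi.
have dA := acts_by_det hv homega hef (rho_omega s) hA L0.
have uA := acts_by_unit homega hef (rho_omega s) hA.
exists A => //; set B := invmx A.
have uB : B \in unitmx by rewrite unitmx_inv.
have dB : v (\det B) = 0%E.
  by rewrite det_inv valV // ?dA ?oppe0 // -unitfE -unitmxE.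
have symB : (B *m B^T)^T = B *m B^T by rewrite trmx_mul trmxK.
have gB : graph e f (B *m B^T) (phi (bact s c)).
  by have := graph_act sb hA Sc graph_c; rewrite mulmx1.
have asb : positively_oriented a (bact s c) b by rewrite -sa -sb oriented_act.
suff [hint|hint] : integralmx v A \/ integralmx v B.
- by split=> //; apply: integralmx_inv.
- by rewrite -(invmxK A); apply: integral_unitmxV; split=> //; apply: integralmx_inv.
case: (oriented_total acb asb) => [cs|csb|scb].
- right; apply: (integral_gram_le1 hv).
  have [_ t] := phi_transverse Sb Sa Sc (etrans (oriented_rot b a c) acb).
  have [t' _] := phi_transverse Sc Sb Sa (etrans (esym (oriented_rot a c b)) acb).
  rewrite (graph_inj Sc t' graph_c (_ : graph e f (B *m B^T) (phi c))) //.
  by rewrite {1}cs.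
- left; have := graph_mono Sc (S_act s Sc) csb (trmx1 _ _) symB graph_c gB => pos.
  rewrite -(invmxK A) -/B -[invmx B]mulmx1; apply: integral_gram_le => // x.
  by rewrite trmx1 mulmx1 -subr_ge0 -qformB; exact: posdef_ge0.
- right; have := graph_mono (S_act s Sc) Sc scb symB (trmx1 _ _) gB graph_c => pos.
  apply: (integral_gram_le1 hv) => x.
  by rewrite -subr_ge0 -qformB; exact: posdef_ge0.
Qed.

End Axis.
(** * Barycenters of maximal triples *)

(** The image in the building of the center of a maximal triple in the Siegel
    space. It is a relation because the adapted basis is determined only up to
    an orthogonal matrix; such a matrix is integral and does not change the
    norm. *)
Definition barycenter x y z (eta : V -> \bar R) : Prop := exists e f,
  [/\ darboux omega e f, (forall i, e i \in phi x), (forall i, f i \in phi z),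
      (forall i, e i + f i \in phi y) & eta = norm_of v omega e f (fun=> 0)].

Lemma barycenter_exists x y z : S x -> S y -> S z -> positively_oriented x y z ->
  exists eta, barycenter x y z eta.
Proof.
move=> Sx Sy Sz xyz; have [e [f [h1 h2 h3 h4]]] := adapted_basis homega (phi_maximal Sx Sy Sz xyz).
by exists (norm_of v omega e f (fun=> 0)), e, f.
Qed.

Lemma barycenter_building x y z eta : barycenter x y z eta -> building v omega eta.
Proof. by case=> e [f [hef _ _ _ ->]]; apply: building_norm_of. Qed.

Section ZeroLength.
Variables (s : Gamma) (a b : option R).
Hypotheses (Sa : S a) (Sb : S b) (hs : hyperbolic (iota s)) (sa : bact s a = a)
  (sb : bact s b = b) (L0 : translation_length v omega (rho s) = 0%E).

(** In the adapted basis [s] acts by an integral matrix and its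
    contragredient. *)
Lemma barycenter_fixed c eta : S c -> positively_oriented a c b -> barycenter a c b eta ->
  building_act (rho s) eta = eta.
Proof.
move=> Sc acb [e [f [hef ea fb efc ->]]].
have [_ _ [A [uA hA hA'] actA]] := zero_length_integral Sa Sb Sc acb hef ea fb efc hs sa sb L0.
have actf := rho_f Sb hef fb sb actA.
have ge i : rho s (e i) = fam e f A 0 i.
  by rewrite -(cmb_delta e i) actA -rowE /fam row0 linear0 addr0.
have gf i : rho s (f i) = fam e f 0 (invmx A)^T i.
  by rewrite -(cmb_delta f i) actf -rowE /fam row0 linear0 add0r.
rewrite (norm_of_act _ homega (rho_omega s)).
have -> : (fun i => rho s (e i)) = fam e f A 0 by apply/funext.
have -> : (fun i => rho s (f i)) = fam e f 0 (invmx A)^T by apply/funext.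
have int0 : integralmx v (0 : 'M[F]_n) by move=> i j; rewrite mxE; exact: integral0.
apply: (norm_of_fam hv homega hef) => //; last exact: integralmx_tr.
apply: (darboux_fam hef) => //; rewrite ?trmx0 ?mulmx0 ?mul0mx //.
by rewrite subr0 trmxK mulmxV.
Qed.

(** The graph of [phi y] lies between those of two translates of [phi x] by
    powers of [s], which are Gram matrices of integral invertible matrices.
    Its own Cholesky factor, by which the adapted basis is changed, is then
    integral and invertible too. *)
Lemma barycenter_move x y eta : S x -> S y ->
  positively_oriented a x b -> positively_oriented a y b ->
  barycenter a x b eta -> barycenter a y b eta.
Proof.
move=> Sx Sy axb ayb [e [f [hef ea fb efx ->]]].
have ints := zero_length_integral Sa Sb Sx axb hef ea fb efx hs sa sb L0.
have [g [h [[ga gb [A hA actA]] [ha hb [B hB actB]] agy yhb]]] :=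
  sandwich (integral_on1 e a b) (@integral_onM e a b) (integral_onV hef) ints hs sa sb axb ayb.
have [_ ty] := phi_transverse Sb Sa Sy (etrans (oriented_rot b a y) ayb).
have [ty' _] := phi_transverse Sy Sb Sa (etrans (esym (oriented_rot a y b)) ayb).
have [M [symM gM]] := graph_exists Sb hef fb Sy ty'.
have g1 := graph_c efx.
have ggx := graph_act Sb hef fb gb actA Sx g1; rewrite mulmx1 in ggx.
have ghx := graph_act Sb hef fb hb actB Sx g1; rewrite mulmx1 in ghx.
have symG (C : 'M[F]_n) : (C *m C^T)^T = C *m C^T by rewrite trmx_mul trmxK.
have gyb : positively_oriented (bact g x) y b by apply: oriented_trans agy ayb.
have p1 := graph_mono Sb hef fb (S_act g Sx) Sy gyb (symG _) symM ggx gM.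
have p2 := graph_mono Sb hef fb Sy (S_act h Sx) yhb symM (symG _) gM ghx.
have p0 : posdef M.
  by have := graph_mono Sb hef fb Sa Sy ayb (trmx0 _ _ _) symM (graph_a f ea) gM; rewrite subr0.
have [C uC MC] := cholesky symM p0.
have [_ iC iC'] : integral_unitmx v C.
  apply: (integral_sandwich hv uC (integral_unitmxV hA) (integral_unitmxV hB)) => z;
    by rewrite -subr_ge0 -qformB -MC; apply: posdef_ge0.
have int0 : integralmx v (0 : 'M[F]_n) by move=> i j; rewrite mxE; exact: integral0.
have hd : darboux omega (fam e f (invmx C) 0) (fam e f 0 C^T).
  apply: (darboux_fam hef) => //; rewrite ?trmx0 ?mulmx0 ?mul0mx //.
  by rewrite subr0 trmxK mulVmx.
exists (fam e f (invmx C) 0), (fam e f 0 C^T); split=> //.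
- by move=> i; rewrite /fam row0 linear0 addr0 mem_cmb.
- by move=> i; rewrite /fam row0 linear0 add0r mem_cmb.
- move=> i; rewrite /fam !row0 !linear0 addr0 add0r.
  suff -> : row i C^T = row i (invmx C) *m M by exact: gM.
  by rewrite -row_mul MC mulmxA mulVmx // mul1mx.
- by rewrite (norm_of_fam hv homega hef) //; exact: integralmx_tr.
Qed.

End ZeroLength.

(** * Crossing axes *)

Section Crossing.
Variables (s1 s2 : Gamma) (a c b d : option R).
Hypotheses (hs1 : hyperbolic (iota s1)) (hs2 : hyperbolic (iota s2)).
Hypotheses (s1a : bact s1 a = a) (s1b : bact s1 b = b) (s2c : bact s2 c = c) (s2d : bact s2 d = d).
Hypotheses (L1 : translation_length v omega (rho s1) = 0%E)
  (L2 : translation_length v omega (rho s2) = 0%E).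
Hypothesis acbd : linked a c b d.

Section Basis.
Variables (e f : 'I_n -> V) (T : 'M[F]_n).
Hypotheses (hef : darboux omega e f) (ea : forall i, e i \in phi a)
  (fb : forall i, f i \in phi b) (efc : forall i, e i + f i \in phi c).
Hypotheses (symT : T^T = T) (gT : graph e f (- T) (phi d)).

Let Sa : S a := S_fixed hs1 s1a.
Let Sb : S b := S_fixed hs1 s1b.
Let Sc : S c := S_fixed hs2 s2c.
Let Sd : S d := S_fixed hs2 s2d.
Let acb : positively_oriented a c b := acbd.1.
Let bda : positively_oriented b d a := acbd.2.

Lemma crossing_posdef : posdef T.
Proof.
have dab : positively_oriented d a b by rewrite -oriented_rot.
have := graph_mono Sb hef fb Sd Sa dab (_ : (- T)^T = - T) (trmx0 _ _ _) gT (graph_a f ea).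
by rewrite sub0r opprK; apply; rewrite linearN /= symT.
Qed.

(** The form of the triple [phi c, phi b, phi d] is [1 + T] in the basis
    [e i + f i] of [phi c], so an orthonormal basis for [1 + T] gives an
    adapted basis. *)
Lemma crossing_basis (P : 'M[F]_n) (e' := fam e f P P) (f' := fam e f (- P) (P *m T)) :
  P *m (1%:M + T) *m P^T = 1%:M ->
  [/\ darboux omega e' f', (forall i, e' i \in phi c), (forall i, f' i \in phi d) &
      (forall i, e' i + f' i \in phi b)].
Proof.
move=> hP; split.
- apply: (darboux_fam hef) => //.
    by rewrite linearN /= trmx_mul symT mulNmx mulmxN mulmxA.
  rewrite trmx_mul symT linearN /= mulmxN opprK mulmxA -hP.
  by rewrite mulmxDr mulmx1 mulmxDl addrC.
- by move=> i; have := graph_c efc (row i P); rewrite mulmx1.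
- move=> i; have := gT (row i (- P)).
  by rewrite -row_mul mulNmx mulmxN opprK.
- move=> i; rewrite /e' /f' /fam addrACA -linearD /= -linearD /= subrr row0 linear0 add0r.
  by rewrite -linearD mem_cmb.
Qed.

(** Let [h] be a power of [s2] moving [b] to a point strictly between [b] and
    [d], whose Lagrangian is the graph of [- T']. On the one hand [T' - T] is
    large compared with [1 + T], because [h] acts integrally in the basis
    adapted to [c, b, d]. On the other hand [T'] is at most a translate of [T]
    by a power of [s1], which acts integrally in the basis adapted to
    [a, c, b]. So the identity is at most an integral multiple of [T]. *)
Lemma crossing_half : integralmx v (invmx T).
Proof.
have posT := crossing_posdef.
have [C uC TC] := cholesky symT posT.
have pos1T : posdef (1%:M + T) by apply: posdefD => //; exact: posdef1.
have sym1T : (1%:M + T)^T = 1%:M + T by rewrite linearD /= trmx1 symT.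
have [D uD DE] := cholesky sym1T pos1T.
pose P := invmx D.
have hP : P *m (1%:M + T) *m P^T = 1%:M.
  by rewrite DE mulmxA mulVmx // mul1mx trmx_inv mulmxV // unitmx_tr.
have [hef' ec fd efb] := crossing_basis hP.
set e' := fam e f P P in hef' ec efb; set f' := fam e f (- P) (P *m T) in hef' fd efb.
have [cbd dac] := linked_rot acbd.
have int2 := zero_length_integral Sc Sd Sb cbd hef' ec fd efb hs2 s2c s2d L2.
have [_ [h [_ [hc hd [A hA actA]] _ bhd]]] :=
  sandwich (integral_on1 e' c d) (@integral_onM e' c d) (integral_onV hef') int2 hs2 s2c s2d cbd cbd.
have Sb' : S (bact h b) by apply: S_act.
have bha := oriented_trans' bhd bda.
have [_ tb'] := phi_transverse Sb Sb' Sa bha.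
have [M' [symM' gM']] := graph_exists Sb hef fb Sb' tb'.
pose T' := - M'.
have symT' : T'^T = T' by rewrite /T' linearN /= symM'.
have posD : posdef (T' - T).
  have hdb : positively_oriented (bact h b) d b by rewrite -oriented_rot.
  have := graph_mono Sb hef fb Sb' Sd hdb symM' (_ : (- T)^T = - T) gM' gT.
  by rewrite addrC; apply; rewrite linearN /= symT.
(* The image of [phi b] under [h], computed in the basis adapted to [c, b, d]
   and expressed in [(e, f)]. *)
have hT' : A *m P *m (1%:M + T') = invmx A^T *m P *m (T' - T).
  have E : A *m P + (invmx A)^T *m (P *m T) = (A *m P - (invmx A)^T *m P) *m M'.
    apply/row_matrixP => i; rewrite [RHS]row_mul.
    apply: (graph_uniq hef tb' fb gM').
    have efb' : cmb e' (delta_mx 0 i) + cmb f' (delta_mx 0 i) \in phi b.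
      by rewrite !cmb_delta.
    have := phi_act h Sb efb'; rewrite linearD /= actA (rho_f Sd hef' fd hd actA).
    rewrite !cmb_fam addrACA -!linearD /= -!rowE.
    have -> : row i (A *m P - (invmx A)^T *m P) = row i A *m P + row i (invmx A)^T *m - P.
      by rewrite linearB /= !row_mul mulmxN.
    suff -> : row i (A *m P + (invmx A)^T *m (P *m T)) =
        row i A *m P + row i (invmx A)^T *m (P *m T) by [].
    by rewrite linearD /= !row_mul.
  rewrite -trmx_inv /T' mulmxDr mulmx1 mulmxBr !mulmxN.
  move: E; rewrite mulmxA mulmxBl.
  set X := A *m P; set Y := (invmx A)^T *m P => E.
  have EX : X = X *m M' - Y *m M' - Y *m T by rewrite -E addrK.
  by rewrite {1}EX -!addrA addrC -!addrA addNr addr0.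
have ints1 := zero_length_integral Sa Sb Sc acb hef ea fb efc hs1 s1a s1b L1.
have [g [_ [[ga gb [B hB actB]] _ bgh _]]] :=
  sandwich (integral_on1 e a b) (@integral_onM e a b) (integral_onV hef) ints1 hs1 s1b s1a bda bha.
have gd := graph_act Sb hef fb gb actB Sd gT.
have ghb : positively_oriented (bact g d) (bact h b) b by rewrite -oriented_rot.
have symG : (invmx B *m - T *m (invmx B)^T)^T = invmx B *m - T *m (invmx B)^T.
  by rewrite !trmx_mul trmxK linearN /= symT mulmxA.
have posG := graph_mono Sb hef fb (S_act g Sd) Sb' ghb symG symM' gd gM'.
have iC : integralmx v (invmx C).
  apply: (integral_crossing hv uC _ symT' _ hA (integral_unitmxV hB)); rewrite -?TC //.
  - exact: hP.
  - exact: hT'.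
  - move=> z; rewrite -subr_ge0 -qformB.
    suff -> : invmx B *m T *m (invmx B)^T - T' = M' - invmx B *m - T *m (invmx B)^T.
      exact: posdef_ge0.
    by rewrite /T' opprK mulmxN mulNmx opprK addrC.
have -> : invmx T = (invmx C)^T *m invmx C.
  have uT : T \in unitmx by apply: posdef_unit.
  apply: (can_inj (mulKmx uT)); rewrite mulmxV // TC mulmxA -(mulmxA C) trmx_inv.
  by rewrite mulmxV ?unitmx_tr // mulmx1 mulmxV.
by apply: integralmxM => //; exact: integralmx_tr.
Qed.

End Basis.
End Crossing.

Section CrossingBarycenter.
Variables (s1 s2 : Gamma) (a c b d : option R).
Hypotheses (hs1 : hyperbolic (iota s1)) (hs2 : hyperbolic (iota s2)).
Hypotheses (s1a : bact s1 a = a) (s1b : bact s1 b = b) (s2c : bact s2 c = c) (s2d : bact s2 d = d).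
Hypotheses (L1 : translation_length v omega (rho s1) = 0%E)
  (L2 : translation_length v omega (rho s2) = 0%E).
Hypothesis acbd : linked a c b d.

(** By crossing_half the inverse of [T] is integral. In the basis adapted to
    [c, b, d] the Lagrangian [phi a] is the graph of minus [P T^-1 P^-1], so
    crossing_half for the axes in the other order shows that [P T P^-1] is
    integral; then so is its trace, which is that of [T], and [T] itself as it
    is positive definite. All the adapted bases now differ by integral
    matrices. *)
Lemma crossing_barycenter eta : barycenter a c b eta ->
  barycenter b d a eta /\ barycenter c b d eta.
Proof.
have Sa := S_fixed hs1 s1a; have Sb := S_fixed hs1 s1b.
have Sc := S_fixed hs2 s2c; have Sd := S_fixed hs2 s2d.
have [acb bda] := acbd; have cbda := linked_rot acbd.
case=> e [f [hef ea fb efc ->]].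
have [_ tdb] := phi_transverse Sb Sd Sa bda.
have [M [symM]] := graph_exists Sb hef fb Sd tdb; rewrite -[M]opprK.
set T := - M => gT; have symT : T^T = T by rewrite /T linearN /= symM.
have posT := crossing_posdef hs1 hs2 s1a s1b s2d acbd hef ea fb symT gT.
have uT := posdef_unit posT.
have iT := crossing_half hs1 hs2 s1a s1b s2c s2d L1 L2 acbd hef ea fb efc symT gT.
have [C uC TC] := cholesky symT posT.
have sym1T : (1%:M + T)^T = 1%:M + T by rewrite linearD /= trmx1 symT.
have [D uD DE] := cholesky sym1T (posdefD (@posdef1 F n) posT).
pose P := invmx D; have uP : P \in unitmx by rewrite unitmx_inv.
have hP : P *m (1%:M + T) *m P^T = 1%:M.
  by rewrite DE mulmxA mulVmx // mul1mx trmx_inv mulmxV // unitmx_tr.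
have [hef' ec fd efb] := crossing_basis hef fb efc symT gT hP.
set e' := fam e f P P in hef' ec efb; set f' := fam e f (- P) (P *m T) in hef' fd efb.
have invP : invmx P = (1%:M + T) *m P^T.
  by apply: (can_inj (mulKmx uP)); rewrite mulmxV // mulmxA hP.
(* The second use of crossing_half, for [c, b, d, a]. *)
have iT' : integralmx v (P *m T *m invmx P).
  pose T' := P *m invmx T *m invmx P.
  have -> : P *m T *m invmx P = invmx T'.
    have uT' : T' \in unitmx by rewrite /T' !unitmx_mul !unitmx_inv uT uD.
    apply: (can_inj (mulKmx uT')); rewrite mulmxV // /T' -!mulmxA mulKmx // (mulmxA (invmx T)).
    by rewrite mulVmx // mul1mx mulmxV.
  have symT' : T'^T = T'.
    rewrite /T' invP -!mulmxA (mulmxA (invmx T)) mulmxDr mulmx1 mulVmx // !trmx_mul trmxK.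
    by rewrite linearD /= trmx1 trmx_inv symT mulmxA.
  apply: (crossing_half hs2 hs1 s2c s2d s1b s1a L2 L1 cbda hef' ec fd efb symT') => x.
  rewrite !cmb_fam addrACA -!linearD /=.
  have -> : x *m P + x *m - T' *m (P *m T) = 0.
    rewrite mulmxN mulNmx /T' -!mulmxA (mulmxA (invmx P)) mulVmx // mul1mx mulVmx // mulmx1.
    exact: subrr.
  by rewrite linear0 addr0 mem_cmb.
have intT : integralmx v T.
  apply: (integral_posdef_tr hv symT posT).
  rewrite -(mulKmx uP T) mxtrace_mulC /mxtrace; apply: integral_sum => // i _; exact: iT'.
have iC : integralmx v C.
  by apply: (integral_gram hv) => i; rewrite -TC; apply: intT.
have iC' : integralmx v (invmx C).
  rewrite -[invmx C]trmxK; apply: integralmx_tr; apply: (integral_gram hv) => i; rewrite trmxK.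
  suff -> : (invmx C)^T *m invmx C = invmx T by exact: iT.
  apply: (can_inj (mulKmx uT)); rewrite mulmxV // TC mulmxA -(mulmxA C) trmx_inv.
  by rewrite mulmxV ?unitmx_tr // mulmx1 mulmxV.
have iP : integralmx v P.
  apply: (integral_gram_le1 hv) => x.
  rewrite -[X in _ <= qform X _]hP mulmxDr mulmx1 mulmxDl qformD lerDl qform_congr.
  exact: posdef_ge0.
have int0 : integralmx v (0 : 'M[F]_n) by move=> i j; rewrite mxE; exact: integral0.
split; last first.
  exists e', f'; split=> //; rewrite /e' /f' (norm_of_fam hv homega hef) //.
  - exact: integralmxN.
  - exact: integralmxM.
have hd : darboux omega (fam e f 0 C^T) (fam e f (- invmx C) 0).
  apply: (darboux_fam hef) => //; rewrite ?trmx0 ?mulmx0 ?mul0mx //.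
  by rewrite sub0r linearN /= mulmxN opprK trmx_inv mulmxV // unitmx_tr.
exists (fam e f 0 C^T), (fam e f (- invmx C) 0); split=> //.
- by move=> i; rewrite /fam row0 linear0 add0r mem_cmb.
- by move=> i; rewrite /fam row0 linear0 addr0 mem_cmb.
- move=> i; rewrite /fam !row0 !linear0 addr0 add0r addrC.
  suff -> : row i C^T = row i (- invmx C) *m (- T) by exact: gT.
  by rewrite -row_mul mulNmx mulmxN opprK TC mulmxA mulVmx // mul1mx.
- by rewrite (norm_of_fam hv homega hef) //; [exact: integralmx_tr | exact: integralmxN].
Qed.

End CrossingBarycenter.

(** * Propagation along the crossing graph *)

(** The norm [eta] is the barycenter seen from both sides of the axis of [s].
    At least one of the sides contains a point [c] of [S], so that [eta] is
    determined by the condition. *)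
Definition axis_barycenter s eta : Prop := exists a b c,
  [/\ bact s a = a, bact s b = b, S c & positively_oriented a c b] /\
  (forall x, S x -> positively_oriented a x b -> barycenter a x b eta) /\
  (forall x, S x -> positively_oriented b x a -> barycenter b x a eta).

Definition zero_length s : Prop :=
  hyperbolic (iota s) /\ translation_length v omega (rho s) = 0%E.

(** Apply crossing_barycenter to the two axes in both orders, then move the
    third point along each of the four sides. *)
Lemma linked_axis_barycenter s1 s2 a c b d eta : zero_length s1 -> zero_length s2 ->
  bact s1 a = a -> bact s1 b = b -> bact s2 c = c -> bact s2 d = d ->
  linked a c b d -> barycenter a c b eta -> axis_barycenter s1 eta /\ axis_barycenter s2 eta.
Proof.
move=> [h1 L1] [h2 L2] s1a s1b s2c s2d acbd bar.
have Sa := S_fixed h1 s1a; have Sb := S_fixed h1 s1b.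
have Sc := S_fixed h2 s2c; have Sd := S_fixed h2 s2d.
have [bda' cbd'] := crossing_barycenter h1 h2 s1a s1b s2c s2d L1 L2 acbd bar.
have cbda := linked_rot acbd.
have [dac' _] := crossing_barycenter h2 h1 s2c s2d s1b s1a L2 L1 cbda cbd'.
case: acbd cbda => acb bda [cbd dac]; split.
- exists a, b, c; split=> //; split=> x Sx h.
  + exact: (barycenter_move Sa Sb h1 s1a s1b L1 Sc Sx).
  + exact: (barycenter_move Sb Sa h1 s1b s1a L1 Sd Sx).
- exists c, d, b; split=> //; split=> x Sx h.
  + exact: (barycenter_move Sc Sd h2 s2c s2d L2 Sb Sx).
  + exact: (barycenter_move Sd Sc h2 s2d s2c L2 Sa Sx).
Qed.

Lemma axis_barycenter_fixed s eta : zero_length s -> axis_barycenter s eta ->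
  building_act (rho s) eta = eta.
Proof.
move=> [hs L0] [a [b [c [[sa sb Sc acb] [h _]]]]].
exact: (barycenter_fixed (S_fixed hs sa) (S_fixed hs sb) hs sa sb L0 Sc acb (h _ Sc acb)).
Qed.

Lemma axis_endpoints s a b (z : R[i]) : hyperbolic (iota s) -> a != b -> bact s a = a -> bact s b = b ->
  axis (iota s) z -> geodesic a b z.
Proof.
move=> hs ab sa sb [x [y [xy sx sy g]]].
have hx := hyperbolic_fixed hs ab sa sb sx; have hy := hyperbolic_fixed hs ab sa sb sy.
case: hx hy g xy => -> [] ->; rewrite ?eqxx //.
by rewrite geodesicC.
Qed.

Variable X : set Gamma.
Hypothesis hX : connected_generating_set iota X.
Hypothesis X_zero : forall s, X s -> zero_length s.

(** Two axes that meet either cross transversally, and then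
    linked_axis_barycenter applies, or coincide. *)
Lemma axis_barycenter_step s t eta : crossing iota X s t ->
  axis_barycenter s eta -> axis_barycenter t eta.
Proof.
move=> [Xs Xt [z [zs zt]]] [a [b [c0 [[sa sb Sc0 acb] [hab hba]]]]].
have [hs Ls] := X_zero Xs; have [ht Lt] := X_zero Xt.
have [_ _ ab] := oriented_neq acb.
have gab := axis_endpoints hs ab sa sb zs.
case: (zt) => c [d [cd tc td gcd]].
have Sc := S_fixed ht tc; have Sd := S_fixed ht td.
case: (geodesic_linked gab gcd) => [[ca db]|[cb da]|[acb' bda]|[bca adb]].
- by exists a, b, c0; split; [rewrite -{1 2}ca -{1 2}db | split].
- by exists a, b, c0; split; [rewrite -{1 2}cb -{1 2}da | split].
- by have [] := linked_axis_barycenter (X_zero Xs) (X_zero Xt) sa sb tc td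
    (conj acb' bda) (hab _ Sc acb').
- by have [] := linked_axis_barycenter (X_zero Xs) (X_zero Xt) sa sb td tc
    (conj adb bca) (hab _ Sd adb).
Qed.

Lemma clos_crossing_ind (P : Gamma -> Prop) s t :
  (forall s t, crossing iota X s t -> P s -> P t) ->
  Relation_Operators.clos_refl_trans Gamma (crossing iota X) s t -> P s -> P t.
Proof.
move=> h; elim=> [s' t'|//|s' t' u' _ h1 _ h2 Ps]; first exact: h.
exact/h2/h1.
Qed.

Lemma building_actE g (eta : V -> \bar R) u : building_act (rho g) eta u = eta (rho g^-1%g u).
Proof. by rewrite /building_act rhoV. Qed.

Lemma fixed_one (eta : V -> \bar R) : building_act (rho 1%g) eta = eta.
Proof. by apply/funext => u; rewrite building_actE invg1 rho1. Qed.

Lemma fixed_mul g h (eta : V -> \bar R) :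
  building_act (rho g) eta = eta -> building_act (rho h) eta = eta ->
  building_act (rho (g * h)%g) eta = eta.
Proof.
move=> hg hh; apply/funext => u.
by rewrite building_actE invgM rhoM -(building_actE h) hh -(building_actE g) hg.
Qed.

Lemma fixed_inv g (eta : V -> \bar R) :
  building_act (rho g) eta = eta -> building_act (rho g^-1%g) eta = eta.
Proof.
move=> hg; apply/funext => u.
by rewrite building_actE invgK -{1}hg building_actE -rhoM mulVg rho1.
Qed.

Lemma fixed_exp g k (eta : V -> \bar R) :
  building_act (rho g) eta = eta -> building_act (rho (g ^+ k)%g) eta = eta.
Proof.
move=> hg; elim: k => [|k IHk]; first by rewrite expg0 fixed_one.
by rewrite expgS fixed_mul.
Qed.

Lemma fixed_generated (eta : V -> \bar R) : (forall s, X s -> building_act (rho s) eta = eta) ->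
  forall g, building_act (rho g) eta = eta.
Proof.
move=> fX g; case: hX => gen _ _.
suff HT : [set g | building_act (rho g) eta = eta] = setT.
  by have : [set g | building_act (rho g) eta = eta] g by rewrite HT.
apply: gen => //; [exact: fixed_one | by move=> g1 g2; exact: fixed_mul | by move=> g1; exact: fixed_inv].
Qed.

Definition linked_axes : Prop := exists s t a c b d,
  [/\ X s, X t & linked a c b d] /\
  [/\ bact s a = a, bact s b = b, bact t c = c & bact t d = d].

Lemma linked_axes_fixed : linked_axes ->
  exists2 eta, building v omega eta & forall g, building_act (rho g) eta = eta.
Proof.
move=> [s [t [a [c [b [d [[Xs Xt acbd] [sa sb tc td]]]]]]]].
have [hs _] := X_zero Xs; have [ht _] := X_zero Xt.
have [acb _] := acbd.
have [eta bar] := barycenter_exists (S_fixed hs sa) (S_fixed ht tc) (S_fixed hs sb) acb.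
exists eta; first exact: barycenter_building bar.
have [bs _] := linked_axis_barycenter (X_zero Xs) (X_zero Xt) sa sb tc td acbd bar.
apply: fixed_generated => u Xu; apply: axis_barycenter_fixed; first exact: X_zero.
case: hX => _ _ conn; apply: (@clos_crossing_ind (axis_barycenter^~ eta) s u _ (conn s u Xs Xu) bs) => p q.
exact: axis_barycenter_step.
Qed.

(** Axes that meet without being linked coincide, so by connectedness all
    generators share one axis, and [Gamma] fixes its endpoints. *)
Lemma unlinked_axes_fixed s0 : X s0 -> ~ linked_axes ->
  exists a b, a != b /\ forall g, bact g a = a /\ bact g b = b.
Proof.
move=> Xs0 nl; have [hs0 _] := X_zero Xs0.
have [a [b [ab sa sb]]] := hyperbolic_fixed_points hs0; exists a, b; split=> //.
have step s t : crossing iota X s t -> bact s a = a /\ bact s b = b -> bact t a = a /\ bact t b = b.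
  move=> [Xs Xt [z [zs zt]]] [fa fb]; have [hs _] := X_zero Xs.
  have gab := axis_endpoints hs ab fa fb zs.
  case: (zt) => c [d [cd tc td gcd]].
  case: (geodesic_linked gab gcd) => [[<- <-]|[<- <-]|[h1 h2]|[h1 h2]] //.
  - by case: nl; exists s, t, a, c, b, d.
  - by case: nl; exists s, t, a, d, b, c.
move=> g; case: hX => gen _ conn.
suff HT : [set g | bact g a = a /\ bact g b = b] = setT.
  by have : [set g | bact g a = a /\ bact g b = b] g by rewrite HT.
apply: gen.
- by rewrite /= !bact1.
- by move=> g1 g2 /= [a1 b1] [a2 b2]; rewrite !bactM a2 b2.
- by move=> g1 /= [a1 b1]; rewrite !bactV_fix.
- move=> t Xt /=; apply: (clos_crossing_ind step (conn s0 t Xs0 Xt)); exact: (conj sa sb).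
Qed.

(** * Elementary groups *)

(** The stabilizer of two boundary points consists of homotheties, up to
    conjugation. By discreteness the ratios of those coming from [Gamma] have
    a gap after 1. *)
Lemma elementary_cyclic a b : a != b -> injective iota -> discrete_image iota ->
  (forall g, bact g a = a /\ bact g b = b) -> (exists s, hyperbolic (iota s)) ->
  exists g0, forall g, exists k, g = (g0 ^+ k)%g \/ g = (g0^-1 ^+ k)%g.
Proof.
move=> ab inj_iota [eps e0 disc] fixab [s hs].
have [h [ha hb]] := boundary_transitive ab.
pose cjg g := (h^-1 * (iota g * h))%g.
have cjgK g : iota g = (h * cjg g * h^-1)%g by rewrite /cjg !mulgA mulgV mul1g mulgK.
have cjg_fix g : exists2 alpha, 0 < alpha & cjg g = homothety alpha.
  have [ga gb] := fixab g; apply: fixed_homothety; rewrite /cjg !boundary_mul.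
    by rewrite ha -[boundary_act (iota g) a]/(bact g a) ga -ha boundaryK.
  by rewrite hb -[boundary_act (iota g) b]/(bact g b) gb -hb boundaryK.
have cjgM g1 g2 : cjg (g1 * g2)%g = (cjg g1 * cjg g2)%g.
  by rewrite /cjg gmulfM -!mulgA mulVKg.
have cjgV g : cjg g^-1%g = (cjg g)^-1%g.
  by apply: (mulgI (cjg g)); rewrite -cjgM !mulgV /cjg iota1 mul1g mulVg.
have cjg_inj : injective cjg.
  by move=> g1 g2 E; apply: inj_iota; rewrite cjgK E -cjgK.
pose L (alpha : R) := 0 < alpha /\ exists g, cjg g = homothety alpha.
have [delta d0 hdelta] := homothety_gap h e0.
have homV (alpha : R) : 0 < alpha -> homothety alpha^-1 = (homothety alpha)^-1%g.
  move=> a0; have an0 : alpha != 0 by rewrite gt_eqF.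
  by apply: (mulgI (homothety alpha)); rewrite -homothetyM ?invr_eq0 // mulgV divff // homothety1.
have gap : forall x : R, L x -> 1 <= x -> x < 1 + delta -> x = 1.
  move=> x [x0 [g gx]] x1 xd; have [A [EA An Aone]] := hdelta x x1 xd.
  apply: Aone; apply: disc => //.
  by exists g => //; rewrite cjgK gx.
have Ldiv : forall x y : R, L x -> L y -> L (x / y).
  move=> x y [x0 [g gx]] [y0 [g' gy]]; split; first exact: divr_gt0.
  exists (g * g'^-1)%g; rewrite cjgM cjgV gx gy -homV // -homothetyM ?invr_eq0 ?gt_eqF //.
have Lone : exists2 x : R, L x & 1 < x.
  have [x x0 sx] := cjg_fix s.
  have x1 : x != 1.
    apply: contraPneq hs => x1; have s1 : s = 1%g.
      by apply: cjg_inj; rewrite sx x1 homothety1 /cjg iota1 mul1g mulVg.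
    rewrite s1 iota1 -[1%g]/(\pi_(PSL2 R) (SL2_one R))%qT pi_hyperbolic /= mxtrace1.
    by rewrite ger0_norm ?ltxx.
  case: (ltgtP x 1) x1 => // [x1|x1] _; last by exists x => //; split=> //; exists s.
  exists x^-1; last by rewrite invf_gt1.
  split; first by rewrite invr_gt0.
  by exists s^-1%g; rewrite cjgV sx homV.
have [x0 [[x0p [g0 g0x]] x01] hx] := gap_cyclic d0 (fun (x : R) (Lx : L x) => Lx.1) Ldiv gap Lone.
exists g0; have cjgX g k : cjg (g ^+ k)%g = (cjg g ^+ k)%g.
  elim: k => [|k IHk]; first by rewrite !expg0 /cjg iota1 mul1g mulVg.
  by rewrite !expgS cjgM IHk.
have homX k : homothety (x0 ^+ k) = (homothety x0 ^+ k)%g.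
  elim: k => [|k IHk]; first by rewrite expr0 expg0 homothety1.
  by rewrite exprS expgS homothetyM ?expf_neq0 ?gt_eqF // IHk.
move=> g; have [x xp gx] := cjg_fix g.
have [x1|x1] := leP 1 x.
  have [k xk] := hx x (conj xp (ex_intro _ g gx)) x1; exists k; left; apply: cjg_inj.
  by rewrite cjgX g0x -homX -xk.
have LV : L x^-1 by split; [rewrite invr_gt0 | exists g^-1%g; rewrite cjgV gx homV].
have xV1 : 1 <= x^-1 by rewrite invf_ge1 // ltW.
have [k xk] := hx _ LV xV1; exists k; right; apply: cjg_inj.
by rewrite cjgX cjgV g0x gx -[x]invrK xk homV ?exprn_gt0 // homX expVgn.
Qed.

(** A lattice of [l] preserved by [rho g0] and its dual lattice give a Darboux
    basis in which the diagonal blocks of [rho g0] are integral. The only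
    other block maps [f'] to [e'], and raising the weight of [e'] to [tau]
    compensates for its denominators. *)
Lemma lagrangian_fixed g0 l m : lagrangian omega l -> (forall u, u \in l -> rho g0 u \in l) ->
  translation_length v omega (rho (g0 ^+ m.+1)%g) = 0%E ->
  exists2 eta, building v omega eta & building_act (rho g0) eta = eta.
Proof.
move=> hl stab L0; have [e [f [hef el]]] := darboux_extension homega hl.
have [A hA] := acts_by_exists homega hef hl el stab.
have hAm : acts_by (rho (g0 ^+ m.+1)%g) e (mxpow A m.+1).
  move=> x; rewrite -(acts_by_iter m.+1 hA); elim: (m.+1) => [|k IHk]; first by rewrite expg0 rho1.
  by rewrite expgS rhoM IHk.
have [slowA _] := acts_by_slow hv homega hef (rho_omega _) hAm L0.
have uA := acts_by_unit homega hef (rho_omega g0) hA.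
have dA : v (\det A) = 0%E.
  have dA0 : \det A != 0 by rewrite -unitfE -unitmxE.
  have := acts_by_det hv homega hef (rho_omega _) hAm L0.
  rewrite det_mxpow valX // => -[] /eqP; rewrite mulf_eq0 pnatr_eq0 /= => /eqP fA.
  by rewrite -(fineK (val_fin hv dA0)) fA.
have [P uP [uX iX iX']] := slow_lattice hv slowA dA.
set Y := P *m A *m invmx P in uX iX iX'.
pose e' := fam e f P 0; pose f' := fam e f 0 (invmx P)^T.
have hef' : darboux omega e' f'.
  apply: (darboux_fam hef) => //; rewrite ?trmx0 ?mulmx0 ?mul0mx //.
  by rewrite subr0 trmxK mulmxV.
have hY : acts_by (rho g0) e' Y.
  move=> x; rewrite !cmb_fam !mulmx0 !linear0 !addr0 hA /Y.
  by rewrite !mulmxA mulmxKV.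
have [c hc] := val_family_lb hv (fun p : 'I_n * 'I_n => omega (rho g0 (f' p.1)) (f' p.2)).
pose tau := - c / 2.
exists (norm_of v omega e' f' (fun=> tau)); first exact: building_norm_of.
rewrite (norm_of_act _ homega (rho_omega g0)); apply: norm_of_eq => //.
- exact: (symplectic_darboux_map (rho_omega g0) hef').
- move=> i j; rewrite -(cmb_delta e' i) hY -[cmb e' _]addr0 -(linear0 (cmb f')) (darboux_x hef').
  by rewrite -rowE mxE; apply: iX.
- by move=> i j; rewrite -(cmb_delta e' i) -(cmb_delta e' j) hY (darboux_ee hef') val0 // leey.
- move=> i j; rewrite -(symplecticV homega (rho_omega g0)) (symplecticK homega (rho_omega g0)).
  rewrite -(cmb_delta e' j) (acts_byV homega hef' (rho_omega g0) hY).
  rewrite -[cmb e' _]addr0 -(linear0 (cmb f')) (darboux_x hef') -rowE mxE.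
  exact: iX'.
- move=> i j; apply: le_trans (hc (i, j)); rewrite lee_fin /tau; lra.
Qed.

Lemma elementary_fixed s0 : surface_group iota -> X s0 -> ~ linked_axes ->
  exists2 eta, building v omega eta & forall g, building_act (rho g) eta = eta.
Proof.
move=> [inj_iota disc _ _] Xs0 nl; have [hs0 L0] := X_zero Xs0.
have [a [b [ab fixab]]] := unlinked_axes_fixed Xs0 nl.
have [g0 hg0] := elementary_cyclic ab inj_iota disc fixab (ex_intro _ s0 hs0).
have [g1 [k [s0k pow]]] : exists g1 k, s0 = (g1 ^+ k)%g /\
    forall g, exists j, g = (g1 ^+ j)%g \/ g = (g1^-1 ^+ j)%g.
  have [k [s0k|s0k]] := hg0 s0; [exists g0, k | exists g0^-1%g, k]; split=> // g.
  have [j [->|->]] := hg0 g; exists j; rewrite ?invgK; tauto.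
have Sa : S a by apply: (S_fixed hs0); case: (fixab s0).
case: k s0k => [|m] s0k.
  exfalso; move: hs0; rewrite s0k expg0 iota1 -[1%g]/(\pi_(PSL2 R) (SL2_one R))%qT.
  by rewrite pi_hyperbolic /= mxtrace1 ger0_norm ?ltxx.
rewrite s0k in L0; have stab u : u \in phi a -> rho g1 u \in phi a.
  by apply: fix_phi => //; case: (fixab g1).
have [eta beta fixg1] := lagrangian_fixed (phi_lagrangian Sa) stab L0.
exists eta => // g; have [j [->|->]] := pow g; apply: fixed_exp => //.
exact: fixed_inv.
Qed.

(** Without generators [Gamma] is trivial, and the building is not empty. *)
Lemma trivial_fixed : ~ (exists s, X s) ->
  exists2 eta, building v omega eta & forall g, building_act (rho g) eta = eta.
Proof.
move=> nX; have [l hl] := lagrangian_exists homega.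
have [e [f [hef _]]] := darboux_extension homega hl.
exists (norm_of v omega e f (fun=> 0)); first exact: building_norm_of.
by apply: fixed_generated => s Xs; case: nX; exists s.
Qed.
End Framing.

(** * Global fixed points *)

Theorem corollary7p6 (R : realType)
    (Gamma : groupType) (iota : {multiplicative Gamma -> PSL2 R})
    (hGamma : surface_group iota)
    (X : set Gamma) (hX : connected_generating_set iota X)
    (F : rcfType) (v : F -> \bar R) (hv : order_compatible_valuation v)
    (V : vectType F) (omega : {skew_symmetric V})
    (homega : nondegenerate omega)
    (rho : Gamma -> 'End(V)) (hrho : symplectic_representation omega rho)
    (hframing : admits_maximal_framing omega iota rho) :
  (exists2 eta, building v omega eta &
     forall g : Gamma, building_act (rho g) eta = eta) <->
  (forall s : Gamma, X s -> translation_length v omega (rho s) = 0%E).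
Proof.
split=> [[eta beta fix_eta] s _|L0].
  exact: translation_length_fixed beta (fix_eta s).
have [S [phi hphi]] := hframing.
have X_zero s : X s -> zero_length iota v omega rho s.
  by move=> Xs; split; [case: hX => _ + _; apply | exact: L0].
have [linked|unlinked] := pselect (linked_axes iota X).
  exact: (linked_axes_fixed hv homega hrho hphi hX X_zero linked).
have [[s0 Xs0]|X0] := pselect (exists s, X s).
  exact: (elementary_fixed hv homega hrho hphi hX X_zero hGamma Xs0 unlinked).
exact: (trivial_fixed v homega hrho hX X0).
Qed.
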